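(* Let $f(z;\tau)$, $z\in\mathbb{C}$, $\tau\in\mathbb{H}$, be the function defined in the context. (a) There exists a unique group homomorphism $\psi:\mathrm{SL}_2(\mathbb{Z})\to \mathrm{N}(K_4)$ such that $$f\big(j(\gamma,\tau)^{-1}z;\gamma\cdot\tau\big)=\psi(\gamma)\cdot f(z;\tau)\qquad\forall\,\gamma\in\mathrm{SL}_2(\mathbb{Z}),\ z\in\mathbb{C},\ \tau\in\mathbb{H},$$ where $\psi(\gamma)\in\mathrm{N}(K_4)\subset\mathrm{PSU}(2)$ acts by linear fractional transformations. (b) $\psi$ is surjective. Its kernel is the subgroup of $\mathrm{SL}_2(\mathbb{Z})$ generated by $\pm\mathrm{I}_2$ and the principal congruence subgroup $\Gamma(4)$. The inverse image $\psi^{-1}(K_4)$ is the principal congruence subgroup $\Gamma(2)$. (c) $\psi\begin{pmatrix}1&1\\0&1\end{pmatrix}$ is the image in $\mathrm{PSU}(2)$ of $\begin{pmatrix}e^{\pi\sqrt{-1}/4}&0\\0&e^{-\pi\sqrt{-1}/4}\end{pmatrix}$, and $\psi\begin{pmatrix}0&1\\-1&0\end{pmatrix}$ is the image in $\mathrm{PSU}(2)$ of $\frac{\sqrt{-1}}{\sqrt2}\begin{pmatrix}-1&1\\1&1\end{pmatrix}$.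
   Context: $\mathbb{H}$ is the upper half plane, $\Lambda_\tau=\mathbb{Z}+\mathbb{Z}\tau$. For $\gamma=\begin{pmatrix}a&b\\c&d\end{pmatrix}$, $\gamma\cdot\tau=\frac{a\tau+b}{c\tau+d}$ and $j(\gamma,\tau)=c\tau+d$. $\Gamma(N)=\{\gamma\in\mathrm{SL}_2(\mathbb{Z}):\gamma\equiv\mathrm{I}_2\bmod N\}$. $K_4\subset\mathrm{PSU}(2)$ is the subgroup, isomorphic to $(\mathbb{Z}/2\mathbb{Z})^2$, consisting of the images of $\begin{pmatrix}1&0\\0&1\end{pmatrix}$, $\begin{pmatrix}\sqrt{-1}&0\\0&-\sqrt{-1}\end{pmatrix}$, $\begin{pmatrix}0&\sqrt{-1}\\\sqrt{-1}&0\end{pmatrix}$, $\begin{pmatrix}0&1\\-1&0\end{pmatrix}$; $\mathrm{N}(K_4)$ is its normalizer in $\mathrm{PSU}(2)$. $f(z;\tau)$ is the meromorphic function of $z\in\mathbb{C}$ $$f(z;\tau)=\frac{\wp(\frac\tau4)-\wp(\frac14+\frac\tau2)}{\wp(\frac\tau4)-\wp(\frac14)}\cdot\frac{\wp(\frac z2)-\wp(\frac14)}{\wp(\frac z2)-\wp(\frac14+\frac\tau2)},\qquad \wp=\wp(\cdot;\Lambda_\tau).$$ It is a developing map of the unique solution $u$ of $\triangle u+e^u=4\pi\delta_0$ on $\mathbb{C}/\Lambda_\tau$ (i.e. $u=\log\frac{8|f'|^2}{(1+|f|^2)^2}$), and it is the unique meromorphic function on $\mathbb{C}$ with: no zeros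 or poles outside $\frac12+\Lambda_\tau$; $f(z+1)=-f(z)$, $f(z+\tau)=1/f(z)$; $f(\frac\tau2)=1$; a simple zero at $z=\frac12$. *)

(* Defs.v *)
From HB Require Import structures.
From mathcomp Require Import all_boot all_order all_algebra.
From mathcomp Require Import spectral complex.
From mathcomp Require Import all_classical all_reals all_analysis.
From mathcomp.analysis.showcase Require Import summability.

Set Implicit Arguments.
Unset Strict Implicit.
Unset Printing Implicit Defensive.

Import Order.TTheory GRing.Theory Num.Theory.
Import numFieldNormedType.Exports.

Local Open Scope classical_set_scope.
Local Open Scope ring_scope.
Local Open Scope quotient_scope.

Definition mx2 (K : Type) (a b c d : K) : 'M[K]_2 :=
  \matrix_(i, j) if i == 0 then (if j == 0 then a else b)
                 else (if j == 0 then c else d).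

Lemma det_mx2 (K : comPzRingType) (a b c d : K) :
  \det (mx2 a b c d) = a * d - b * c.
Proof.
rewrite (expand_det_row _ ord0) !big_ord_recl big_ord0 addr0 /cofactor.
rewrite !det_mx11 !mxE /= expr0 expr1 !mul1r.
by rewrite mulN1r mulrN.
Qed.

Definition normalizer (G : groupType) (H : set G) : set G :=
  [set x | [set (h ^ x)%g | h in H] = H].

Definition generated (G : groupType) (A : set G) : set G :=
  smallest [set H : set G | group_closed [in H]] A.

Record SL2Z := MkSL2Z { SL2Z_mx :> 'M[int]_2; _ : \det SL2Z_mx == 1 }.

HB.instance Definition _ := [isSub for SL2Z_mx].
HB.instance Definition _ := [Choice of SL2Z by <:].

Lemma SL2Z_det (g : SL2Z) : \det g = 1.
Proof. by case: g => A /= /eqP. Qed.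

Lemma SL2Z_unit (g : SL2Z) : (g : 'M[int]_2) \in unitmx.
Proof. by rewrite unitmxE SL2Z_det unitr1. Qed.

Fact SL2Z_one_subproof : \det (1%:M : 'M[int]_2) == 1.
Proof. by rewrite det1. Qed.

Fact SL2Z_mul_subproof (g h : SL2Z) : \det (g *m h) == 1.
Proof. by rewrite det_mulmx !SL2Z_det mulr1. Qed.

Fact SL2Z_inv_subproof (g : SL2Z) : \det (invmx g) == 1.
Proof. by rewrite det_inv SL2Z_det invr1. Qed.

Definition SL2Z_one := MkSL2Z SL2Z_one_subproof.
Definition SL2Z_mul g h := MkSL2Z (SL2Z_mul_subproof g h).
Definition SL2Z_inv g := MkSL2Z (SL2Z_inv_subproof g).

Fact SL2Z_mulA : associative SL2Z_mul.
Proof. by move=> x y z; apply/val_inj; rewrite /= mulmxA. Qed.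
Fact SL2Z_mul1g : left_id SL2Z_one SL2Z_mul.
Proof. by move=> x; apply/val_inj; rewrite /= mul1mx. Qed.
Fact SL2Z_mulg1 : right_id SL2Z_one SL2Z_mul.
Proof. by move=> x; apply/val_inj; rewrite /= mulmx1. Qed.
Fact SL2Z_mulVg : left_inverse SL2Z_one SL2Z_inv SL2Z_mul.
Proof. by move=> x; apply/val_inj; rewrite /= mulVmx ?SL2Z_unit. Qed.
Fact SL2Z_mulgV : right_inverse SL2Z_one SL2Z_inv SL2Z_mul.
Proof. by move=> x; apply/val_inj; rewrite /= mulmxV ?SL2Z_unit. Qed.

HB.instance Definition _ := isGroup.Build SL2Z
  SL2Z_mulA SL2Z_mul1g SL2Z_mulg1 SL2Z_mulVg SL2Z_mulgV.

Fact SL2Z_T_subproof : \det (mx2 1 1 0 1 : 'M[int]_2) == 1.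
Proof. by rewrite det_mx2. Qed.
Definition SL2Z_T := MkSL2Z SL2Z_T_subproof.

Fact SL2Z_S_subproof : \det (mx2 0 1 (-1) 0 : 'M[int]_2) == 1.
Proof. by rewrite det_mx2. Qed.
Definition SL2Z_S := MkSL2Z SL2Z_S_subproof.

Definition Gamma (N : nat) : set SL2Z :=
  [set g : SL2Z | forall i j, (g i j = (1%:M : 'M[int]_2) i j %[mod N])%Z].

Section PSU2.
Variable C : numClosedFieldType.

Record SU2 := MkSU2 {
  SU2_mx :> 'M[C]_2; _ : (SU2_mx \is unitarymx) && (\det SU2_mx == 1) }.

HB.instance Definition _ := [isSub for SU2_mx].
HB.instance Definition _ := [Choice of SU2 by <:].

Lemma SU2_unitary (A : SU2) : (A : 'M[C]_2) \is unitarymx.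
Proof. by case: A => A /= /andP[]. Qed.

Lemma SU2_det (A : SU2) : \det A = 1.
Proof. by case: A => A /= /andP[_ /eqP]. Qed.

Lemma SU2_unit (A : SU2) : (A : 'M[C]_2) \in unitmx.
Proof. by rewrite unitmxE SU2_det unitr1. Qed.

Fact SU2_one_subproof :
  ((1%:M : 'M[C]_2) \is unitarymx) && (\det (1%:M : 'M[C]_2) == 1).
Proof.
by rewrite det1 eqxx andbT; apply/unitarymxP; rewrite trmx1 map_mx1 mulmx1.
Qed.

Fact SU2_mul_subproof (A B : SU2) :
  (A *m B \is unitarymx) && (\det (A *m B) == 1).
Proof. by rewrite det_mulmx !SU2_det mulr1 eqxx mul_unitarymx ?SU2_unitary. Qed.

Fact SU2_inv_subproof (A : SU2) :
  (invmx A \is unitarymx) && (\det (invmx A) == 1).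
Proof.
rewrite det_inv SU2_det invr1 eqxx andbT invmx_unitary ?SU2_unitary//.
by rewrite trmxC_unitary SU2_unitary.
Qed.

Definition SU2_one := MkSU2 SU2_one_subproof.
Definition SU2_mul A B := MkSU2 (SU2_mul_subproof A B).
Definition SU2_inv A := MkSU2 (SU2_inv_subproof A).

Fact SU2_mulA : associative SU2_mul.
Proof. by move=> x y z; apply/val_inj; rewrite /= mulmxA. Qed.
Fact SU2_mul1g : left_id SU2_one SU2_mul.
Proof. by move=> x; apply/val_inj; rewrite /= mul1mx. Qed.
Fact SU2_mulg1 : right_id SU2_one SU2_mul.
Proof. by move=> x; apply/val_inj; rewrite /= mulmx1. Qed.
Fact SU2_mulVg : left_inverse SU2_one SU2_inv SU2_mul.
Proof. by move=> x; apply/val_inj; rewrite /= mulVmx ?SU2_unit. Qed.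
Fact SU2_mulgV : right_inverse SU2_one SU2_inv SU2_mul.
Proof. by move=> x; apply/val_inj; rewrite /= mulmxV ?SU2_unit. Qed.

HB.instance Definition _ := isGroup.Build SU2
  SU2_mulA SU2_mul1g SU2_mulg1 SU2_mulVg SU2_mulgV.

Definition eq_upto_sign (A B : SU2) :=
  ((A : 'M[C]_2) == B) || ((A : 'M[C]_2) == - (B : 'M[C]_2)).

Fact eq_upto_sign_refl : reflexive eq_upto_sign.
Proof. by move=> A; rewrite /eq_upto_sign eqxx. Qed.

Fact eq_upto_sign_sym : symmetric eq_upto_sign.
Proof.
move=> A B; rewrite /eq_upto_sign [RHS]orbC [in RHS]eq_sym eqr_oppLR orbC.
by rewrite [X in _ || X]eq_sym eq_sym.
Qed.

Fact eq_upto_sign_trans : transitive eq_upto_sign.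
Proof.
move=> B A D; rewrite /eq_upto_sign.
by case/orP=> /eqP-> /orP[]/eqP->; rewrite ?opprK eqxx ?orbT.
Qed.

Canonical eq_upto_sign_equiv :=
  EquivRel eq_upto_sign eq_upto_sign_refl eq_upto_sign_sym eq_upto_sign_trans.

Definition PSU2 := {eq_quot eq_upto_sign}.

HB.instance Definition _ : EqQuotient _ eq_upto_sign PSU2 := EqQuotient.on PSU2.
HB.instance Definition _ := Choice.on PSU2.

Lemma PSU2_eqP (A B : SU2) :
  reflect ((A : 'M[C]_2) = B \/ (A : 'M[C]_2) = - (B : 'M[C]_2))
          (A == B %[mod PSU2]).
Proof.
rewrite eqmodE /= /eq_upto_sign.
by apply: (iffP orP) => -[] h; [left|right|left|right]; apply/eqP.
Qed.

Lemma PSU2_repr (A : SU2) :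
  (repr (\pi_PSU2 A) : 'M[C]_2) = A \/
  (repr (\pi_PSU2 A) : 'M[C]_2) = - (A : 'M[C]_2).
Proof. by apply/PSU2_eqP; rewrite reprK. Qed.

Definition PSU2_one : PSU2 := lift_cst PSU2 SU2_one.
Definition PSU2_mul : PSU2 -> PSU2 -> PSU2 := lift_op2 PSU2 SU2_mul.
Definition PSU2_inv : PSU2 -> PSU2 := lift_op1 PSU2 SU2_inv.

Canonical pi_PSU2_one_morph := PiConst PSU2_one.

Fact pi_PSU2_mul : {morph \pi_PSU2 : A B / SU2_mul A B >-> PSU2_mul A B}.
Proof.
move=> A B; unlock PSU2_mul; apply/eqP/PSU2_eqP => /=.
case: (PSU2_repr A) => ->; case: (PSU2_repr B) => ->;
  rewrite ?mulmxN ?mulNmx ?opprK; by [left | right].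
Qed.
Canonical pi_PSU2_mul_morph := PiMorph2 pi_PSU2_mul.

Fact pi_PSU2_inv : {morph \pi_PSU2 : A / SU2_inv A >-> PSU2_inv A}.
Proof.
move=> A; unlock PSU2_inv; apply/eqP/PSU2_eqP => /=.
rewrite !invmx_unitary ?SU2_unitary//.
by case: (PSU2_repr A) => ->; [left | right]; rewrite // linearN map_mxN opprK.
Qed.
Canonical pi_PSU2_inv_morph := PiMorph1 pi_PSU2_inv.

Fact PSU2_mulA : associative PSU2_mul.
Proof.
by move=> x y z; rewrite -[x]reprK -[y]reprK -[z]reprK !piE SU2_mulA.
Qed.
Fact PSU2_mul1g : left_id PSU2_one PSU2_mul.
Proof. by move=> x; rewrite -[x]reprK !piE SU2_mul1g. Qed.
Fact PSU2_mulg1 : right_id PSU2_one PSU2_mul.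
Proof. by move=> x; rewrite -[x]reprK !piE SU2_mulg1. Qed.
Fact PSU2_mulVg : left_inverse PSU2_one PSU2_inv PSU2_mul.
Proof. by move=> x; rewrite -[x]reprK !piE SU2_mulVg. Qed.
Fact PSU2_mulgV : right_inverse PSU2_one PSU2_inv PSU2_mul.
Proof. by move=> x; rewrite -[x]reprK !piE SU2_mulgV. Qed.

HB.instance Definition _ := isGroup.Build PSU2
  PSU2_mulA PSU2_mul1g PSU2_mulg1 PSU2_mulVg PSU2_mulgV.

Definition is_image_of (x : PSU2) (A : 'M[C]_2) :=
  exists2 U : SU2, (U : 'M[C]_2) = A & x = \pi_PSU2 U.

Definition K4 : set PSU2 :=
  [set x | exists2 A, is_image_of x A &
     A \in [:: 1%:M; mx2 'i 0 0 (- 'i); mx2 0 'i 'i 0; mx2 0 1 (-1) 0]].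

(* The Riemann sphere, with [None] as the point at infinity. *)
Definition P1 := option C.

Definition moebius (A : 'M[C]_2) (p : P1) : P1 :=
  match p with
  | Some w => if A 1 0 * w + A 1 1 == 0 then None
              else Some ((A 0 0 * w + A 0 1) / (A 1 0 * w + A 1 1))
  | None => if A 1 0 == 0 then None else Some (A 0 0 / A 1 0)
  end.

Definition PSU2_act (x : PSU2) (p : P1) : P1 := moebius (repr x) p.

Lemma PSU2_act_pi (A : SU2) (p : P1) : PSU2_act (\pi A) p = moebius A p.
Proof.
rewrite /PSU2_act; case: (PSU2_repr A) => -> //.
by case: p => [w|] /=; rewrite !mxE ?mulNr -?opprD oppr_eq0 invrN mulrN ?mulNr opprK.
Qed.

End PSU2.

Section DevelopingMap.
Variable C : numClosedFieldType.
Implicit Types tau z : C.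

Definition lattice_pt tau (mn : int * int) : C := mn.1%:~R + mn.2%:~R * tau.

Definition lattice tau : set C := range (lattice_pt tau).

(* [sum] is the limit over the directed set of finite subsets of Z^2. The
   value of [wp tau] at its poles, the points of [lattice tau], is junk. *)
Definition wp tau z : C :=
  z ^- 2 + sum (fun mn : int * int =>
    if mn == (0, 0) then 0
    else (z - lattice_pt tau mn) ^- 2 - lattice_pt tau mn ^- 2).

(* The value of f(z; tau) on the Riemann sphere; the first case is the limit
   as wp tau (z / 2) tends to infinity. *)
Definition dev_map z tau : P1 C :=
  let e1 := wp tau (1 / 4) in
  let e2 := wp tau (1 / 4 + tau / 2) in
  let e := wp tau (tau / 4) in
  let w := wp tau (z / 2) in
  let c := (e - e2) / (e - e1) in
  if z / 2 \in lattice tau then Some c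
  else if w == e2 then None
  else Some (c * ((w - e1) / (w - e2))).

Definition autj (g : SL2Z) tau : C := (g 1 0)%:~R * tau + (g 1 1)%:~R.

Definition SL2Z_act (g : SL2Z) tau : C :=
  ((g 0 0)%:~R * tau + (g 0 1)%:~R) / autj g tau.

End DevelopingMap.

Local Open Scope complex_scope.

Definition cexp (R : realType) (z : R[i]) : R[i] :=
  (expR (complex.Re z))%:C * (cos (complex.Im z) +i* sin (complex.Im z)).

Definition is_psi (R : realType) (psi : SL2Z -> PSU2 R[i]) : Prop :=
  [/\ {morph psi : g h / (g * h)%g},
      forall g, normalizer (@K4 R[i]) (psi g) &
      forall (g : SL2Z) (z tau : R[i]), 0 < complex.Im tau ->
        dev_map ((autj g tau)^-1 * z) (SL2Z_act g tau)
        = PSU2_act (psi g) (dev_map z tau)].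

(* Main.v *)
(** Write P for wp(.; tau). The six pairs +-(m + n tau)/4 of primitive 4-torsion
    points are the points z/2 at which f is 0, oo, 1, -1, -i or i, and everything
    reduces to the values of P there.

    For a half period w, the function (P(z) - P(w)) (P(z - w) - P(w)) is elliptic
    without poles, hence constant. The constant is not 0: otherwise P = a near
    -w, and if P = a near u then (P(z) - a) (P(z - u) - a) is elliptic without
    poles and locally zero, so z = u/2 gives P(u/2) = a; iterating, P = a at
    points tending to the pole 0. Thus translation by w acts on P by an
    involution, which makes the six values distinct and gives f = +-i at
    z = (1 + tau)/2. The sign is continuous in tau, and at tau = i it follows from
    the symmetry P(iz) = -P(z) and a crude bound on P(z) - z^-2.

    Constancy is Liouville's theorem: if h is bounded and has Taylor expansions at
    every point, the maximum principle on large squares shows that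
    (h(z) - h(0)) / z vanishes.

    It follows that f(z; tau + 1) = i f(z; tau) and
    f(-z/tau; -1/tau) = (1 - f) / (1 + f). Since T and S generate SL_2(Z) and an
    element of PSU(2) is determined by its action on 0, 1 and oo, psi exists. The
    kernel and the preimage of K_4 are read off from
    psi(g) f((c tau + d)/2; tau) = 0 and psi(g) f((a tau + b)/2; tau) = 1. An
    element of N(K_4) permutes the six points fixed by nontrivial elements of K_4;
    T and S act transitively on them, and T rotates those other than 0 and oo, so
    the element can be moved into the stabilizer of 0, 1 and oo. *)
Require Import Defs.
From HB Require Import structures.
From mathcomp Require Import all_boot all_order all_algebra finmap.
From mathcomp Require Import complex ring lra zify.
From mathcomp Require Import all_classical all_reals all_analysis.
From mathcomp.analysis.showcase Require Import summability.

Set Implicit Arguments.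
Unset Strict Implicit.
Unset Printing Implicit Defensive.
Import Order.TTheory GRing.Theory Num.Theory.
Import numFieldNormedType.Exports.
Local Open Scope classical_set_scope.
Local Open Scope ring_scope.
Local Open Scope complex_scope.

(** * Unordered sums of complex numbers *)

(** Analyticity enters only through finite Taylor expansions with bounded remainder. This calculus
    is stable under sums of dominated families, products and inverses, it is uniform in the lattice
    index, and it applies alike to [z] and to [tau]. Each removal of a singularity costs one order:
    order six at a half period leaves four after division by [x ^+ 2], and Liouville's quotient
    turns four into the three of the maximum principle.

    The transformation laws rest on homogeneity. Passing from [tau] to its image under [g]
    multiplies P and all its torsion values by one factor, which cancels in the quotient defining f.
    The transformed f is therefore the same coordinate normalized at other torsion points, and
    comparing two normalizations is algebra in the values of P.

    The relations that the involutions give between these values are symmetric in [wp4 tau 1 1] and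
    [wp4 tau 1 (-1)], so they determine f at (1 + tau)/2 only up to sign. This is why a numerical
    estimate at one lattice is needed. *)

Notation nrm := Normc.normc.

Section Modulus.
Variable R : rcfType.
Implicit Types z w : R[i].

Lemma nrm_ge0 z : 0 <= nrm z.
Proof. by case: z => a b; rewrite sqrtr_ge0. Qed.

Lemma nrmE z : `|z| = (nrm z)%:C.
Proof. by case: z => a b; rewrite normc_def. Qed.

Lemma nrm0 : nrm (0 : R[i]) = 0.
Proof. exact: Normc.normc0. Qed.

Lemma nrm1 : nrm (1 : R[i]) = 1.
Proof. exact: Normc.normc1. Qed.

Lemma nrmM z w : nrm (z * w) = nrm z * nrm w.
Proof. exact: Normc.normcM. Qed.

Lemma nrmV z : nrm z^-1 = (nrm z)^-1.
Proof. exact: Normc.normcV. Qed.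

Lemma nrmX z n : nrm (z ^+ n) = nrm z ^+ n.
Proof. by elim: n => [|n IH]; rewrite ?nrm1// !exprS nrmM IH. Qed.

Lemma nrmN z : nrm (- z) = nrm z.
Proof. exact: normcN. Qed.

Lemma nrmD z w : nrm (z + w) <= nrm z + nrm w.
Proof. exact: le_normcD. Qed.

Lemma nrmB z w : nrm (z - w) <= nrm z + nrm w.
Proof. by rewrite (le_trans (nrmD _ _))// nrmN. Qed.

Lemma nrm_distC z w : nrm (z - w) = nrm (w - z).
Proof. by rewrite -nrmN opprB. Qed.

Lemma nrm_lip z w : `|nrm z - nrm w| <= nrm (z - w).
Proof.
have h (u v : R[i]) : nrm u - nrm v <= nrm (u - v).
  by have := nrmD (u - v) v; rewrite subrK -lerBlDr.
by rewrite ler_norml h lerNl opprB nrm_distC h.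
Qed.

Lemma nrm_eq0 z : (nrm z == 0) = (z == 0).
Proof.
by apply/eqP/eqP => [/Normc.eq0_normc|->]//; rewrite nrm0.
Qed.

Lemma nrm_gt0 z : (0 < nrm z) = (z != 0).
Proof. by rewrite lt_def nrm_ge0 nrm_eq0 andbT. Qed.

Lemma nrm_sum (I : Type) (r : seq I) (P : pred I) (F : I -> R[i]) :
  nrm (\sum_(i <- r | P i) F i) <= \sum_(i <- r | P i) nrm (F i).
Proof.
elim/big_ind2 : _ => [|x1 x2 y1 y2 h1 h2|//]; first by rewrite nrm0.
by rewrite (le_trans (nrmD _ _))// lerD.
Qed.

Lemma nrm_real (x : R) : nrm x%:C = `|x|.
Proof. by rewrite /= expr0n addr0 sqrtr_sqr. Qed.

Lemma nrm_nat (n : nat) : nrm (n%:R : R[i]) = n%:R.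
Proof. by rewrite -(rmorph_nat (real_complex R)) nrm_real normr_nat. Qed.

Lemma nrm_int (n : int) : nrm (n%:~R : R[i]) = `|n%:~R|.
Proof. by rewrite -(rmorph_int (real_complex R)) nrm_real. Qed.

Lemma nrm_sqr z : nrm z ^+ 2 = complex.Re z ^+ 2 + complex.Im z ^+ 2.
Proof. by case: z => a b /=; rewrite sqr_sqrtr// addr_ge0 ?sqr_ge0. Qed.

Lemma Re_nrm z : `|complex.Re z| <= nrm z.
Proof.
rewrite -(@ler_pXn2r _ 2)// ?nnegrE ?nrm_ge0//.
by rewrite real_normK ?num_real// nrm_sqr lerDl sqr_ge0.
Qed.

Lemma Im_nrm z : `|complex.Im z| <= nrm z.
Proof.
rewrite -(@ler_pXn2r _ 2)// ?nnegrE ?nrm_ge0//.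
by rewrite real_normK ?num_real// nrm_sqr lerDr sqr_ge0.
Qed.

Lemma nrm_ReIm z : nrm z <= `|complex.Re z| + `|complex.Im z|.
Proof.
have ni : nrm ('i : R[i]) = 1 by rewrite /= expr0n expr1n add0r sqrtr1.
rewrite {1}[z]complexE (le_trans (nrmD _ _))// nrmM !nrm_real.
by rewrite -[X in nrm X]complexiE ni mul1r.
Qed.

Lemma nrm_eps z : (forall e : R, 0 < e -> nrm z <= e) -> z = 0.
Proof.
move=> h; apply/eqP; rewrite -nrm_eq0 eq_le nrm_ge0 andbT.
by apply/ler_addgt0Pr => e /h; rewrite add0r.
Qed.

End Modulus.

Lemma sum_eq (K : numClosedFieldType) (I : choiceType) (f : I -> K) (s : K) :
  (forall e : K, 0 < e -> exists A : {fset I}, forall B : {fset I},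
     (A `<=` B)%fset -> `|\sum_(i <- B) f i - s| <= e) ->
  sum f = s.
Proof.
move=> fs; have FF := @totally_filter I.
apply: cvg_lim; first exact: norm_hausdorff.
apply/cvgrPdist_le => e /fs[A hA]; exists A => // B /= AB.
by rewrite distrC /partial_sum -(big_seq_fsetE _ _ xpredT) /= hA.
Qed.

Section HasSum.
Variables (R : realType) (I : choiceType).
Implicit Types (f g : I -> R[i]) (s t : R[i]) (A B : {fset I}).

(** A relation, since the value of [sum] says nothing about convergence. Errors are measured by the
    real modulus [nrm], so that real inequalities apply. *)
Definition has_sum f s := forall e : R, 0 < e ->
  exists A, forall B, (A `<=` B)%fset -> nrm (\sum_(i <- B) f i - s) <= e.

Lemma has_sum_sum f s : has_sum f s -> sum (f : I -> (R[i] : numClosedFieldType)) = s.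
Proof.
move=> fs; apply: (@sum_eq (R[i] : numClosedFieldType)) => e e0.
have [e' e'E] : exists e', e = e'%:C by apply/complex_realP/gtr0_real.
have [|A hA] := fs e'; first by rewrite -ltcR -e'E.
by exists A => B AB; rewrite e'E nrmE lecR hA.
Qed.

Lemma has_sum_unique f s t : has_sum f s -> has_sum f t -> s = t.
Proof. by move=> /has_sum_sum <- /has_sum_sum. Qed.

Lemma has_sumD f g s t : has_sum f s -> has_sum g t ->
  has_sum (fun i => f i + g i) (s + t).
Proof.
move=> hf hg e e0; have e20 : 0 < e / 2 by rewrite divr_gt0.
have [A hA] := hf _ e20; have [B hB] := hg _ e20.
exists (A `|` B)%fset => D; rewrite fsubUset => /andP[/hA h1 /hB h2].
rewrite big_split /= opprD addrACA (splitr e).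
by rewrite (le_trans (nrmD _ _))// lerD.
Qed.

Lemma has_sumZ c f s : has_sum f s -> has_sum (fun i => c * f i) (c * s).
Proof.
move=> hf e e0; have c0 : 0 < nrm c + 1 by rewrite ltr_wpDl ?nrm_ge0.
have [A hA] := hf _ (divr_gt0 e0 c0); exists A => B /hA h.
rewrite -mulr_sumr -mulrBr nrmM.
rewrite (le_trans (ler_wpM2l (nrm_ge0 _) h))// mulrA ler_pdivrMr//.
by rewrite mulrDr mulr1 mulrC lerDl ltW.
Qed.

Lemma has_sumB f g s t : has_sum f s -> has_sum g t ->
  has_sum (fun i => f i - g i) (s - t).
Proof.
move=> hf /(@has_sumZ (-1)) hg; rewrite -[- t]mulN1r.
have -> : (fun i => f i - g i) = (fun i => f i + -1 * g i).
  by apply/funext => i; rewrite mulN1r.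
exact: has_sumD.
Qed.

Lemma has_sum_le f s (M : R) : has_sum f s ->
  (forall A : {fset I}, \sum_(i <- A) nrm (f i) <= M) -> nrm s <= M.
Proof.
move=> hf hM; apply/ler_addgt0Pr => e e0.
have [A /(_ A (fsubset_refl _)) hA] := hf _ e0.
rewrite -(subrK (\sum_(i <- A) f i) s) addrC (le_trans (nrmD _ _))//.
by rewrite lerD// ?(le_trans (nrm_sum _ _ _))// nrm_distC.
Qed.

Lemma has_sum_reindex (h k : I -> I) f s : cancel h k -> cancel k h ->
  has_sum f s -> has_sum (f \o h) s.
Proof.
move=> hk kh hf e /hf[A hA].
exists (k @` A)%fset => B /fsubsetP kAB.
have /hA : (A `<=` h @` B)%fset.
  apply/fsubsetP => i iA; apply/imfsetP; exists (k i); last by rewrite kh.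
  by apply: kAB; apply/imfsetP; exists i.
rewrite big_imfset//= => x y _ _; exact: (can_inj hk).
Qed.

Lemma has_sum_nneg (f : I -> R) (M : R) : (forall i, 0 <= f i) ->
  (forall A : {fset I}, \sum_(i <- A) f i <= M) -> exists s : R, has_sum (fun i => (f i)%:C) s%:C.
Proof.
move=> f0 fM; pose E : set R := [set \sum_(i <- A) f i | A in [set: {fset I}]].
have supE : has_sup E.
  split; first by exists (\sum_(i <- fset0 : {fset I}) f i), fset0.
  by apply: (ex_intro _ M) => _ [A _ <-].
exists (sup E) => e e0.
have [_ [A _ <-] hA] := sup_adherent e0 supE.
exists A => B AB; rewrite -rmorph_sum -rmorphB nrm_real /=.
have h1 : \sum_(i <- B) f i <= sup E.
  by apply: ub_le_sup; [exact: supE.2|exists B].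
have h2 : \sum_(i <- A) f i <= \sum_(i <- B) f i.
  rewrite [leRHS](big_fsetID _ (mem A)) /=.
  have -> : [fset x in B | x \in A]%fset = A.
    by apply/fsetP => x; rewrite !inE /= andb_idl// => /(fsubsetP AB).
  by rewrite lerDl sumr_ge0.
rewrite ler_norml; apply/andP; split; lra.
Qed.

(* Real and imaginary parts, shifted by the majorant, are nonnegative families
   with bounded finite sums, so no completeness of [R[i]] is needed. *)
Lemma has_sum_dominated f (g : I -> R) (M : R) :
  (forall A : {fset I}, \sum_(i <- A) g i <= M) -> (forall i, nrm (f i) <= g i) ->
  exists s, has_sum f s.
Proof.
move=> gM fg.
have g0 i : 0 <= g i by rewrite (le_trans (nrm_ge0 _) (fg i)).
have part (p : I -> R) : (forall i, `|p i| <= g i) ->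
    exists s, has_sum (fun i => (p i)%:C) s.
  move=> pg.
  have [i|A|s hs] := @has_sum_nneg (fun i => p i + g i) (M + M).
  - by have := pg i; rewrite ler_norml => /andP[h _]; lra.
  - rewrite big_split lerD//= (le_trans _ (gM A))// ler_sum// => i _.
    by rewrite (le_trans (ler_norm _)).
  have [t ht] := has_sum_nneg g0 gM.
  exists (s%:C - t%:C); have := has_sumB hs ht; congr has_sum.
  by apply/funext => i; rewrite -rmorphB addrK.
have [|s hs] := part (fun i => complex.Re (f i)); first move=> i.
  exact: le_trans (Re_nrm _) (fg i).
have [|t ht] := part (fun i => complex.Im (f i)); first move=> i.
  exact: le_trans (Im_nrm _) (fg i).
exists (s + 'i * t); have := has_sumD hs (has_sumZ 'i ht); congr has_sum.
by apply/funext => i; rewrite -complexE.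
Qed.

End HasSum.

(** * Taylor expansions, uniformly over a family *)

Section UniformTaylor.
Variables (R : realType) (I : Type) (P : pred I).
Implicit Types (g h : I -> R) (c : I -> R[i]) (F G : I -> R[i] -> R[i]).

(* [uT K g F]: on [P], the functions [F i] have Taylor expansions of order [K]
   at 0 with coefficients and remainders bounded by a multiple of [g i],
   uniformly on a common disc. *)
Fixpoint uT K g F : Prop :=
  if K is K'.+1 then
    exists c G (B d : R), [/\ 0 < d, forall i, P i -> nrm (c i) <= B * g i,
      uT K' g G & forall i x, P i -> nrm x <= d -> F i x = c i + x * G i x]
  else exists B d : R, 0 < d /\
    forall i x, P i -> nrm x <= d -> nrm (F i x) <= B * g i.

Lemma uT_ext K g F G (d : R) : 0 < d ->
  (forall i x, P i -> nrm x <= d -> F i x = G i x) -> uT K g F -> uT K g G.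
Proof.
move=> d0 FG; case: K => [[B [e [e0 h]]]|K [c [H [B [e [e0 h1 h2 h3]]]]]] /=.
  exists B, (Num.min d e); split; first by rewrite lt_min d0 e0.
  by move=> i x Pi; rewrite le_min => /andP[xd xe]; rewrite -FG// h.
exists c, H, B, (Num.min d e); split => //; first by rewrite lt_min d0 e0.
by move=> i x Pi; rewrite le_min => /andP[xd xe]; rewrite -FG// h3.
Qed.

Lemma uT_le K g F : (forall i, 0 <= g i) -> uT K.+1 g F -> uT K g F.
Proof.
move=> g0; elim: K F => [|K IH] F [c [G [B [d [d0 h1 h2 h3]]]]].
  have [B' [d' [d'0 h4]]] := h2.
  have m0 : 0 < Num.min d d' by rewrite lt_min d0 d'0.
  exists (B + Num.min d d' * B'), (Num.min d d'); split => // i x Pi.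
  move=> xm; have := xm; rewrite le_min => /andP[xd xe]; rewrite h3//.
  rewrite (le_trans (nrmD _ _))// mulrDl lerD ?h1// nrmM -mulrA.
  by rewrite ler_pM ?nrm_ge0 ?h4.
by exists c, G, B, d; split => //; exact: IH.
Qed.

Lemma uT_leq K L g F : (forall i, 0 <= g i) -> (K <= L)%N -> uT L g F -> uT K g F.
Proof.
move=> g0; elim: L => [|L IH]; first by rewrite leqn0 => /eqP->.
by rewrite leq_eqVlt => /predU1P[->//|KL] /(uT_le g0)/IH; apply.
Qed.

Lemma uT_cst K g c (B : R) : (forall i, P i -> nrm (c i) <= B * g i) ->
  uT K g (fun i _ => c i).
Proof.
elim: K c B => [|K IH] c B hc; first by exists B, 1; split => // i x /hc.
exists c, (fun _ _ => 0), B, 1; split => //; last by move=> *; rewrite mulr0 addr0.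
by apply: (IH (fun=> 0) 0) => i _; rewrite nrm0 mul0r.
Qed.

Lemma uT_id K : uT K (fun=> 1) (fun _ x => x).
Proof.
case: K => [|K]; first by exists 1, 1; split => // i x _; rewrite mulr1.
exists (fun=> 0), (fun _ _ => 1), 0, 1; split => //.
- by move=> *; rewrite nrm0 mul0r.
- by apply: (@uT_cst _ _ (fun=> 1) 1) => i _; rewrite nrm1 mul1r.
- by move=> *; rewrite add0r mulr1.
Qed.

Lemma uTD K g F G : uT K g F -> uT K g G -> uT K g (fun i x => F i x + G i x).
Proof.
elim: K F G => [|K IH] F G.
  move=> [B [d [d0 h]]] [B' [d' [d'0 h']]].
  exists (B + B'), (Num.min d d'); split; first by rewrite lt_min d0 d'0.
  move=> i x Pi; rewrite le_min => /andP[xd xe].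
  by rewrite (le_trans (nrmD _ _))// mulrDl lerD ?h ?h'.
move=> [c [H [B [d [d0 h1 h2 h3]]]]] [c' [H' [B' [d' [d0' h1' h2' h3']]]]].
exists (fun i => c i + c' i), (fun i x => H i x + H' i x), (B + B'), (Num.min d d').
split; first by rewrite lt_min d0 d0'.
- by move=> i Pi; rewrite (le_trans (nrmD _ _))// mulrDl lerD ?h1 ?h1'.
- exact: IH.
- move=> i x Pi; rewrite le_min => /andP[xd xe].
  by rewrite h3 ?h3'// mulrDr addrACA.
Qed.

(** With [F = c + x H] and [G = c' + x H'], the product is [c c' + x (c H' + H G)]. The remainder
    involves [G] itself at the lower order, whence [uT_le]. *)
Lemma uTM K g h F G : (forall i, 0 <= g i) -> (forall i, 0 <= h i) ->
  uT K g F -> uT K h G -> uT K (fun i => g i * h i) (fun i x => F i x * G i x).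
Proof.
move=> g0 h0; elim: K F G => [|K IH] F G.
  move=> [B [d [d0 hF]]] [B' [d' [d'0 hG]]].
  exists (B * B'), (Num.min d d'); split; first by rewrite lt_min d0 d'0.
  move=> i x Pi; rewrite le_min => /andP[xd xe].
  by rewrite nrmM mulrACA ler_pM ?nrm_ge0 ?hF ?hG.
move=> [c [H [B [d [d0 h1 h2 h3]]]]] uG.
have [c' [H' [B' [d' [d0' h1' h2' h3']]]]] := uG.
exists (fun i => c i * c' i), (fun i x => c i * H' i x + H i x * G i x), (B * B').
exists (Num.min d d'); split; first by rewrite lt_min d0 d0'.
- by move=> i Pi; rewrite nrmM mulrACA ler_pM ?nrm_ge0 ?h1 ?h1'.
- apply: uTD; last by apply: IH => //; exact: uT_le.
  by apply: (IH (fun i _ => c i)) => //; exact: uT_cst h1.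
- move=> i x Pi; rewrite le_min => /andP[xd xe].
  by rewrite h3 ?h3'//; ring.
Qed.

Lemma uTM1 K g F G : (forall i, 0 <= g i) ->
  uT K (fun=> 1) F -> uT K g G -> uT K g (fun i x => F i x * G i x).
Proof.
move=> g0 hF hG; have := uTM (fun=> ler01) g0 hF hG.
by congr uT; apply/funext => i; rewrite mul1r.
Qed.

Lemma uT1M K F G : uT K (fun=> 1) F -> uT K (fun=> 1) G ->
  uT K (fun=> 1) (fun i x => F i x * G i x).
Proof. by apply: uTM1. Qed.

Lemma uT_opp K g F : (forall i, 0 <= g i) -> uT K g F -> uT K g (fun i x => - F i x).
Proof.
move=> g0 hF; have -> : (fun i x => - F i x) = (fun i x => -1 * F i x).
  by apply/funext => i; apply/funext => x; rewrite mulN1r.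
by apply: uTM1 => //; apply: (@uT_cst _ _ (fun=> -1) 1) => i _; rewrite nrmN nrm1 mulr1.
Qed.

Lemma uTB K g F G : (forall i, 0 <= g i) ->
  uT K g F -> uT K g G -> uT K g (fun i x => F i x - G i x).
Proof. by move=> g0 hF hG; apply: (@uTD _ _ F (fun i x => - G i x)) => //; exact: uT_opp. Qed.

Lemma uTX K F n : uT K (fun=> 1) F -> uT K (fun=> 1) (fun i x => F i x ^+ n).
Proof.
move=> hF; elim: n => [|n IH].
  by apply: (@uT_cst _ _ (fun=> 1) 1) => i _; rewrite nrm1 mulr1.
have -> : (fun i x => F i x ^+ n.+1) = (fun i x => F i x * F i x ^+ n).
  by apply/funext => i; apply/funext => x; rewrite exprS.
exact: uT1M.
Qed.

(** From [F = c + x G] one gets [1/F = 1/c - x (G / c) (1/F)], whose remainder contains the same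
    inverse at one order less. The lower bound is fixed before the induction and so stays uniform in
    the family. *)
Lemma uTV_lower K F (r d : R) : 0 < r -> 0 < d ->
  (forall i x, P i -> nrm x <= d -> r <= nrm (F i x)) ->
  uT K (fun=> 1) F -> uT K (fun=> 1) (fun i x => (F i x)^-1).
Proof.
move=> r0 d0 low; have inv_le i x : P i -> nrm x <= d -> nrm (F i x)^-1 <= r^-1.
  move=> Pi xd; have Fr := low i x Pi xd.
  by rewrite nrmV lef_pV2 ?posrE ?(lt_le_trans r0).
elim: K => [|K IH] hF.
  by exists r^-1, d; split => // i x Pi xd; rewrite mulr1 inv_le.
have hF' := uT_le (fun=> ler01) hF.
have [c [G [B [e [e0 h1 h2 h3]]]]] := hF.
have c0 i : P i -> c i = F i 0.
  by move=> Pi; rewrite (h3 i 0 Pi) ?nrm0 ?ltW// mul0r addr0.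
have cV i : P i -> nrm (c i)^-1 <= r^-1 * 1.
  by move=> Pi; rewrite mulr1 c0// inv_le// nrm0 ltW.
exists (fun i => (c i)^-1), (fun i x => - (((c i)^-1 * G i x) * (F i x)^-1)), r^-1.
exists (Num.min d e); split => //; first by rewrite lt_min d0 e0.
- apply: uT_opp => //; apply: uT1M; last exact: IH.
  by apply: uT1M => //; exact: uT_cst cV.
- move=> i x Pi; rewrite le_min => /andP[xd xe].
  have Fn0 : F i x != 0 by rewrite -nrm_gt0 (lt_le_trans r0)// low.
  have cn0 : c i != 0 by rewrite -nrm_gt0 (lt_le_trans r0)// c0// low// nrm0 ltW.
  have FE := h3 i x Pi xe.
  apply: (mulIf Fn0); rewrite mulVf// mulrDl mulrN mulNr mulrA mulfVK//.
  by rewrite {1}FE; field.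
Qed.

Lemma uT_lower K F (r : R) : 0 < r -> uT K.+1 (fun=> 1) F ->
  (forall i, P i -> r <= nrm (F i 0)) ->
  exists d : R, 0 < d /\ forall i x, P i -> nrm x <= d -> r / 2 <= nrm (F i x).
Proof.
move=> r0 hF low; have [c [G [B [d [d0 h1 [B' [d' [d'0 h2]]] h3]]]]] :=
  @uT_leq 1 K.+1 (fun=> 1) F (fun=> ler01) isT hF.
have B1 : 0 < `|B'| + 1 by rewrite ltr_wpDl.
(* On [nrm x <= e] the increment [x G] is at most [r / 2]; adding 1 keeps the divisor positive. *)
pose e := r / 2 / (`|B'| + 1).
have e0 : 0 < e by rewrite !divr_gt0.
exists (Num.min (Num.min d d') e); split; first by rewrite !lt_min d0 d'0 e0.
move=> i x Pi; rewrite !le_min => /andP[/andP[xd xd'] xe].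
have c0 : c i = F i 0 by rewrite (h3 i 0 Pi) ?nrm0 ?ltW// mul0r addr0.
have : nrm (x * G i x) <= r / 2.
  rewrite nrmM (le_trans (ler_pM (nrm_ge0 _) (nrm_ge0 _) xe (h2 i x Pi xd')))//.
  rewrite mulr1 /e mulrAC ler_pdivrMr//.
  apply: ler_wpM2l; first by rewrite divr_ge0 ?ltW.
  by rewrite ler_wpDr// ler_norm.
have := low i Pi; rewrite -c0.
have -> : c i = F i x - x * G i x by rewrite h3//; ring.
by have := nrmB (F i x) (x * G i x); lra.
Qed.

(** The order is at least one because order 0 is mere boundedness, which does not keep [F] away from
    0 near the origin. *)
Lemma uTV K F (r : R) : 0 < r -> uT K.+1 (fun=> 1) F ->
  (forall i, P i -> r <= nrm (F i 0)) ->
  uT K.+1 (fun=> 1) (fun i x => (F i x)^-1).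
Proof.
move=> r0 hF /(uT_lower r0 hF)[d [d0 h]].
by apply: (@uTV_lower _ _ (r / 2) d) => //; rewrite divr_gt0.
Qed.

End UniformTaylor.

(** * Taylor expansions of a single function *)

Section TaylorAtPoint.
Variable R : realType.
Implicit Types (f g : R[i] -> R[i]) (z p : R[i]).

(** A family with one member, so that single functions inherit the uniform calculus. *)
Definition taylor K f z := uT xpredT K (fun _ : unit => 1 : R) (fun _ x => f (z + x)).

Lemma taylor_eq K f g z (d : R) : 0 < d ->
  (forall x, nrm x <= d -> f (z + x) = g (z + x)) -> taylor K f z -> taylor K g z.
Proof. by move=> d0 h; apply: (uT_ext d0) => *; exact: h. Qed.

Lemma taylor_leq K L f z : (K <= L)%N -> taylor L f z -> taylor K f z.
Proof. exact: uT_leq. Qed.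

Lemma taylor_cst K c z : taylor K (fun=> c) z.
Proof. by apply: (@uT_cst _ _ _ _ _ _ (nrm c)) => *; rewrite mulr1. Qed.

Lemma taylorD K f g z : taylor K f z -> taylor K g z ->
  taylor K (fun x => f x + g x) z.
Proof. exact: uTD. Qed.

Lemma taylor_id K z : taylor K id z.
Proof. by apply: uTD; [exact: (taylor_cst K z z)|exact: uT_id]. Qed.

Lemma taylorB K f g z : taylor K f z -> taylor K g z ->
  taylor K (fun x => f x - g x) z.
Proof. exact: uTB. Qed.

Lemma taylorM K f g z : taylor K f z -> taylor K g z ->
  taylor K (fun x => f x * g x) z.
Proof. exact: uT1M. Qed.

Lemma taylorX K f n z : taylor K f z -> taylor K (fun x => f x ^+ n) z.
Proof. exact: uTX. Qed.

Lemma taylorV K f z : f z != 0 -> taylor K.+1 f z ->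
  taylor K.+1 (fun x => (f x)^-1) z.
Proof.
rewrite -nrm_gt0 => r0 hf; apply: (uTV r0 hf) => _ _.
by rewrite addr0.
Qed.

Lemma taylor_bounded f z : taylor 0 f z ->
  exists B d : R, 0 < d /\ forall x, nrm x <= d -> nrm (f (z + x)) <= B.
Proof.
move=> [B [d [d0 h]]]; exists B, d; split => // x xd.
by have := h tt x isT xd; rewrite mulr1.
Qed.

(* The remainder is again a Taylor-expandable function of the increment. *)
Lemma taylorS K f z : taylor K.+1 f z <->
  exists g, taylor K g 0 /\ exists2 d : R, 0 < d &
    forall x, nrm x <= d -> f (z + x) = f z + x * g x.
Proof.
split=> [[c [G [B [d [d0 h1 h2 h3]]]]]|[g [hg [d d0 h]]]].
  exists (G tt); split.
    by apply: uT_ext h2 => [|[] x _ _]; [exact: d0|rewrite add0r].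
  exists d => // x xd; rewrite (h3 tt x isT xd); congr (_ + _).
  by rewrite -[z in RHS]addr0 (h3 tt 0 isT) ?nrm0 ?ltW// mul0r addr0.
exists (fun=> f z), (fun=> g), (nrm (f z)), d; split => //.
- by move=> *; rewrite mulr1.
- by apply: uT_ext hg => [|[] x _ _]; [exact: d0|rewrite add0r].
- by move=> *; exact: h.
Qed.

Lemma taylor_lipschitz K f z : taylor K.+1 f z -> exists B d : R,
  [/\ 0 < d, 0 < B & forall x, nrm x <= d -> nrm (f (z + x) - f z) <= B * nrm x].
Proof.
move=> /(taylor_leq (isT : (1 <= K.+1)%N))/taylorS[g [/taylor_bounded[B [e [e0 hB]]] [d d0 h]]].
exists (`|B| + 1), (Num.min d e); split; first by rewrite lt_min d0 e0.
  by rewrite ltr_wpDl.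
move=> x; rewrite le_min => /andP[xd xe]; rewrite h// addrC addKr nrmM mulrC.
rewrite ler_wpM2r ?nrm_ge0//; have := hB x xe; rewrite add0r => /le_trans; apply.
by rewrite ler_wpDr// ler_norm.
Qed.

Lemma taylor_shift K f z w : (forall x, f (x + w) = f x) ->
  taylor K f z -> taylor K f (z + w).
Proof.
by move=> h; apply: (uT_ext ltr01) => _ x _ _ /=; rewrite addrAC h.
Qed.

End TaylorAtPoint.

Section TaylorSum.
Variables (R : realType) (I : choiceType) (P : pred I) (g : I -> R) (M : R).
Hypotheses (g_ge0 : forall i, 0 <= g i)
  (g_sum : forall A : {fset I}, \sum_(i <- A) g i <= M).
Implicit Types F G : I -> R[i] -> R[i].

(** The mask sits inside the summand because [sum] runs over the whole index type; for the
    Weierstrass series it removes the index (0, 0). *)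
Definition masked_sum F (x : R[i]) : R[i] :=
  sum ((fun i => if P i then F i x else 0) : I -> (R[i] : numClosedFieldType)).

Lemma masked_has_sum F x (B : R) :
  (forall i, P i -> nrm (F i x) <= B * g i) ->
  has_sum (fun i => if P i then F i x else 0) (masked_sum F x).
Proof.
move=> h; have [A|i|s hs] := @has_sum_dominated R I
    (fun i => if P i then F i x else 0) (fun i => `|B| * g i) (`|B| * M).
- by rewrite -mulr_sumr ler_wpM2l.
- case: ifPn => [/h/le_trans->//|_]; last by rewrite nrm0 mulr_ge0.
  by rewrite ler_wpM2r// ler_norm.
by rewrite /masked_sum (has_sum_sum hs).
Qed.

(** Constant terms and remainders are both dominated by multiples of [g], so they can be summed
    separately. The remainder of the sum is the sum of the remainders, to which the induction
    applies. *)
Lemma taylor_sum K F : uT P K g F ->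
  taylor K (masked_sum F) 0.
Proof.
elim: K F => [|K IH] F hF.
  have [B [d [d0 h]]] := hF; exists (`|B| * M), d; split => // _ x _ xd.
  rewrite mulr1 add0r; apply: has_sum_le (masked_has_sum (fun i Pi => h i x Pi xd)) _.
  move=> A; rewrite (le_trans _ (ler_wpM2l (normr_ge0 B) (g_sum A)))// mulr_sumr.
  rewrite ler_sum// => i _; case: ifPn => [Pi|_]; last by rewrite nrm0 mulr_ge0.
  by rewrite (le_trans (h i x Pi xd))// ler_wpM2r// ler_norm.
have [c [G [B [d [d0 h1 h2 h3]]]]] := hF.
have [B' [d' [d'0 hG]]] := uT_leq g_ge0 (leq0n K) h2.
apply/taylorS; exists (masked_sum G); split; first exact: IH.
exists (Num.min d d'); first by rewrite lt_min d0 d'0.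
have c0 i : P i -> c i = F i 0.
  by move=> Pi; rewrite (h3 i 0 Pi) ?nrm0 ?ltW// mul0r addr0.
move=> x; rewrite le_min add0r => /andP[xd xd'].
have S0 : has_sum (fun i => if P i then F i 0 else 0) (masked_sum F 0).
  by apply: (@masked_has_sum _ _ B) => i Pi; rewrite -c0// h1.
have SG := masked_has_sum (fun i Pi => hG i x Pi xd').
rewrite /masked_sum; apply: has_sum_sum.
have := has_sumD S0 (has_sumZ x SG); congr has_sum.
apply/funext => i; case: ifPn => Pi; last by rewrite mulr0 addr0.
by rewrite (h3 i x)// c0.
Qed.

End TaylorSum.

(** * Lattice sums and the Weierstrass function *)

Section LatticeMajorant.
Variable R : realType.

Lemma ler_sum_uniq (T : eqType) (s t : seq T) (f : T -> R) :
  (forall x, 0 <= f x) -> uniq s -> {subset s <= t} ->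
  \sum_(x <- s) f x <= \sum_(x <- t) f x.
Proof.
move=> f0; elim: s t => [|x s IH] t /=; first by rewrite big_nil sumr_ge0.
move=> /andP[xs us] st; have xt : x \in t by apply: st; rewrite mem_head.
rewrite big_cons (perm_big _ (perm_to_rem xt)) big_cons lerD2l IH// => y ys.
have := st y; rewrite inE ys orbT => /(_ isT).
rewrite (perm_mem (perm_to_rem xt)) inE => /predU1P[yx|//].
by move: xs; rewrite -yx ys.
Qed.

(** The three summands account for 0, the positive and the negative integers. *)
Lemma ler_sum_int (s : seq int) (d : nat -> R) (D : R) :
  (forall k, 0 <= d k) -> (forall n, \sum_(k < n) d k.+1 <= D) -> uniq s ->
  \sum_(m <- s) d `|m|%N <= d 0%N + D + D.
Proof.
move=> d0 hD us; have [n hn] : exists n, forall m, m \in s -> (`|m| <= n)%N.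
  exists (\max_(m <- s) `|m|)%N => m ms.
  exact: (@leq_bigmax_seq _ _ xpredT (fun m : int => `|m|%N)).
pose t := [seq Posz k | k <- iota 0 n.+1] ++ [seq Negz k | k <- iota 0 n].
have st : {subset s <= t}.
  move=> m /hn; rewrite mem_cat; case: m => k kn; apply/orP.
    by left; apply/mapP; exists k => //; rewrite mem_iota.
  by right; apply/mapP; exists k => //; rewrite mem_iota.
apply: le_trans (@ler_sum_uniq _ s t (fun m => d `|m|%N) (fun=> d0 _) us st) _.
rewrite /t big_cat !big_map [iota 0 n.+1]/= big_cons -(addn0 1%N) iotaDl big_map.
have iotaE : iota 0 n = index_iota 0 n by rewrite /index_iota subn0.
by rewrite iotaE !big_mkord lerD// lerD.
Qed.

Lemma ler_sum_int2 (s : seq (int * int)) (d e : nat -> R) (D E : R) :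
  (forall k, 0 <= d k) -> (forall n, \sum_(k < n) d k.+1 <= D) ->
  (forall k, 0 <= e k) -> (forall n, \sum_(k < n) e k.+1 <= E) -> uniq s ->
  \sum_(p <- s) d `|p.1|%N * e `|p.2|%N <= (d 0%N + D + D) * (e 0%N + E + E).
Proof.
move=> d0 hD e0 hE us.
pose X := undup [seq p.1 | p <- s]; pose Y := undup [seq p.2 | p <- s].
have sub : {subset s <= [seq (x, y) | x <- X, y <- Y]}.
  move=> [m n] ps; apply/allpairsP; exists (m, n); split => //;
  by rewrite mem_undup; apply/mapP; exists (m, n).
apply: le_trans (ler_sum_uniq _ us sub) _; first by move=> p; rewrite mulr_ge0.
rewrite big_allpairs /=; under eq_bigr do rewrite -mulr_sumr.
rewrite -mulr_suml ler_pM ?sumr_ge0 ?ler_sum_int ?undup_uniq//.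
Qed.

(** The sup norm of the index, raised to 1 at (0, 0) so that it is always invertible. *)
Definition maxabs (p : int * int) : nat := maxn 1 (maxn `|p.1| `|p.2|).

Definition invcube (p : int * int) : R := (maxabs p)%:R ^- 3.

Lemma invcube_ge0 p : 0 <= invcube p.
Proof. by rewrite invr_ge0 exprn_ge0. Qed.

(** Telescoping: for the square roots [a] and [b] of consecutive integers, [b - a = 1 / (a + b)],
    hence [2 / a - 2 / b = 2 / (a b (a + b))], which is at least [b ^- 3]. *)
Lemma sum_pow32 (n : nat) :
  \sum_(k < n) (Num.sqrt (k.+1)%:R ^- 3 : R) <= 3 - 2 / Num.sqrt (maxn 1 n)%:R.
Proof.
elim: n => [|n IH]; first by rewrite big_ord0 maxn0 sqrtr1; lra.
rewrite big_ord_recr /=; case: n IH => [|n] IH.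
  by rewrite big_ord0 maxnn sqrtr1 expr1n; lra.
apply: le_trans (lerD IH (lexx _)) _.
have -> : maxn 1 n.+1 = n.+1 by lia.
have -> : maxn 1 n.+2 = n.+2 by lia.
set a := Num.sqrt n.+1%:R; set b := Num.sqrt n.+2%:R.
have a0 : 0 < a by rewrite sqrtr_gt0.
have b0 : 0 < b by rewrite sqrtr_gt0.
have ab : a <= b by rewrite ler_sqrt// ler_nat.
have ab2 : b ^+ 2 = a ^+ 2 + 1 by rewrite !sqr_sqrtr// -natr1.
have : b ^- 3 <= 2 / a - 2 / b; last by lra.
have -> : 2 / a - 2 / b = 2 * (b - a) / (a * b).
  by field; rewrite !gt_eqF.
rewrite ler_pdivlMr ?mulr_gt0// mulrC ler_pdivrMr ?exprn_gt0//.
have : 0 <= (b - a) * (b - a) by rewrite mulr_ge0// subr_ge0.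
have : 0 <= b * b by rewrite mulr_ge0 ?ltW.
have : 1 = (b - a) * (a + b) by move: ab2; rewrite !expr2; lra.
nra.
Qed.

(** The maximum of two numbers is at least their geometric mean, so the inverse cube is bounded by a
    product of powers -3/2 of [|m|] and [|n|], zero being read as 1. The double sum splits into two
    factors, each at most 1 + 3 + 3, whence 49. *)
Lemma sum_invcube (A : {fset int * int}) : \sum_(p <- A) invcube p <= 49.
Proof.
pose d k : R := Num.sqrt (maxn 1 k)%:R ^- 3.
have d0 k : 0 <= d k by rewrite invr_ge0 exprn_ge0 ?sqrtr_ge0.
have hD n : \sum_(k < n) d k.+1 <= 3.
  have h : 0 <= 2 / Num.sqrt (maxn 1 n)%:R :> R by rewrite divr_ge0 ?sqrtr_ge0.
  suff -> : \sum_(k < n) d k.+1 = \sum_(k < n) (Num.sqrt (k.+1)%:R ^- 3 : R).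
    by have := sum_pow32 n; lra.
  by apply: eq_bigr => k _; rewrite /d (_ : maxn 1 k.+1 = k.+1)//; lia.
have -> : 49 = (d 0%N + 3 + 3) * (d 0%N + 3 + 3).
  by rewrite /d maxn0 sqrtr1 expr1n invr1; lra.
apply: le_trans (ler_sum_int2 d0 hD d0 hD (fset_uniq A)).
apply: ler_sum => -[m n] _; rewrite /d /invcube /maxabs /= -invfM -exprMn.
set N := maxn 1 (maxn _ _).
rewrite lef_pV2 ?posrE ?exprn_gt0 ?mulr_gt0 ?sqrtr_gt0 ?ltr0n//.
- rewrite lerXn2r ?nnegrE ?mulr_ge0 ?sqrtr_ge0//.
  have NE : Num.sqrt N%:R * Num.sqrt N%:R = N%:R :> R by rewrite -expr2 sqr_sqrtr.
  rewrite -[leRHS]NE ler_pM ?sqrtr_ge0// ler_sqrt// ler_nat /N; lia.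
- by rewrite /N; lia.
- by lia.
- by lia.
Qed.

Lemma Im_real (a : R) : complex.Im a%:C = 0. Proof. by []. Qed.

Lemma Im_realM (a : R) (z : R[i]) : complex.Im (a%:C * z) = a * complex.Im z.
Proof. by case: z => u v /=; rewrite mul0r addr0. Qed.

Lemma Im_add (z w : R[i]) : complex.Im (z + w) = complex.Im z + complex.Im w.
Proof. by case: z w => [a b] [c d]. Qed.

Lemma Re_add (z w : R[i]) : complex.Re (z + w) = complex.Re z + complex.Re w.
Proof. by case: z w => [a b] [c d]. Qed.

Lemma dist_int (a : R) : (forall m : int, a <> m%:~R) ->
  exists2 d : R, 0 < d & forall m : int, d <= `|a - m%:~R|.
Proof.
move=> h; set k := Num.floor a.
have ka : k%:~R < a by rewrite lt_def floor_le andbT; apply/eqP/h.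
have ak : a < k%:~R + 1 by rewrite -[1](mulr1z 1) -intrD -/(k + 1) floorD1_gt.
exists (Num.min (a - k%:~R) (k%:~R + 1 - a)).
  by rewrite lt_min !subr_gt0 ka ak.
move=> m; have [mk|km] := leP m k.
  have : m%:~R <= k%:~R :> R by rewrite ler_int.
  move=> mk'; rewrite ge_min; apply/orP; left; rewrite ger0_norm; lra.
have : k%:~R + 1 <= m%:~R :> R.
  by rewrite -[1](mulr1z 1) -intrD ler_int; lia.
move=> mk'; rewrite ge_min; apply/orP; right; rewrite ler0_norm; lra.
Qed.

Lemma maxabsE (p : int * int) : p != (0, 0) ->
  (maxabs p)%:R = Num.max `|p.1%:~R| `|p.2%:~R| :> R.
Proof.
case: p => m n; rewrite xpair_eqE negb_and => mn.
rewrite -!intr_norm -!natr_absz !pmulrn.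
rewrite -(@natr_max R).
congr (_%:R); rewrite /maxabs /=.
by move: mn; rewrite -!absz_eq0; lia.
Qed.

End LatticeMajorant.

Section LatticeDistance.
Variables (R : realType) (tau : R[i]).
Hypothesis tau_gt0 : 0 < complex.Im tau.
Local Notation C := R[i].
Local Notation pt := (@lattice_pt C tau).

Let y := complex.Im tau.

Lemma coords_dist : exists2 d : R, 0 < d & forall a b : R,
  d * Num.max `|a| `|b| <= nrm (a%:C + b%:C * tau).
Proof.
have den : 0 < 1 + y + nrm tau by rewrite ltr_pwDl ?nrm_ge0// addr_gt0.
(* The imaginary part gives [|b| y <= |w|], and then [|a| <= |w| + |b| |tau|]; so [|a|] and [|b|]
   are at most [|w| (1 + y + |tau|) / y]. *)
exists (y / (1 + y + nrm tau)); first by rewrite divr_gt0.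
move=> a b; set w := a%:C + b%:C * tau.
have bw : `|b| * y <= nrm w.
  apply: le_trans (Im_nrm w); rewrite /w Im_add Im_realM Im_real add0r normrM.
  by rewrite (gtr0_norm tau_gt0).
have aw : `|a| <= nrm w + `|b| * nrm tau.
  have -> : `|a| = nrm (w - b%:C * tau) by rewrite addrK nrm_real.
  by rewrite (le_trans (nrmB _ _))// nrmM nrm_real.
rewrite mulrAC ler_pdivrMr// maxr_pMr; last exact: ltW.
rewrite ge_max.
have := nrm_ge0 w; have := nrm_ge0 tau; have := tau_gt0; rewrite -/y.
move: (nrm w) (nrm tau) bw aw => u v bw aw y0 v0 u0.
by rewrite mulrC in bw; apply/andP; split; nra.
Qed.

Lemma coordsE (z : C) : exists a b : R, z = a%:C + b%:C * tau.
Proof.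
exists (complex.Re z - complex.Im z / y * complex.Re tau), (complex.Im z / y).
have y0 : y != 0 by rewrite gt_eqF.
apply/eqP; rewrite eq_complex Re_add Im_add Im_realM Im_real add0r divfK//.
by rewrite eqxx andbT; case: tau => u v /=; apply/eqP; ring.
Qed.

Lemma lattice_ptE m n : pt (m, n) = (m%:~R : R)%:C + (n%:~R : R)%:C * tau.
Proof. by rewrite /lattice_pt !rmorph_int. Qed.

(** Only nonzero lattice points are excluded, so [z = 0] is allowed. Any other [z] is off the
    lattice, hence one of its two real coordinates keeps a positive distance from the integers. This
    bounds the distance to nearby lattice points; for distant ones the shift by [z] is
    negligible. *)
Lemma lattice_far (z : C) : (forall p, p != (0, 0) -> z <> pt p) ->
  exists2 r : R, 0 < r & forall p, p != (0, 0) ->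
    r * (maxabs p)%:R <= nrm (z - pt p).
Proof.
move=> zL; have [d d0 hd] := coords_dist.
have [z0|/eqP z0] := eqVneq z 0.
  exists d => // -[m n] mn; rewrite maxabsE// z0 add0r nrmN lattice_ptE; exact: hd.
have {}zL p : z <> pt p.
  have [->|/zL//] := eqVneq p (0, 0).
  by rewrite /lattice_pt /= mul0r addr0.
have [a [b zE]] := coordsE z.
have zp m n : z - pt (m, n) = (a - m%:~R)%:C + (b - n%:~R)%:C * tau.
  by rewrite lattice_ptE zE !rmorphB; ring.
have [e e0 he] : exists2 e : R, 0 < e &
    forall m n : int, e <= Num.max `|a - m%:~R| `|b - n%:~R|.
  have [[m am]|/forallNP hm] := pselect (exists m : int, a = m%:~R).
    have [|e e0 he] := @dist_int _ b.
      move=> n bn; apply: (zL (m, n)); apply/eqP; rewrite -subr_eq0 zp am bn.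
      by rewrite !subrr mul0r addr0.
    by exists e => // m' n'; rewrite le_max he orbT.
  have [e e0 he] := dist_int hm.
  by exists e => // m' n'; rewrite le_max he.
pose c := 1 + `|a| + `|b|.
have c0 : 0 < c by rewrite /c ltr_pwDl// ltr_pwDl.
(* For the larger coordinate difference [X >= e], one has [maxabs p <= X + c <= X (1 + c / e)]. *)
exists (d / (1 + c / e)).
  by rewrite divr_gt0// addr_gt0// divr_gt0.
move=> -[m n] mn; rewrite zp; apply: le_trans (hd _ _).
rewrite -mulrA ler_pM2l// mulrC ler_pdivrMr ?addr_gt0 ?divr_gt0//.
have := he m n; set X := Num.max _ _ => eX.
rewrite maxabsE// mulrDr mulr1; apply: (@le_trans _ _ (X + c)); last first.
  by rewrite lerD2l mulrA ler_pdivlMr// mulrC ler_wpM2r// ltW.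
have Xa : `|a - m%:~R| <= X by rewrite le_max lexx.
have Xb : `|b - n%:~R| <= X by rewrite le_max lexx orbT.
rewrite ge_max /c /=; apply/andP; split.
  have := ler_normB a (a - m%:~R); rewrite opprB addrC subrK.
  by have := normr_ge0 b; lra.
have := ler_normB b (b - n%:~R); rewrite opprB addrC subrK.
by have := normr_ge0 a; lra.
Qed.

End LatticeDistance.

(** * The terms of the Weierstrass series, uniformly in the index *)

Section EisensteinFamily.
Variable R : realType.
Local Notation C := R[i].
Local Notation idx := (int * int)%type.
Implicit Types (tau z : C) (p : idx).

Definition nz p := p != (0, 0).

Definition eis tau z p : C :=
  (z - lattice_pt tau p) ^- 2 - lattice_pt tau p ^- 2.

Lemma wpE tau z : wp tau z = z ^- 2 + masked_sum nz (fun p _ => eis tau z p) 0.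
Proof.
rewrite /wp /masked_sum; congr (_ + sum _); apply/funext => p.
by rewrite /nz; case: eqP.
Qed.

Lemma uT_affine (I : Type) (P : pred I) K (u v : I -> C) (B B' : R) :
  (forall i, P i -> nrm (u i) <= B) -> (forall i, P i -> nrm (v i) <= B') ->
  uT P K (fun=> 1) (fun i x => u i + v i * x).
Proof.
move=> hu hv; apply: uTD.
  by apply: (@uT_cst _ _ _ _ _ _ B) => i Pi; rewrite mulr1 hu.
apply: uT1M; last exact: uT_id.
by apply: (@uT_cst _ _ _ _ _ _ B') => i Pi; rewrite mulr1 hv.
Qed.

Lemma lattice_ptDr tau (x : C) p : lattice_pt (tau + x) p = lattice_pt tau p + p.2%:~R * x.
Proof. by rewrite /lattice_pt mulrDr addrA. Qed.

Lemma lattice_pt_neq0 tau p : 0 < complex.Im tau -> nz p -> lattice_pt tau p != 0.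
Proof.
move=> t0 pn; have [d d0 hd] := coords_dist t0; case: p pn => m n pn.
rewrite -nrm_gt0 lattice_ptE (lt_le_trans _ (hd _ _))// mulr_gt0//.
by rewrite -(@maxabsE _ (m, n))// ltr0n /maxabs; lia.
Qed.

Lemma int_maxabs p : (`|(p.1)%:~R| <= (maxabs p)%:R :> R) * (`|(p.2)%:~R| <= (maxabs p)%:R :> R).
Proof. by split; rewrite -intr_norm -natr_absz pmulrn ler_nat /maxabs; lia. Qed.

(** With [w] the lattice point and [N] the size of the index, the term is
    [z (2 w - z) / ((z - w)^2 w^2)]. Divided by [N], the factors [2 w - z], [z - w] and [w] are
    uniformly bounded, and the last two are bounded below by [lattice_far]; what remains is
    [N ^- 3]. Point and lattice move together with [x], so that one estimate gives the expansions in
    [z] and in [tau]. *)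
Lemma uT_eis tau z (b c : C) K : 0 < complex.Im tau ->
  (forall p, nz p -> z <> lattice_pt tau p) ->
  uT nz K (@invcube R) (fun p x => eis (tau + c * x) (z + b * x) p).
Proof.
move=> t0 zL; have g0 := @invcube_ge0 R.
apply: (@uT_leq _ _ _ _ K.+1) => //.
have [r r0 hr] := lattice_far t0 zL.
have [|r' r'0 hr'] := lattice_far t0 (z := 0).
  by move=> p pn /esym/eqP; rewrite (negbTE (lattice_pt_neq0 t0 pn)).
pose N p : C := (maxabs p)%:R.
have N0 p : 0 < (maxabs p)%:R :> R by rewrite ltr0n /maxabs; lia.
have Nn p : N p != 0 by rewrite pnatr_eq0 /maxabs; lia.
have nN p : nrm (N p) = (maxabs p)%:R by rewrite nrm_nat.
have bnd (u : C) p (M : R) : nrm u <= M * (maxabs p)%:R -> nrm (u / N p) <= M.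
  by rewrite nrmM nrmV nN ler_pdivrMr.
have lowb (u : C) p (M : R) : M * (maxabs p)%:R <= nrm u -> M <= nrm (u / N p).
  by rewrite nrmM nrmV nN ler_pdivlMr.
have N1 p : 1 <= (maxabs p)%:R :> R by rewrite ler1n /maxabs; lia.
have ptB p : nrm (lattice_pt tau p) <= (1 + nrm tau) * (maxabs p)%:R.
  rewrite /lattice_pt (le_trans (nrmD _ _))// nrmM !nrm_int mulrDl mul1r lerD ?int_maxabs//.
  by rewrite mulrC ler_wpM2l ?nrm_ge0 ?int_maxabs.
have cstB (u : C) p : nrm u <= nrm u * (maxabs p)%:R.
  by rewrite ler_peMr ?nrm_ge0.
have slB (v w : C) p : nrm (v + p.2%:~R * w) <= (nrm v + nrm w) * (maxabs p)%:R.
  rewrite (le_trans (nrmD _ _))// mulrDl lerD ?cstB// nrmM nrm_int mulrC.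
  by rewrite ler_wpM2l ?nrm_ge0 ?int_maxabs.
pose F1 (p : idx) x := z + b * x.
pose F2 (p : idx) x := (2 * lattice_pt tau p - z) / N p + (- b + p.2%:~R * (2 * c)) / N p * x.
pose G3 (p : idx) x := (z - lattice_pt tau p) / N p + (b + p.2%:~R * (- c)) / N p * x.
pose G4 (p : idx) x := (0 - lattice_pt tau p) / N p + (0 + p.2%:~R * (- c)) / N p * x.
have uF1 L : uT nz L (fun=> 1) F1.
  by apply: (@uT_affine _ nz L (fun=> z) (fun=> b) (nrm z) (nrm b)).
have uF2 L : uT nz L (fun=> 1) F2.
  apply: (@uT_affine _ _ _ _ _ (2 * (1 + nrm tau) + nrm z) (nrm (- b) + nrm (2 * c))).
    move=> p _; apply: bnd; rewrite (le_trans (nrmB _ _))// [leRHS]mulrDl lerD ?cstB//.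
    by rewrite nrmM -mulrA ler_pM ?nrm_ge0// (nrm_nat R 2).
  by move=> p _; apply: bnd; apply: slB.
have uG3 L : uT nz L (fun=> 1) G3.
  apply: (@uT_affine _ _ _ _ _ (nrm z + (1 + nrm tau)) (nrm b + nrm (- c))).
    by move=> p _; apply: bnd; rewrite (le_trans (nrmB _ _))// [leRHS]mulrDl lerD ?cstB.
  by move=> p _; apply: bnd; apply: slB.
have uG4 L : uT nz L (fun=> 1) G4.
  apply: (@uT_affine _ _ _ _ _ (nrm (0 : C) + (1 + nrm tau)) (nrm (0 : C) + nrm (- c))).
    by move=> p _; apply: bnd; rewrite (le_trans (nrmB _ _))// [leRHS]mulrDl lerD ?cstB.
  by move=> p _; apply: bnd; apply: slB.
have low3 p : nz p -> r <= nrm (G3 p 0).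
  by move=> pn; rewrite /G3 mulr0 addr0; apply/lowb/hr.
have low4 p : nz p -> r' <= nrm (G4 p 0).
  by move=> pn; rewrite /G4 mulr0 addr0; apply/lowb/hr'.
have [d [d0 h3]] := uT_lower r0 (uG3 1%N) low3.
have [d' [d'0 h4]] := uT_lower r'0 (uG4 1%N) low4.
have uN : uT nz K.+1 (@invcube R) (fun p _ => N p ^- 3).
  apply: (@uT_cst _ _ _ _ _ _ 1) => p _.
  by rewrite mul1r nrmV nrmX nN.
have m0 : 0 < Num.min d d' by rewrite lt_min d0 d'0.
have := uTM1 g0 (uTX 2 (uTV r'0 (uG4 _) low4)) uN.
move/(uTM1 g0 (uTX 2 (uTV r0 (uG3 _) low3))).
move/(uTM1 g0 (uF2 _))/(uTM1 g0 (uF1 _)).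
apply: (uT_ext m0) => p x pn; rewrite le_min => /andP[xd xd'].
have n3 : G3 p x != 0.
  by rewrite -nrm_gt0 (lt_le_trans _ (h3 p x pn xd))// divr_gt0.
have n4 : G4 p x != 0.
  by rewrite -nrm_gt0 (lt_le_trans _ (h4 p x pn xd'))// divr_gt0.
have E3 : G3 p x = (z + b * x - lattice_pt (tau + c * x) p) / N p.
  by rewrite /G3 lattice_ptDr; field; exact: Nn.
have E4 : G4 p x = - lattice_pt (tau + c * x) p / N p.
  by rewrite /G4 lattice_ptDr; field; exact: Nn.
have E2 : F2 p x = (2 * lattice_pt (tau + c * x) p - (z + b * x)) / N p.
  by rewrite /F2 lattice_ptDr; field; exact: Nn.
rewrite /F1 E2 E3 E4 /eis; move: n3 n4; rewrite E3 E4.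
move: (lattice_pt _ _) (z + b * x) => w u.
rewrite !mulf_eq0 !negb_or oppr_eq0 => /andP[n3 _] /andP[n4 _].
by field; rewrite n3 n4 Nn.
Qed.

Lemma eis_has_sum tau z : 0 < complex.Im tau ->
  (forall p, nz p -> z <> lattice_pt tau p) ->
  has_sum (fun p => if nz p then eis tau z p else 0) (wp tau z - z ^- 2).
Proof.
move=> t0 zL; rewrite wpE addrC addKr.
have [B [d [d0 h]]] := @uT_eis tau z 0 0 0 t0 zL.
apply: (@masked_has_sum _ _ _ _ _ (@invcube_ge0 R) (@sum_invcube R) _ _ B) => p pn.
by have := h p 0 pn; rewrite !mulr0 !addr0 nrm0; apply; exact: ltW.
Qed.

Lemma taylor_masked_eis tau z (b c : C) K : 0 < complex.Im tau ->
  (forall p, nz p -> z <> lattice_pt tau p) ->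
  taylor K (fun x => masked_sum nz (fun p _ => eis (tau + c * x) (z + b * x) p) 0) 0.
Proof.
move=> t0 zL.
have := taylor_sum (@invcube_ge0 R) (@sum_invcube R) (uT_eis b c K t0 zL).
by congr taylor; apply/funext => x; rewrite /masked_sum.
Qed.

End EisensteinFamily.

(** * Parity, homogeneity and periods of the Weierstrass function *)

Section Weierstrass.
Variable R : realType.
Local Notation C := R[i].
Implicit Types (tau z : C) (p : int * int).

Definition off_lattice tau z := forall p, z <> lattice_pt tau p.

Lemma off_latticeP tau z : reflect (off_lattice tau z) (z \notin lattice tau).
Proof.
apply: (iffP idP) => [/negP h p zp|h].
  by apply: h; rewrite inE; exists p.
by apply/negP; rewrite inE => -[p _ /esym]; exact: h.
Qed.

Lemma lattice_pt0 tau : lattice_pt tau (0, 0) = 0.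
Proof. by rewrite /lattice_pt mul0r addr0. Qed.

Lemma lattice_ptD tau p q :
  lattice_pt tau p + lattice_pt tau q = lattice_pt tau (p.1 + q.1, p.2 + q.2).
Proof. by rewrite /lattice_pt !intrD; ring. Qed.

Lemma lattice_ptN tau p : - lattice_pt tau p = lattice_pt tau (- p.1, - p.2).
Proof. by rewrite /lattice_pt !intrN; ring. Qed.

Lemma off_latticeN tau z : off_lattice tau z -> off_lattice tau (- z).
Proof.
by move=> h p /eqP; rewrite eqr_oppLR lattice_ptN => /eqP/h.
Qed.

Lemma off_latticeD tau z p : off_lattice tau z -> off_lattice tau (z + lattice_pt tau p).
Proof.
by move=> h q /eqP; rewrite -subr_eq0 -addrA lattice_ptN lattice_ptD addr_eq0 lattice_ptN =>
  /eqP/h.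
Qed.

#[global] Arguments off_latticeD [tau z] p _.

Lemma off_lattice_neq0 tau z : off_lattice tau z -> z != 0.
Proof. by move=> /(_ (0, 0)); rewrite lattice_pt0 => /eqP. Qed.

Lemma off_lattice_half tau z : off_lattice tau z -> off_lattice tau (z / 2).
Proof.
move=> h p zp; apply: (h (p.1 + p.1, p.2 + p.2)).
by rewrite -lattice_ptD -zp; field.
Qed.

Lemma off_lattice_near tau z : 0 < complex.Im tau -> off_lattice tau z ->
  exists2 d : R, 0 < d & forall x, nrm x <= d -> off_lattice tau (z + x).
Proof.
move=> t0 zL; have [r r0 hr] := lattice_far t0 (fun p _ => zL p).
have z0 : 0 < nrm z by rewrite nrm_gt0; exact: off_lattice_neq0 zL.
exists (Num.min (r / 2) (nrm z / 2)); first by rewrite lt_min !divr_gt0.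
move=> x; rewrite le_min => /andP[xr xz] p zxp.
have [p0|/hr] := eqVneq p (0, 0).
  move: zxp; rewrite p0 lattice_pt0 => /eqP; rewrite addr_eq0 => /eqP zx.
  by move: xz z0; rewrite zx nrmN; lra.
have -> : z - lattice_pt tau p = - x by rewrite -zxp; ring.
have : r * 1 <= r * (maxabs p)%:R by rewrite ler_pM2l// ler1n /maxabs; lia.
by rewrite nrmN; lra.
Qed.

Lemma off_lattice_near0 tau : 0 < complex.Im tau ->
  exists2 d : R, 0 < d & forall x, x != 0 -> nrm x <= d -> off_lattice tau x.
Proof.
move=> t0; have [|r r0 hr] := lattice_far t0 (z := 0).
  by move=> p pn /esym/eqP; rewrite (negbTE (lattice_pt_neq0 t0 pn)).
exists (r / 2); first by rewrite divr_gt0.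
move=> x x0 xr p xp; have [p0|/hr] := eqVneq p (0, 0).
  by move: x0; rewrite xp p0 lattice_pt0 eqxx.
rewrite add0r -xp nrmN.
have : r * 1 <= r * (maxabs p)%:R by rewrite ler_pM2l// ler1n /maxabs; lia.
by lra.
Qed.

Lemma wp_has_sum tau z : 0 < complex.Im tau -> off_lattice tau z ->
  has_sum (fun p => if nz p then eis tau z p else 0) (wp tau z - z ^- 2).
Proof. by move=> t0 h; apply: eis_has_sum. Qed.

Lemma wp_even tau z : 0 < complex.Im tau -> off_lattice tau z -> wp tau (- z) = wp tau z.
Proof.
move=> t0 zL; have h := wp_has_sum t0 zL.
pose opp p : int * int := (- p.1, - p.2).
have oppK : cancel opp opp by move=> [m n]; rewrite /opp /= !opprK.
have := has_sum_reindex oppK oppK h.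
have := wp_has_sum t0 (off_latticeN zL).
have -> : (fun p => if nz p then eis tau z p else 0) \o opp =
          (fun p => if nz p then eis tau (- z) p else 0).
  apply/funext => p /=; have -> : nz (opp p) = nz p.
    by case: p => m n; rewrite /nz /opp !xpair_eqE /= !oppr_eq0.
  by case: ifP => // _; rewrite /eis -lattice_ptN opprK sqrrN -[z + _]opprK sqrrN opprD.
move=> h1 h2; have := has_sum_unique h1 h2.
by rewrite -!exprVn invrN sqrrN => /addIr.
Qed.

(** The lattice of the new parameter is [j^-1] times the old one. The automorphism [h] of Z^2, with
    inverse [k], matches the terms up to the factor [j ^+ 2], and an unordered sum may be reindexed
    by any bijection. *)
Lemma wp_SL2Z tau z (a b c d : int) : 0 < complex.Im tau -> off_lattice tau z ->
  a * d - b * c = 1 ->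
  let j := c%:~R * tau + d%:~R in
  wp ((a%:~R * tau + b%:~R) / j) (j^-1 * z) = j ^+ 2 * wp tau z.
Proof.
move=> t0 zL det1 j; have j0 : j != 0.
  have -> : j = lattice_pt tau (d, c) by rewrite /lattice_pt addrC.
  apply: lattice_pt_neq0 => //; apply/eqP => -[dE cE].
  by move: det1; rewrite dE cE; lia.
set tau' := _ / j.
pose h p := (p.1 * d + p.2 * b, p.1 * c + p.2 * a).
pose k p := (a * p.1 - b * p.2, d * p.2 - c * p.1).
have hk : cancel h k by move=> [m n]; rewrite /h /k /= -[m in RHS]mulr1 -[n in RHS]mulr1
  -det1; congr pair; ring.
have kh : cancel k h by move=> [m n]; rewrite /h /k /= -[m in RHS]mulr1 -[n in RHS]mulr1
  -det1; congr pair; ring.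
have E := has_sumZ (j ^+ 2) (has_sum_reindex hk kh (wp_has_sum t0 zL)).
have ptE p : lattice_pt tau' p = j^-1 * lattice_pt tau (h p).
  rewrite /lattice_pt /tau' !intrD !intrM /= /j.
  by field; exact: j0.
rewrite wpE /masked_sum (@has_sum_sum _ _ _ (j ^+ 2 * (wp tau z - z ^- 2))).
  rewrite mulrBr; have -> : (j^-1 * z) ^- 2 = j ^+ 2 * z ^- 2.
    by rewrite -!exprVn invfM invrK exprMn.
  by rewrite addrC subrK.
move: E; congr has_sum; apply/funext => p /=.
have -> : nz (h p) = nz p.
  rewrite /nz; congr negb; apply/eqP/eqP => [hp|->]; last by rewrite /h /= !mul0r.
  by rewrite -(hk p) hp /k /= !mulr0 subrr.
case: ifP => [pn|]; last by rewrite mulr0.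
rewrite /eis ptE -mulrBr -!exprVn !invfM !exprMn invrK.
by rewrite mulrBr.
Qed.

Lemma has_sum_single (I : choiceType) (i0 : I) (c : C) :
  has_sum (fun i => if i == i0 then c else 0) c.
Proof.
move=> e e0; exists [fset i0]%fset => B; rewrite fsub1set => iB.
rewrite (big_fsetD1 i0)//= eqxx big1_fset ?addr0 ?subrr ?nrm0 ?ltW// => i.
by rewrite !inE => /andP[/negbTE->].
Qed.

(* Summing over the boxes [|m|, |n| <= L], the difference telescopes to two
   edges of [2 L + 1] terms of size [L^-2]. *)
Lemma wp_add1 tau z : 0 < complex.Im tau -> off_lattice tau z -> wp tau (z + 1) = wp tau z.
Proof.
move=> t0 zL; have one : 1 = lattice_pt tau (1, 0) by rewrite /lattice_pt mul0r addr0.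
have z1L : off_lattice tau (z + 1) by rewrite one; exact: off_latticeD.
pose u m n : C := (z - lattice_pt tau (m, n)) ^- 2.
pose D p := u (p.1 - 1) p.2 - u p.1 p.2.
(* Counting [w ^- 2] as the term of index (0, 0) lets the shift by 1 act on all of Z^2; the
   constants [lattice_pt tau p ^- 2] then cancel in the difference. *)
have full w : off_lattice tau w ->
    has_sum (fun p => (w - lattice_pt tau p) ^- 2 -
                      (if nz p then lattice_pt tau p ^- 2 else 0)) (wp tau w).
  move=> wL; have := has_sumD (has_sum_single (0, 0) (w ^- 2)) (wp_has_sum t0 wL).
  rewrite addrC subrK; congr has_sum; apply/funext => p.
  rewrite /nz; case: eqP => [->|_] /=; last by rewrite add0r.
  by rewrite lattice_pt0 !subr0 addr0.
have : has_sum D (wp tau (z + 1) - wp tau z).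
  have := has_sumB (full _ z1L) (full _ zL); congr has_sum; apply/funext => -[m n].
  rewrite /D /u /= opprB addrA subrK; congr (_ ^- 2 - _).
  by rewrite /lattice_pt /= intrB; ring.
have [r r0 hr] := lattice_far t0 (fun p _ => zL p).
have ub m n (L : nat) : (0 < L <= `|m|)%N -> nrm (u m n) <= (r ^+ 2)^-1 / L%:R ^+ 2.
  move=> /andP[L0 Lm]; rewrite /u nrmV nrmX -invfM -exprMn.
  have mn : (m, n) != (0, 0) by rewrite xpair_eqE; lia.
  have LR : 0 < r * L%:R by rewrite mulr_gt0// ltr0n.
  have Lu : r * L%:R <= nrm (z - lattice_pt tau (m, n)).
    by rewrite (le_trans _ (hr _ mn))// ler_pM2l// ler_nat /maxabs /=; lia.
  have := lt_le_trans LR Lu => u0.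
  by rewrite lef_pV2 ?posrE ?exprn_gt0// lerXn2r// nnegrE ltW.
pose ss L : seq int := [seq k%:Z - L%:Z | k <- iota 0 (2 * L + 1)].
have iotaE n : iota 0 n = index_iota 0 n by rewrite /index_iota subn0.
have ss_uniq L : uniq (ss L).
  by rewrite map_inj_uniq ?iota_uniq// => k l; lia.
pose box L := [fset p in [seq (m, n) | n <- ss L, m <- ss L]]%fset.
have boxD L : (0 < L)%N -> nrm (\sum_(p <- box L) D p) <= 6 * (r ^+ 2)^-1 / L%:R.
  move=> L0; have -> : \sum_(p <- box L) D p =
      \sum_(p <- [seq (m, n) | n <- ss L, m <- ss L]) D p.
    apply: perm_big; apply: uniq_perm; first exact: fset_uniq.
      apply: allpairs_uniq => //.
      by move=> [n m] [n' m'] _ _ /= [-> ->].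
    by move=> p; rewrite inE.
  rewrite big_allpairs_dep /=.
  have row n : \sum_(m <- ss L) D (m, n) = u (- L%:Z - 1) n - u L%:Z n.
    rewrite big_map iotaE.
    pose v k : C := - u (k%:Z - L%:Z - 1) n.
    under eq_bigr => k _.
      rewrite (_ : D _ = v k.+1 - v k).
      over.
      rewrite /D /v /= opprK addrC; congr (- u _ _ + _); lia.
    rewrite telescope_sumr// /v opprK addrC; congr (u _ _ - u _ _); lia.
  under eq_bigr do rewrite row.
  apply: le_trans (nrm_sum _ _ _) _.
  apply: (@le_trans _ _ (\sum_(n <- ss L) 2 * ((r ^+ 2)^-1 / L%:R ^+ 2))).
    apply: ler_sum => n _; apply: le_trans (nrmB _ _) _.
    by rewrite mulr_natl mulr2n lerD// ub//; lia.
  rewrite big_map iotaE sumr_const_nat subn0 -[leLHS]mulr_natr.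
  have L1 : 1 <= L%:R :> R by rewrite ler1n.
  rewrite natrD natrM; set l := L%:R in L1 *.
  have rn : r != 0 by rewrite gt_eqF.
  have ln : l != 0 by rewrite gt_eqF// (lt_le_trans _ L1).
  have -> : 2 * ((r ^+ 2)^-1 / l ^+ 2) * (2 * l + 1) =
            (2 * (r ^+ 2)^-1 / l) * ((2 * l + 1) / l) by field; rewrite rn ln.
  have -> : 6 * (r ^+ 2)^-1 / l = (2 * (r ^+ 2)^-1 / l) * 3 by field; rewrite rn ln.
  have l0 : 0 < l by rewrite (lt_le_trans _ L1).
  apply: ler_wpM2l; last by rewrite ler_pdivrMr//; lra.
  by rewrite !mulr_ge0// ?invr_ge0 ?exprn_ge0// ltW.
move=> hD; apply/eqP; rewrite -subr_eq0; apply/eqP.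
apply: nrm_eps => e e0.
have e20 : 0 < e / 2 by rewrite divr_gt0.
have [A hA] := hD _ e20.
pose L0 := (\max_(p <- A) maxn `|p.1| `|p.2|)%N.
have [L [LL0 Lp Le]] : exists L : nat, [/\ (L0 <= L)%N, (0 < L)%N &
    6 * (r ^+ 2)^-1 / L%:R <= e / 2].
  pose M := 6 * (r ^+ 2)^-1 / (e / 2).
  exists (maxn (maxn 1 L0) (Num.truncn M).+1); split.
  - by rewrite !leq_max leqnn orbT.
  - by rewrite !leq_max.
  set L := maxn _ _.
  have ML : M <= L%:R.
    by rewrite (le_trans (ltW (truncnS_gt M)))// ler_nat /L leq_maxr.
  rewrite ler_pdivrMr; last by rewrite ltr0n !leq_max.
  by rewrite [leRHS]mulrC -ler_pdivrMr.
have sub : (A `<=` box L)%fset.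
  apply/fsubsetP => -[m n] pA; rewrite inE; apply/allpairsP; exists (n, m).
  have mnL : (maxn `|m| `|n| <= L0)%N.
    exact: (@leq_bigmax_seq _ _ xpredT (fun p : int * int => maxn `|p.1| `|p.2|)%N (m, n)).
  split => //=; apply/mapP.
    exists (`|(n + L%:Z)%R|%N); rewrite ?mem_iota; lia.
  exists (`|(m + L%:Z)%R|%N); rewrite ?mem_iota; lia.
have := hA _ sub; have := boxD L Lp; set S := \sum_(p <- _) _ => h1 h2.
rewrite -[X in nrm X](subrK S) (le_trans (nrmD _ _))//.
by rewrite nrm_distC (splitr e) lerD// (le_trans h1).
Qed.

End Weierstrass.

#[local] Opaque wp masked_sum.

Section WeierstrassTaylor.
Variables (R : realType) (tau : R[i]).
Hypothesis tau_gt0 : 0 < complex.Im tau.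
Local Notation C := R[i].
Local Notation off := (off_lattice tau).
Implicit Types (z x : C) (p : int * int).

(** Division by [- tau] turns translation by [tau] into translation by -1 for the parameter
    [- tau^-1], where [wp_add1] applies. *)
Lemma wp_addtau z : off z -> wp tau (z + tau) = wp tau z.
Proof.
move=> oz; have t0 : tau != 0.
  have := @lattice_pt_neq0 _ tau (0, 1) tau_gt0 isT.
  by rewrite /lattice_pt add0r mul1r.
have oz' : off (z + tau).
  have := off_latticeD (0, 1) oz; by rewrite /lattice_pt add0r mul1r.
have S w : off w -> wp (- tau^-1) (- (w / tau)) = tau ^+ 2 * wp tau w.
  move=> ow; have := @wp_SL2Z _ tau w 0 1 (-1) 0 tau_gt0 ow.
  move=> /(_ erefl) /=.
  rewrite mulr0z mulr1z mulrN1z mul0r add0r addr0 mulN1r sqrrN.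
  by rewrite invrN mulrN mul1r mulNr [_^-1 * _]mulrC.
have Im' : 0 < complex.Im (- tau^-1).
  case: tau tau_gt0 => a b /= b0; rewrite opprK divr_gt0//.
  by rewrite ltr_wpDl ?sqr_ge0// exprn_gt0.
have o' : off_lattice (- tau^-1) (- (z / tau) - 1).
  move=> [m n] h; apply: (oz (n, - m - 1)).
  rewrite /lattice_pt /= in h *; rewrite intrD !intrN.
  have -> : z = - tau * (- (z / tau) - 1) - tau by field.
  by rewrite h; field.
have tau2 : tau ^+ 2 != 0 by rewrite expf_neq0.
apply: (mulfI tau2).
rewrite -(S _ oz') -(S _ oz).
have -> : (z + tau) / tau = z / tau + 1 by rewrite mulrDl divff.
rewrite opprD -(wp_add1 Im' o').
by rewrite subrK.
Qed.

Lemma off_latticeB z p : off z -> off (z - lattice_pt tau p).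
Proof. by move=> oz; rewrite lattice_ptN; exact: off_latticeD. Qed.

Lemma wp_periodic p z : off z -> wp tau (z + lattice_pt tau p) = wp tau z.
Proof.
have gen (q : int * int) : (forall w, off w -> wp tau (w + lattice_pt tau q) = wp tau w) ->
    forall (m : int) w, off w -> wp tau (w + lattice_pt tau (m * q.1, m * q.2)) = wp tau w.
  move=> hq; have nat_case (n : nat) w : off w ->
      wp tau (w + lattice_pt tau (n%:Z * q.1, n%:Z * q.2)) = wp tau w.
    elim: n w => [|n IH] w ow; first by rewrite !mul0r lattice_pt0 addr0.
    rewrite -[RHS](IH _ ow) -[RHS](hq _ (off_latticeD _ ow)) -[in RHS]addrA lattice_ptD /=.
    congr (wp _ (_ + lattice_pt _ (_, _))); rewrite -add1n PoszD; ring.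
  case=> [n|n] w ow; first exact: nat_case.
  rewrite -[LHS](nat_case n.+1 _ (off_latticeD _ ow)) -addrA lattice_ptD /= NegzE.
  by rewrite !mulNr !addNr lattice_pt0 addr0.
case: p => m n oz.
have -> : lattice_pt tau (m, n) = lattice_pt tau (m, 0) + lattice_pt tau (0, n).
  by rewrite lattice_ptD /= addr0 add0r.
have per1 w : off w -> wp tau (w + lattice_pt tau (1, 0)) = wp tau w.
  by move=> ow; rewrite /lattice_pt /= mul0r addr0 wp_add1.
have pertau w : off w -> wp tau (w + lattice_pt tau (0, 1)) = wp tau w.
  by move=> ow; rewrite /lattice_pt /= mul1r add0r wp_addtau.
have h1 := gen (1, 0) per1 m z oz.
have h2 := gen (0, 1) pertau n _ (off_latticeD (m, 0) oz).
have e1 : (m * (1%:Z, 0%:Z).1, m * (1%:Z, 0%:Z).2) = (m, 0) :> (int * int)%type.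
  by rewrite /= mulr1 mulr0.
have e2 : (n * (0%:Z, 1%:Z).1, n * (0%:Z, 1%:Z).2) = (0, n) :> (int * int)%type.
  by rewrite /= mulr1 mulr0.
rewrite e2 in h2; rewrite e1 in h1.
by rewrite addrA h2 h1.
Qed.

Lemma taylor_shift0 K (f : C -> C) z : taylor K (fun x => f (z + x)) 0 -> taylor K f z.
Proof.
by apply: (uT_ext ltr01) => _ x _ _ /=; rewrite add0r.
Qed.

(** What is left of [wp] without its polar part at 0; unlike [wp] it has Taylor expansions at 0. *)
Definition wp_reg z : C := masked_sum (@nz) (fun p _ => eis tau z p) 0.

Lemma wp_regE z : wp tau z = z ^- 2 + wp_reg z.
Proof. exact: wpE. Qed.

Lemma taylor_wp_reg K z : (forall p, nz p -> z <> lattice_pt tau p) -> taylor K wp_reg z.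
Proof.
move=> h; apply: taylor_shift0.
have h' := taylor_masked_eis 1 0 K tau_gt0 h.
apply: taylor_eq ltr01 _ h' => x _.
by rewrite /wp_reg mul0r addr0 mul1r.
Qed.

Lemma taylor_wp K z : off z -> taylor K (wp tau) z.
Proof.
move=> oz; have z0 := off_lattice_neq0 oz.
have h : taylor K (fun x => x ^- 2 + wp_reg x) z.
  apply: taylorD; last by apply: taylor_wp_reg => p _; exact: oz.
  apply: (@taylor_leq _ K K.+1); first exact: leqnSn.
  by apply: taylorV; [rewrite expf_neq0|apply/taylorX/taylor_id].
by apply: taylor_eq ltr01 _ h => x _; rewrite wp_regE.
Qed.

(** The point moves linearly with the parameter, as the points of order four do. *)
Lemma taylor_wp_tau (b z : C) K : off z ->
  taylor K (fun t => wp t (z + b * (t - tau))) tau.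
Proof.
move=> oz; have z0 := off_lattice_neq0 oz.
have h : taylor K (fun x => (z + b * x) ^- 2 +
   masked_sum (@nz) (fun p _ => eis (tau + 1 * x) (z + b * x) p) 0) 0.
  apply: taylorD; last by apply: taylor_masked_eis => // p _; exact: oz.
  apply: (@taylor_leq _ K K.+1); first exact: leqnSn.
  apply: taylorV; first by rewrite mulr0 addr0 expf_neq0.
  apply/taylorX/taylorD; first exact: taylor_cst.
  by apply: taylorM; [exact: taylor_cst|exact: taylor_id].
apply: taylor_shift0; apply: taylor_eq ltr01 _ h => x _.
by rewrite wpE !add0r mul1r addrAC subrr add0r.
Qed.

Lemma wp_pole (a : C) : exists2 d : R, 0 < d &
  forall x, x != 0 -> nrm x <= d -> wp tau x != a.
Proof.
have [|B [d [d0 h]]] := @taylor_bounded _ wp_reg 0.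
  apply: taylor_wp_reg => p pn /esym/eqP.
  by rewrite (negbTE (lattice_pt_neq0 tau_gt0 pn)).
have M0 : 0 < 1 + `|B| + nrm a by rewrite ltr_pwDl ?nrm_ge0// ltr_pwDl.
(* The three radii bound [wp_reg] by [B], give [|x|^-1 <= |x|^-2], and make [|x|^-1] exceed
   [|a| + |B|]. *)
exists (Num.min d (Num.min 1 (1 + `|B| + nrm a)^-1)).
  by rewrite !lt_min d0 ltr01 invr_gt0.
move=> x x0; rewrite !le_min => /andP[xd /andP[x1 xM]].
apply/eqP => /(congr1 (fun u => u - wp_reg x)); rewrite wp_regE addrK => E.
have : nrm (x ^- 2) <= nrm a + `|B|.
  rewrite E (le_trans (nrmB _ _))// lerD2l (le_trans _ (ler_norm B))//.
  by have := h x xd; rewrite add0r.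
have x0' : 0 < nrm x by rewrite nrm_gt0.
have : 1 + `|B| + nrm a <= (nrm x)^-1 by rewrite -[leLHS]invrK lef_pV2 ?posrE ?invr_gt0.
have : (nrm x)^-1 <= nrm (x ^- 2).
  rewrite nrmV nrmX lef_pV2 ?posrE ?exprn_gt0// expr2.
  by rewrite -[leRHS]mul1r ler_pM2r.
by lra.
Qed.

End WeierstrassTaylor.

(** * Liouville's theorem *)

Section Liouville.
Variable R : realType.
Local Notation C := R[i].

(** Serves twice: for the maximum principle, in real and imaginary parts, and for the boundedness of
    periodic functions, in coordinates relative to 1 and [tau]. *)
Lemma compact_square_max (U : R -> R -> R) (L : R) : 0 <= L ->
  (forall x y, `|x| <= L -> `|y| <= L -> forall e, 0 < e -> exists2 d, 0 < d &
    forall x' y', `|x - x'| < d -> `|y - y'| < d -> `|U x y - U x' y'| <= e) ->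
  exists x y, [/\ `|x| <= L, `|y| <= L &
    forall x' y', `|x'| <= L -> `|y'| <= L -> U x' y' <= U x y].
Proof.
move=> L0 cU.
pose A : set (R * R) := `[- L, L]%classic `*` `[- L, L]%classic.
have AE x y : A (x, y) <-> (`|x| <= L /\ `|y| <= L).
  by rewrite /A /= !in_itv /= !ler_norml.
have cA : compact A by apply: compact_setX; exact: segment_compact.
have A0 : A !=set0 by exists (0, 0); apply/AE; rewrite normr0.
have [|[x y] /set_mem/AE[xL yL] mx] := @compact_EVT_max _ R (fun p : R * R => U p.1 p.2) A A0 cA.
  apply: continuous_in_subspaceT => -[x y] /set_mem/AE[xL yL].
  apply/cvgrPdist_le => /= e e0; have [d d0 h] := cU x y xL yL e e0.
  exists (ball x d, ball y d) => /=; first by split; exact: nbhsx_ballx.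
  by move=> [x' y'] /= [xd yd]; exact: h.
exists x, y; split => // x' y' x'L y'L.
by have := mx (x', y'); apply; apply/mem_set/AE.
Qed.

Lemma complexB (x y x' y' : R) : (x +i* y) - (x' +i* y') = (x - x') +i* (y - y').
Proof. by []. Qed.

Lemma taylor3E (Q : C -> C) z : taylor 3 Q z -> exists c1 c2 : C, exists B d : R,
  [/\ 0 < d, 0 < B & forall x, nrm x <= d ->
    nrm (Q (z + x) - (Q z + c1 * x + c2 * x ^+ 2)) <= B * nrm x ^+ 3].
Proof.
move=> /taylorS[g1 [/taylorS[g2 [/taylorS[g3 [/taylor_bounded[B [d4 [d40 h4]]] [d3 d30 h3]]]
  [d2 d20 h2]]] [d1 d10 h1]]].
exists (g1 0), (g2 0), (`|B| + 1), (Num.min (Num.min d1 d2) (Num.min d3 d4)).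
split; [by rewrite !lt_min d10 d20 d30 d40|by rewrite ltr_wpDl|].
move=> x; rewrite !le_min => /andP[/andP[xd1 xd2] /andP[xd3 xd4]].
have E1 := h1 x xd1; have E2 := h2 x xd2; have E3 := h3 x xd3; have E4 := h4 x xd4.
rewrite add0r in E2 E3 E4; rewrite E1 E2 E3.
have -> : Q z + x * (g1 0 + x * (g2 0 + x * g3 x)) - (Q z + g1 0 * x + g2 0 * x ^+ 2)
  = g3 x * x ^+ 3 by ring.
rewrite nrmM nrmX ler_wpM2r ?exprn_ge0 ?nrm_ge0// (le_trans E4)//.
by rewrite ler_wpDr// ler_norm.
Qed.

(* At an interior maximum of [Re Q + e |z|^2], averaging over the four points
   [z + t i^k] cancels the first two orders of [Q] and leaves [e t^2 > 0]. *)
Lemma max_principle (Q : C -> C) (L M : R) : 0 < L ->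
  (forall x y, `|x| <= L -> `|y| <= L -> taylor 3 Q (x +i* y)) ->
  (forall x y, `|x| <= L -> `|y| <= L -> `|x| = L \/ `|y| = L ->
     complex.Re (Q (x +i* y)) <= M) ->
  forall x y, `|x| <= L -> `|y| <= L -> complex.Re (Q (x +i* y)) <= M.
Proof.
move=> L0 hT hM x0 y0 x0L y0L; rewrite leNgt; apply/negP => Mlt.
(* On the square [e |z|^2] is at most half of the excess over [M], too little to bring a maximum of
   [V] to the boundary. *)
pose e := (complex.Re (Q (x0 +i* y0)) - M) / (4 * L ^+ 2).
have L2 : 0 < L ^+ 2 by rewrite exprn_gt0.
have e0 : 0 < e by rewrite divr_gt0 ?subr_gt0// mulr_gt0.
pose V x y := complex.Re (Q (x +i* y)) + e * (x ^+ 2 + y ^+ 2).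
have sqL (x : R) : `|x| <= L -> x ^+ 2 <= L ^+ 2.
  by move=> xL; rewrite -real_normK ?num_real// lerXn2r// nnegrE ltW.
have [x y xL yL eps eps0|x1 [y1 [x1L y1L mx]]] := @compact_square_max V L (ltW L0).
  have [B [d [d0 B0 hB]]] := taylor_lipschitz (hT x y xL yL).
  pose K := 2 * B + e * (2 * (2 * L + 1)).
  have K0 : 0 < K by rewrite addr_gt0// mulr_gt0// ?mulr_gt0// addr_gt0// mulr_gt0.
  exists (Num.min (d / 2) (Num.min 1 (eps / K))).
    by rewrite !lt_min !divr_gt0// ltr01.
  move=> x' y'; rewrite !lt_min => /andP[xd /andP[x1 xK]] /andP[yd /andP[y1 yK]].
  have sq (u u' : R) : `|u| <= L -> `|u - u'| < 1 -> `|u ^+ 2 - u' ^+ 2| <= (2 * L + 1) * `|u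
    - u'|.
    move=> uL u1; rewrite subr_sqr normrM mulrC ler_wpM2r//.
    have -> : u + u' = 2 * u - (u - u') by ring.
    by rewrite (le_trans (ler_normB _ _))// normrM ger0_norm// lerD ?ler_pM2l// ltW.
  have := sq x x' xL x1; have := sq y y' yL y1.
  have nz : nrm ((x' +i* y') - (x +i* y)) <= `|x - x'| + `|y - y'|.
    by rewrite complexB (le_trans (nrm_ReIm _))//= (distrC x') (distrC y').
  have := hB ((x' +i* y') - (x +i* y)); rewrite [_ + (_ - _)]addrC subrK => hQ.
  have {}hQ : `|complex.Re (Q (x +i* y)) - complex.Re (Q (x' +i* y'))| <= B * (`|x - x'| +
    `|y - y'|).
    rewrite distrC -raddfB; apply: le_trans (Re_nrm _) _.
    apply: le_trans (hQ _) _; last by rewrite ler_pM2l.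
    by apply: le_trans nz _; lra.
  move=> hy hx; rewrite /V.
  have -> : complex.Re (Q (x +i* y)) + e * (x ^+ 2 + y ^+ 2) -
    (complex.Re (Q (x' +i* y')) + e * (x' ^+ 2 + y' ^+ 2)) =
    (complex.Re (Q (x +i* y)) - complex.Re (Q (x' +i* y'))) +
    (e * (x ^+ 2 - x' ^+ 2) + e * (y ^+ 2 - y' ^+ 2)) by ring.
  apply: le_trans (ler_normD _ _) _.
  apply: le_trans (lerD hQ (ler_normD _ _)) _.
  rewrite !(normrM e) (gtr0_norm e0).
  have hx' : e * `|x ^+ 2 - x' ^+ 2| <= e * ((2 * L + 1) * (eps / K)).
    rewrite ler_pM2l// (le_trans hx)// ler_pM2l ?ltW//.
    by rewrite addr_gt0// mulr_gt0.
  have hy' : e * `|y ^+ 2 - y' ^+ 2| <= e * ((2 * L + 1) * (eps / K)).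
    rewrite ler_pM2l// (le_trans hy)// ler_pM2l ?ltW//.
    by rewrite addr_gt0// mulr_gt0.
  have hB' : B * (`|x - x'| + `|y - y'|) <= B * (eps / K + eps / K).
    by rewrite ler_pM2l// lerD// ltW.
  apply: le_trans (lerD hB' (lerD hx' hy')) _.
  have -> : B * (eps / K + eps / K) + (e * ((2 * L + 1) * (eps / K)) + e * ((2 * L + 1) *
    (eps / K)))
    = K * (eps / K) by rewrite {5}/K; ring.
  by rewrite mulrC divfK// gt_eqF.
have V0 : complex.Re (Q (x0 +i* y0)) <= V x1 y1.
  apply: le_trans (mx x0 y0 x0L y0L); rewrite /V lerDl.
  by apply: mulr_ge0; [exact: ltW|rewrite addr_ge0 ?sqr_ge0].
have [x1i y1i] : `|x1| < L /\ `|y1| < L.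
  apply/andP; rewrite !lt_neqAle x1L y1L !andbT; apply/andP.
  have nb : ~ (`|x1| = L \/ `|y1| = L).
    move=> /(hM _ _ x1L y1L) hb.
    have : e * (x1 ^+ 2 + y1 ^+ 2) <= e * (2 * L ^+ 2).
      by rewrite ler_pM2l// mulr_natl mulr2n lerD// sqL.
    have -> : e * (2 * L ^+ 2) = (complex.Re (Q (x0 +i* y0)) - M) / 2.
      by rewrite /e; field; rewrite gt_eqF.
    by move: V0; rewrite /V; lra.
  by split; apply/eqP => h; apply: nb; [left|right].
have [c1 [c2 [B [d [d0 B0 hB]]]]] := taylor3E (hT x1 y1 x1L y1L).
(* Small enough for the expansion to hold, for the cubic error at each point to be at most
   [e t^2 / 2], and for the four points to stay in the square. *)
pose t := Num.min (Num.min d (e / (2 * B))) (Num.min (L - `|x1|) (L - `|y1|)).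
have t0 : 0 < t by rewrite !lt_min d0 !subr_gt0 x1i y1i !andbT /= divr_gt0// mulr_gt0.
have td : t <= d by rewrite !ge_min lexx.
have tB : t <= e / (2 * B) by rewrite !ge_min lexx orbT.
have tx : `|x1| + t <= L.
  by rewrite -lerBrDl !ge_min lexx !orbT.
have ty : `|y1| + t <= L.
  by rewrite -lerBrDl !ge_min lexx !orbT.
have tn : `|t| = t by rewrite gtr0_norm.
have near (s : R) : `|s| = t -> `|x1 + s| <= L /\ `|y1 + s| <= L.
  by move=> st; split; [apply: le_trans (ler_normD _ _) _|apply: le_trans (ler_normD _ _) _];
    rewrite st.
have tN : `|- t| = t by rewrite normrN.
have V1 := mx _ _ (near _ tn).1 y1L; have V2 := mx _ _ (near _ tN).1 y1L.
have V3 := mx _ _ x1L (near _ tn).2; have V4 := mx _ _ x1L (near _ tN).2.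
have est (x : C) : nrm x = t -> complex.Re (Q (x1 +i* y1) + c1 * x + c2 * x ^+ 2) - B * t ^+ 3
    <= complex.Re (Q (x1 +i* y1 + x)).
  move=> xt; have := hB x; rewrite xt => /(_ td); set W := _ + c2 * _ => h.
  have := Re_nrm (Q (x1 +i* y1 + x) - W); rewrite raddfB /= ler_norml => /andP[h' _].
  by lra.
pose T : C := t%:C.
have nT : nrm T = t by rewrite nrm_real.
have nNT : nrm (- T) = t by rewrite nrmN.
have ni : nrm ('i : C) = 1 by rewrite /= expr0n expr1n add0r sqrtr1.
have niT : nrm ('i * T) = t by rewrite nrmM ni mul1r.
have nNiT : nrm (- ('i * T)) = t by rewrite nrmN.
have := est _ nT; have := est _ nNT; have := est _ niT; have := est _ nNiT.
have -> : x1 +i* y1 + T = (x1 + t) +i* y1 by apply/eqP; rewrite eq_complex /= addr0 !eqxx.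
have -> : x1 +i* y1 + - T = (x1 - t) +i* y1.
  by apply/eqP; rewrite eq_complex /= oppr0 addr0 !eqxx.
have -> : x1 +i* y1 + 'i * T = x1 +i* (y1 + t).
  by apply/eqP; rewrite eq_complex /= !mulr0 !mul0r !mul1r subr0 add0r addr0 !eqxx.
have -> : x1 +i* y1 + - ('i * T) = x1 +i* (y1 - t).
  by apply/eqP; rewrite eq_complex /= !mulr0 !mul0r !mul1r subr0 add0r oppr0 addr0 !eqxx.
have sum4 : complex.Re (Q (x1 +i* y1) + c1 * T + c2 * T ^+ 2) +
   complex.Re (Q (x1 +i* y1) + c1 * - T + c2 * (- T) ^+ 2) +
   complex.Re (Q (x1 +i* y1) + c1 * ('i * T) + c2 * ('i * T) ^+ 2) +
   complex.Re (Q (x1 +i* y1) + c1 * - ('i * T) + c2 * (- ('i * T)) ^+ 2) =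
   4 * complex.Re (Q (x1 +i* y1)).
  have i2 : ('i : C) ^+ 2 = -1 by exact: sqr_i.
  rewrite -!Re_add.
  have -> : 4 * complex.Re (Q (x1 +i* y1)) = complex.Re (4 * Q (x1 +i* y1)).
    have -> : 4 * Q (x1 +i* y1) = Q (x1 +i* y1) + Q (x1 +i* y1) + Q (x1 +i* y1) + Q (x1 +i* y1).
      by ring.
    by rewrite !Re_add; ring.
  congr complex.Re; rewrite !sqrrN exprMn i2; ring.
have tB3 : B * t ^+ 3 <= e * t ^+ 2 / 2.
  have -> : B * t ^+ 3 = (B * t) * t ^+ 2 by ring.
  have -> : e * t ^+ 2 / 2 = (e / 2) * t ^+ 2 by ring.
  rewrite ler_pM2r ?exprn_gt0//; move: tB.
  by rewrite invfM mulrA ler_pdivlMr// [t * _]mulrC.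
have et : 0 < e * t ^+ 2 by rewrite mulr_gt0// exprn_gt0.
move: V1 V2 V3 V4; rewrite /V.
have -> : e * ((x1 + t) ^+ 2 + y1 ^+ 2) = e * (x1 ^+ 2 + y1 ^+ 2) + 2 * (e * x1 * t) + e * t
  ^+ 2 by ring.
have -> : e * ((x1 - t) ^+ 2 + y1 ^+ 2) = e * (x1 ^+ 2 + y1 ^+ 2) - 2 * (e * x1 * t) + e * t
  ^+ 2 by ring.
have -> : e * (x1 ^+ 2 + (y1 + t) ^+ 2) = e * (x1 ^+ 2 + y1 ^+ 2) + 2 * (e * y1 * t) + e * t
  ^+ 2 by ring.
have -> : e * (x1 ^+ 2 + (y1 - t) ^+ 2) = e * (x1 ^+ 2 + y1 ^+ 2) - 2 * (e * y1 * t) + e * t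
  ^+ 2 by ring.
lra.
Qed.

Lemma bounded_constant (h : C -> C) (M : R) :
  (forall z, taylor 4 h z) -> (forall z, nrm (h z) <= M) -> forall z, h z = h 0.
Proof.
move=> hT hM; have /taylorS[g [gT [d d0 hg]]] := hT 0.
have M0 : 0 <= M := le_trans (nrm_ge0 _) (hM 0).
(* The removable singularity gets its limit. The quotient has order three, as [max_principle]
   requires. *)
pose Q z := if z == 0 then g 0 else (h z - h 0) / z.
have QT z : taylor 3 Q z.
  have [->|z0] := eqVneq z 0.
    apply: taylor_eq d0 _ gT => x xd; rewrite add0r /Q.
    case: eqP => [->//|/eqP x0]; have := hg x xd; rewrite add0r => ->.
    by rewrite addrC addKr mulrC mulKf.
  have nz0 : 0 < nrm z / 2 by rewrite divr_gt0 ?nrm_gt0.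
  have T3 : taylor 3 (fun x => (h x - h 0) * x^-1) z.
    apply: taylorM; last by apply: taylorV => //; exact: taylor_id.
    by apply: taylorB; [exact: taylor_leq (hT z)|exact: taylor_cst].
  apply: (taylor_eq nz0 _ T3) => x xz; rewrite /Q ifN// addr_eq0.
  by apply/eqP => zx; move: xz nz0; rewrite zx nrmN; lra.
have Q0 z : z != 0 -> Q z = 0.
  (* Multiplied by the conjugate of its value at [z], the quotient takes there the real value
     [|Q z|^2]; a bound on real parts thus bounds the modulus. *)
  move=> z0; pose c := ((Q z)^*)%C.
  have cQ : c * Q z = (nrm (Q z) ^+ 2)%:C.
    by rewrite mulrC -sqr_normc nrmE rmorphXn.
  have bound L : nrm z <= L -> 0 < L -> nrm (Q z) ^+ 2 <= nrm c * (2 * M) / L.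
    move=> zL L0; have : complex.Re (c * Q z) <= nrm c * (2 * M) / L.
      have [x [y zE]] : exists x y, z = x +i* y by case: (z) => x y; exists x, y.
      rewrite [in Q z]zE.
      apply: (@max_principle (fun w => c * Q w) L) => //.
      - by move=> *; apply: taylorM; [exact: taylor_cst|exact: QT].
      - move=> x' y' _ _ b; apply: le_trans (le_trans (ler_norm _) (Re_nrm _)) _.
        rewrite nrmM -mulrA ler_wpM2l ?nrm_ge0//.
        have Lw : L <= nrm (x' +i* y').
          by case: b => <-; [exact: (Re_nrm (x' +i* y'))|exact: (Im_nrm (x' +i* y'))].
        have w0 : x' +i* y' != 0 by rewrite -nrm_gt0 (lt_le_trans L0).
        rewrite /Q (negbTE w0) nrmM nrmV ler_pM ?nrm_ge0 ?invr_ge0 ?nrm_ge0//.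
          by rewrite (le_trans (nrmB _ _))// mulr_natl mulr2n lerD.
        by rewrite lef_pV2 ?posrE// (lt_le_trans L0).
      - by apply: le_trans zL; have := Re_nrm z; rewrite zE.
      - by apply: le_trans zL; have := Im_nrm z; rewrite zE.
    by rewrite cQ.
  apply/eqP; rewrite -nrm_eq0 -sqrf_eq0 eq_le sqr_ge0 andbT.
  apply/ler_addgt0Pr => e e0; rewrite add0r.
  have K0 : 0 <= nrm c * (2 * M) by rewrite mulr_ge0 ?nrm_ge0// mulr_ge0.
  pose L := nrm z + (nrm c * (2 * M)) / e + 1.
  have Ke : 0 <= nrm c * (2 * M) / e by rewrite divr_ge0// ltW.
  have L0 : 0 < L by rewrite ltr_wpDl// addr_ge0 ?nrm_ge0.
  apply: le_trans (bound L _ L0) _; first by rewrite /L; lra.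
  rewrite ler_pdivrMr// [e * _]mulrC -ler_pdivrMr// /L.
  by have := nrm_ge0 z; lra.
move=> z; have [->//|z0] := eqVneq z 0.
have := Q0 z z0; rewrite /Q (negbTE z0) => /eqP.
by rewrite mulf_eq0 invr_eq0 (negbTE z0) orbF subr_eq0 => /eqP.
Qed.

End Liouville.

(** * Translation by half periods *)

Section TranslationProduct.
Variables (R : realType) (tau : R[i]).
Hypothesis tau_gt0 : 0 < complex.Im tau.
Local Notation C := R[i].
Local Notation off := (off_lattice tau).
Local Notation P := (wp tau).
Local Notation pt := (lattice_pt tau).
Implicit Types (z x u : C).

Lemma periodic_constant (h : C -> C) :
  (forall z p, h (z + pt p) = h z) -> (forall z, taylor 4 h z) -> forall z, h z = h 0.
Proof.
move=> hp hT.
(* Translation by the lattice brings the coordinates relative to 1 and [tau] into this compact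
   square. *)
have [B hB] : exists B : R, forall x y : R, `|x| <= 1 -> `|y| <= 1 ->
    nrm (h (x%:C + y%:C * tau)) <= B.
  have [x y xL yL eps eps0|x [y [_ _ mx]]] :=
      @compact_square_max _ (fun x y : R => nrm (h (x%:C + y%:C * tau))) 1 ler01; last first.
    by exists (nrm (h (x%:C + y%:C * tau))).
  have [B [d [d0 B0 hB]]] := taylor_lipschitz (hT (x%:C + y%:C * tau)).
  have K0 : 0 < 1 + nrm tau by rewrite ltr_pwDl ?nrm_ge0.
  exists (Num.min d (eps / B) / (1 + nrm tau)).
    by rewrite divr_gt0// lt_min d0 divr_gt0.
  move=> x' y'; rewrite !ltr_pdivlMr// => xx' yy'.
  pose w : C := (x' - x)%:C + (y' - y)%:C * tau.
  have wE : x'%:C + y'%:C * tau = (x%:C + y%:C * tau) + w.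
    by rewrite /w !rmorphB; ring.
  have nw : nrm w <= Num.min d (eps / B).
    have le1 : nrm w <= `|x - x'| + `|y - y'| * nrm tau.
      by rewrite (le_trans (nrmD _ _))// nrmM !nrm_real (distrC x') (distrC y').
    have [yx|xy] := leP `|y - y'| `|x - x'|.
      rewrite (le_trans le1)// (le_trans _ (ltW xx'))// mulrDr mulr1 lerD2l.
      by rewrite ler_wpM2r ?nrm_ge0.
    by rewrite (le_trans le1)// (le_trans _ (ltW yy'))// mulrDr mulr1 lerD2r ltW.
  move: nw; rewrite le_min wE => /andP[wd wB].
  apply: le_trans (nrm_lip _ _) _; rewrite nrm_distC.
  by rewrite (le_trans (hB w wd))// mulrC -ler_pdivlMr.
apply: (@bounded_constant _ h B hT) => z; have [a [b ->]] := coordsE tau_gt0 z.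
pose m := Num.floor a; pose n := Num.floor b.
have -> : h (a%:C + b%:C * tau) = h ((a - m%:~R)%:C + (b - n%:~R)%:C * tau).
  rewrite -[RHS](hp _ (m, n)) lattice_ptE; congr h; rewrite !rmorphB; ring.
have fl (c : R) : `|c - (Num.floor c)%:~R| <= 1.
  have := floor_le c; have := floorD1_gt c; rewrite intrD mulr1z => c1 c2.
  by rewrite ger0_norm; lra.
exact: hB.
Qed.

Lemma uT_subst_opp (I : Type) (Q : pred I) K g (F : I -> C -> C) :
  (forall i, 0 <= g i) -> uT Q K g F -> uT Q K g (fun i x => F i (- x)).
Proof.
move=> g0; elim: K F => [|K IH] F.
  by move=> [B [d [d0 h]]]; exists B, d; split => // i x Qi xd; rewrite h// nrmN.
move=> [c [G [B [d [d0 h1 h2 h3]]]]].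
exists c, (fun i x => - G i (- x)), B, d; split => //.
  by apply: uT_opp => //; exact: IH.
by move=> i x Qi xd; rewrite h3 ?nrmN// mulrN mulNr.
Qed.

Lemma off_lattice_periodic z p : off (z + pt p) <-> off z.
Proof.
split; last exact: off_latticeD.
by move=> h; rewrite -[z](addrK (pt p)); exact: off_latticeB.
Qed.

Lemma not_off0 : ~ off 0.
Proof. by move=> /(_ (0, 0)); rewrite lattice_pt0. Qed.

(* The poles of one factor are cancelled by the double zeros of the other. *)
Lemma wp_translation_product u a (g : C -> C) (d : R) : off u -> taylor 4 g 0 ->
  0 < d -> (forall x, nrm x <= d -> P (u + x) - a = x ^+ 2 * g x) ->
  forall z, off z -> off (z - u) -> (P z - a) * (P (z - u) - a) = g 0.
Proof.
move=> ou gT d0 hg.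
(* The lattice and its translate by [u] are removable singularities, with the same limit [g 0]: near
   the lattice [P (x - u)] equals [P (u - x)] by evenness, and the expansion at [u] applies. *)
pose h z := if `[< off z /\ off (z - u) >] then (P z - a) * (P (z - u) - a) else g 0.
have hp z p : h (z + pt p) = h z.
  rewrite /h; have -> : z + pt p - u = z - u + pt p by ring.
  have -> : `[< off (z + pt p) /\ off (z - u + pt p) >] = `[< off z /\ off (z - u) >].
    by apply/asbool_equiv_eq; rewrite !off_lattice_periodic.
  by case: asboolP => // -[oz ozu]; rewrite !wp_periodic.
have hp' z p : h (z - pt p) = h z by rewrite lattice_ptN hp.
have [r r0 hr] := off_lattice_near0 tau_gt0.
have [s s0 hs] := off_lattice_near tau_gt0 ou.
pose e := Num.min d (Num.min r s).
have e0 : 0 < e by rewrite !lt_min d0 r0 s0.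
have regT K : taylor K (wp_reg tau) 0.
  apply: taylor_wp_reg => // p pn /esym/eqP.
  by rewrite (negbTE (lattice_pt_neq0 tau_gt0 pn)).
have coefT : taylor 4 (fun x => 1 + x ^+ 2 * (wp_reg tau x - a)) 0.
  apply: taylorD; first exact: taylor_cst.
  apply: taylorM; first exact/taylorX/taylor_id.
  by apply: taylorB; [exact: regT|exact: taylor_cst].
have coefE x : x != 0 -> P x - a = x ^- 2 * (1 + x ^+ 2 * (wp_reg tau x - a)).
  by move=> x0; rewrite wp_regE mulrDr mulr1 mulKf ?expf_neq0// addrA.
have T0 : taylor 4 h 0.
  have gN : taylor 4 (fun x => g (- x)) 0.
    have := uT_subst_opp (fun=> ler01) gT.
    by apply: (uT_ext ltr01) => _ x _ _ /=; rewrite !add0r.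
  apply: (taylor_eq e0 _ (taylorM coefT gN)) => x; rewrite !le_min => /andP[xd /andP[xr xs]].
  rewrite add0r; have [->|x0] := eqVneq x 0.
    rewrite /h asboolF; last by case=> /not_off0.
    by rewrite oppr0 expr0n mul0r addr0 mul1r.
  have ox := hr x x0 xr.
  have oux : off (u - x) by apply: hs; rewrite nrmN.
  have oxu : off (x - u) by rewrite -opprB; exact: off_latticeN.
  rewrite /h asboolT// coefE//.
  rewrite -[x - u]opprB (wp_even tau_gt0 oux) hg ?nrmN// sqrrN.
  by field.
have Tu : taylor 4 h u.
  have M := taylorM coefT gT.
  apply: taylor_shift0; apply: (taylor_eq e0 _ M) => x; rewrite !le_min => /andP[xd /andP[xr xs]].
  rewrite !add0r; have [->|x0] := eqVneq x 0.
    rewrite /h asboolF; last by rewrite addr0 subrr => -[_ /not_off0].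
    by rewrite expr0n mul0r addr0 mul1r.
  have uxu : u + x - u = x by ring.
  rewrite /h uxu asboolT; last by split; [exact: hs|exact: hr].
  by rewrite (coefE x)// hg//; field.
have hT z : taylor 4 h z.
  have [oz|/existsNP[p /contrapT zp]] := pselect (off z); last first.
    by rewrite zp -[pt p]add0r; apply: taylor_shift.
  have [ozu|/existsNP[p /contrapT zp]] := pselect (off (z - u)); last first.
    have -> : z = u + pt p by rewrite -zp; ring.
    exact: taylor_shift.
  have [t t0 ht] := off_lattice_near tau_gt0 oz.
  have [t' t'0 ht'] := off_lattice_near tau_gt0 ozu.
  have m0 : 0 < Num.min t t' by rewrite lt_min t0 t'0.
  have Tz : taylor 4 (fun w => P w - a) z.
    by apply: taylorB; [exact: taylor_wp|exact: taylor_cst].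
  have Tzu : taylor 4 (fun w => P (w - u) - a) z.
    apply: taylorB; last exact: taylor_cst.
    have := taylor_wp tau_gt0 4 ozu.
    by apply: (uT_ext ltr01) => _ x _ _ /=; rewrite addrAC.
  apply: (taylor_eq m0 _ (taylorM Tz Tzu)) => x; rewrite le_min => /andP[xt xt'].
  by rewrite /h asboolT//; split; [exact: ht|rewrite addrAC; exact: ht'].
move=> z oz ozu; have := periodic_constant hp hT z.
rewrite /h asboolT// asboolF//; by case=> /not_off0.
Qed.

Lemma wp_half_spread a v (d : R) : off v -> 0 < d ->
  (forall x, nrm x <= d -> P (v + x) = a) ->
  exists2 e : R, 0 < e & forall x, nrm x <= e -> P (v / 2 + x) = a.
Proof.
move=> ov d0 hv; have [s s0 hs] := off_lattice_near tau_gt0 ov.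
(* Room for [2 x + y] when [x] and [y] have modulus at most [e]. *)
pose e := Num.min d s / 4.
have e0 : 0 < e by rewrite divr_gt0// lt_min d0 s0.
have [ed es] : e * 4 <= d /\ e * 4 <= s by rewrite /e divfK// !ge_min !lexx orbT.
exists e => // x xe.
pose u := v + 2 * x.
have n2 (w : C) : nrm (2 * w) = 2 * nrm w by rewrite nrmM (nrm_nat R 2).
have ou : off u by apply: hs; rewrite n2; lra.
have hg y : nrm y <= e -> P (u + y) - a = y ^+ 2 * 0.
  move=> ye; rewrite /u -(addrA v) hv ?subrr ?mulr0// (le_trans (nrmD _ _))// n2; lra.
have oh := off_lattice_half ou.
have uE : u / 2 - u = - (u / 2) by field.
have := wp_translation_product ou (taylor_cst 4 0 0) e0 hg oh.
rewrite uE wp_even// => /(_ (off_latticeN oh))/eqP.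
rewrite mulf_eq0 orbb subr_eq0 => /eqP <-; congr (wp _ _).
by rewrite /u; field.
Qed.

Lemma wp_not_locally_constant a v (d : R) : off v -> 0 < d ->
  ~ (forall x, nrm x <= d -> P (v + x) = a).
Proof.
move=> ov d0 hv.
have all n : off (v / 2 ^+ n) /\ exists2 e : R, 0 < e &
    forall x, nrm x <= e -> P (v / 2 ^+ n + x) = a.
  elim: n => [|n [on [e e0 he]]]; first by rewrite expr0 divr1; split => //; exists d.
  have -> : v / 2 ^+ n.+1 = v / 2 ^+ n / 2 by rewrite exprSr invfM mulrA.
  by split; [exact: off_lattice_half|exact: wp_half_spread he].
have [r r0 hr] := wp_pole tau_gt0 a.
pose n := (Num.truncn (nrm v / r)).+1.
have [on [e e0 he]] := all n.
have : P (v / 2 ^+ n) == a by rewrite -(he 0) ?addr0// nrm0 ltW.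
apply/negP/hr; first exact: off_lattice_neq0 on.
have rn : nrm v / r <= n%:R by rewrite ltW// truncnS_gt.
have n2 : n%:R <= 2 ^+ n :> R by rewrite -natrX ler_nat ltnW// ltn_expl.
rewrite nrmM nrmV nrmX (nrm_nat R 2) ler_pdivrMr ?exprn_gt0//.
by rewrite mulrC -ler_pdivrMr// (le_trans rn).
Qed.

(** [P] is even about the half period [w], hence takes the value [P w] with multiplicity at least
    two there; this is the hypothesis of [wp_translation_product]. *)
Lemma wp_translation2 w q : off w -> w + w = pt q ->
  exists2 k : C, k != 0 &
    forall z, off z -> off (z - w) -> (P z - P w) * (P (z - w) - P w) = k.
Proof.
move=> ow w2.
(* Order six, so that two divisions by the increment leave order four. *)
have /taylorS[g1 [/taylorS[g [gT [d2 d20 h2]]] [d1 d10 h1]]] := taylor_wp tau_gt0 6 ow.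
have [s s0 hs] := off_lattice_near tau_gt0 ow.
have even x : nrm x <= s -> P (w - x) = P (w + x).
  move=> xs; have owx := hs x xs.
  rewrite -(wp_even tau_gt0 owx) -(wp_periodic tau_gt0 q (off_latticeN owx)) -w2.
  by congr (wp _ _); ring.
have c1 : g1 0 = 0.
  have [B [d [d0 hB]]] := taylor_bounded (taylor_leq (leq0n 4) gT).
  pose e := Num.min (Num.min d1 d2) (Num.min s d).
  have e0 : 0 < e by rewrite !lt_min d10 d20 s0 d0.
  (* Comparing the expansions at [x] and [- x] shows that the linear coefficient is a bounded
     multiple of [x] for every small [x], hence zero. *)
  have step x : x != 0 -> nrm x <= e -> 2 * g1 0 = x * (g (- x) - g x).
    move=> x0; rewrite !le_min => /andP[/andP[xd1 xd2] /andP[xs xd]].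
    have := even x xs; rewrite h1 ?nrmN// (h1 x xd1).
    have := h2 x xd2; rewrite add0r => ->.
    have := h2 (- x); rewrite nrmN add0r => /(_ xd2) -> /addrI /eqP.
    rewrite mulNr eqr_oppLR -mulrN => /eqP/(mulfI x0) E.
    have -> : 2 * g1 0 = (g1 0 + - x * g (- x)) + g1 0 + x * g (- x) by ring.
    by rewrite E; ring.
  have B0 : 0 <= B.
    by apply: le_trans (nrm_ge0 _) (hB 0 _); rewrite nrm0 ltW.
  have : 2 * g1 0 = 0.
    apply: nrm_eps => eps eps0.
    pose t := Num.min e (eps / (2 * B + 1)).
    have K0 : 0 < 2 * B + 1 by lra.
    have t0 : 0 < t by rewrite lt_min e0 divr_gt0.
    have nt : nrm (t%:C) = t by rewrite nrm_real gtr0_norm.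
    have tn0 : t%:C != 0 :> C by rewrite -nrm_gt0 nt.
    have te : t <= e by rewrite ge_min lexx.
    have [tE td] : t <= eps / (2 * B + 1) /\ t <= d.
      by rewrite ge_min lexx orbT; split => //; rewrite (le_trans te)// !ge_min lexx !orbT.
    rewrite (step _ tn0) ?nt// nrmM nt.
    have gb : nrm (g (- t%:C) - g t%:C) <= 2 * B.
      rewrite (le_trans (nrmB _ _))// mulr_natl mulr2n lerD//.
        by have := hB (- t%:C); rewrite nrmN nt add0r; apply.
      by have := hB t%:C; rewrite nt add0r; apply.
    apply: le_trans (ler_pM (ltW t0) (nrm_ge0 _) tE gb) _.
    by rewrite mulrAC ler_pdivrMr// ler_pM2l//; lra.
  by move=> /eqP; rewrite mulf_eq0 pnatr_eq0 /= => /eqP.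
have mm : 0 < Num.min d1 d2 by rewrite lt_min d10 d20.
have hg x : nrm x <= Num.min d1 d2 -> P (w + x) - P w = x ^+ 2 * g x.
  rewrite le_min => /andP[xd1 xd2]; rewrite h1//.
  by have := h2 x xd2; rewrite add0r c1 add0r => ->; ring.
exists (g 0); last exact: wp_translation_product gT mm hg.
apply/eqP => g00.
have prod := wp_translation_product ow gT mm hg; rewrite g00 in prod.
have [r r0 hr] := wp_pole tau_gt0 (P w).
have [t t0 ht] := off_lattice_near0 tau_gt0.
have onw := off_latticeN ow; have [s' s'0 hs'] := off_lattice_near tau_gt0 onw.
have e0 : 0 < Num.min r (Num.min t s') by rewrite !lt_min r0 t0 s'0.
apply: (@wp_not_locally_constant (P w) (- w) _ onw e0) => x.
rewrite !le_min => /andP[xr /andP[xt xs]].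
have [->|x0] := eqVneq x 0; first by rewrite addr0 wp_even.
have := prod x (ht x x0 xt); rewrite addrC => /(_ (hs' x xs))/eqP.
by rewrite mulf_eq0 !subr_eq0 (negbTE (hr x x0 xr)) => /eqP.
Qed.

End TranslationProduct.

(** * Values at the points of order four *)

Section CrossRatios.
Variable K : numFieldType.
Implicit Types (a b c k u v w x y s t : K).

(** Here [a1], [a2], [a3] play the half period values: the involution sending [a1] to infinity
    exchanges [a2] and [a3], and likewise for [a2]. The difference of the two equations forces a
    common fixed point [u] to be [a3], and the first then makes [a3] equal to [a1] or [a2]. This
    excludes coincidences among the quarter period values. *)
Lemma fixed_points_distinct a1 a2 a3 u : a1 != a2 -> a2 != a3 ->
  (u - a1) ^+ 2 = (a2 - a1) * (a3 - a1) -> (u - a2) ^+ 2 = (a1 - a2) * (a3 - a2) ->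
  a1 = a3.
Proof.
move=> a12 a23 h1 h2.
have d12 : a2 - a1 != 0 by rewrite subr_eq0 eq_sym.
have u3 : u = a3.
  have h : (a2 - a1) * (2 * (u - a3)) = 0.
    have -> : (a2 - a1) * (2 * (u - a3)) = (u - a1) ^+ 2 - (u - a2) ^+ 2 -
      ((a2 - a1) * (a3 - a1) - (a1 - a2) * (a3 - a2)) by ring.
    by rewrite h1 h2 subrr.
  move/eqP: h; rewrite !mulf_eq0 (negbTE d12) pnatr_eq0 /= subr_eq0; exact/eqP.
have : (a3 - a2) * (a3 - a1) = 0.
  have -> : (a3 - a2) * (a3 - a1) = (a3 - a1) ^+ 2 - (a2 - a1) * (a3 - a1) by ring.
  by rewrite -h1 u3 subrr.
move/eqP; rewrite mulf_eq0 !subr_eq0 [a3 == a2]eq_sym (negbTE a23) /=.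
by move=> /eqP.
Qed.

Lemma opposite_fixed_points a k u v : (u - a) ^+ 2 = k -> (v - a) ^+ 2 = k -> u != v ->
  u + v = 2 * a /\ u * v = a ^+ 2 - k.
Proof.
move=> hu hv uv; have : (u - v) * (u + v - 2 * a) = 0.
  have -> : (u - v) * (u + v - 2 * a) = (u - a) ^+ 2 - (v - a) ^+ 2 by ring.
  by rewrite hu hv subrr.
move=> /eqP; rewrite mulf_eq0 subr_eq0 (negbTE uv) /= subr_eq0 => /eqP E; split=> //.
have -> : v = 2 * a - u by rewrite -E; ring.
by rewrite -hu; ring.
Qed.

(* The involution [w w' - a (w + w') + a^2 = k] fixes [u] and [v], so it negates
   the coordinate [(w - u) / (w - v)]. *)
Lemma involution_opp a k u v w x : (u - a) ^+ 2 = k -> (v - a) ^+ 2 = k -> u != v ->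
  (w - a) * (x - a) = k -> (w - u) * (x - v) = - ((x - u) * (w - v)).
Proof.
move=> hu hv uv h; have [E1 E2] := opposite_fixed_points hu hv uv.
apply/eqP; rewrite -subr_eq0 opprK; apply/eqP.
have -> : (w - u) * (x - v) + (x - u) * (w - v) =
  2 * (w * x) - (u + v) * (w + x) + 2 * (u * v) by ring.
by rewrite E1 E2 -h; ring.
Qed.

(* The involution exchanging [u] and [v] with fixed point [t] inverts that
   coordinate, up to normalization at [t]. *)
Lemma involution_inv a k u v t w x : (t - a) ^+ 2 = k -> (u - a) * (v - a) = k ->
  (w - a) * (x - a) = k ->
  (w - u) * (x - u) * (t - v) ^+ 2 = (t - u) ^+ 2 * ((w - v) * (x - v)).
Proof.
set p := u - a; set q := v - a; set r := t - a; set y := w - a; set z := x - a.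
move=> hr hp hy.
have -> : w - u = y - p by rewrite /y /p; ring.
have -> : x - u = z - p by rewrite /z /p; ring.
have -> : w - v = y - q by rewrite /y /q; ring.
have -> : x - v = z - q by rewrite /z /q; ring.
have -> : t - v = r - q by rewrite /r /q; ring.
have -> : t - u = r - p by rewrite /r /p; ring.
have e1 : (y - p) * (z - p) = p * (p + q - y - z).
  have -> : (y - p) * (z - p) = y * z - p * (y + z) + p ^+ 2 by ring.
  by rewrite hy -hp; ring.
have e2 : (y - q) * (z - q) = q * (p + q - y - z).
  have -> : (y - q) * (z - q) = y * z - q * (y + z) + q ^+ 2 by ring.
  by rewrite hy -hp; ring.
have e3 : (r - q) ^+ 2 = q * (p + q - 2 * r).
  have -> : (r - q) ^+ 2 = r ^+ 2 - 2 * r * q + q ^+ 2 by ring.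
  by rewrite hr -hp; ring.
have e4 : (r - p) ^+ 2 = p * (p + q - 2 * r).
  have -> : (r - p) ^+ 2 = r ^+ 2 - 2 * r * p + p ^+ 2 by ring.
  by rewrite hr -hp; ring.
by rewrite e1 e2 e3 e4; ring.
Qed.

(** If [w] were the fixed point [u], it would be its own image [x]. *)
Lemma involution_neq a k u w x : (u - a) ^+ 2 = k -> k != 0 ->
  (w - a) * (x - a) = k -> w != x -> w != u.
Proof.
move=> hu k0 h; apply: contra => /eqP wu; rewrite wu in h *.
have ua : u - a != 0 by apply: contraNneq k0 => ua; rewrite -hu ua expr0n.
have : (u - a) * (u - a) = (u - a) * (x - a) by rewrite h -hu.
by move=> /(mulfI ua)/addIr ->.
Qed.

End CrossRatios.

Definition quarter (R : realType) (tau : R[i]) (m n : int) : R[i] :=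
  (m%:~R + n%:~R * tau) / 4.

(** Locked, so that equality of two values is decided through the integer indices and not by
    unfolding lattice sums. *)
HB.lock Definition wp4 (R : realType) (tau : R[i]) (m n : int) : R[i] :=
  wp tau (quarter tau m n).

Lemma wp4E (R : realType) (tau : R[i]) m n : wp4 tau m n = wp tau (quarter tau m n).
Proof. by rewrite wp4.unlock. Qed.

Section QuarterPeriods.
Variables (R : realType).
Local Notation C := R[i].
Implicit Types (tau z : C) (m n : int).

Lemma off_quarter tau m n : 0 < complex.Im tau ->
  ~~ ((4 %| m)%Z && (4 %| n)%Z) -> off_lattice tau (quarter tau m n).
Proof.
move=> t0 mn [p q] h.
have : lattice_pt tau (m - (p + p + p + p), n - (q + q + q + q)) = 0.
  have E : m%:~R + n%:~R * tau = 4 * lattice_pt tau (p, q).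
    by rewrite -h /quarter; field.
  rewrite -(subrr (4 * lattice_pt tau (p, q))) -{1}E.
  by rewrite /lattice_pt /= !intrB !intrD; ring.
apply/eqP/lattice_pt_neq0 => //; apply: contra mn => /eqP[/eqP + /eqP].
rewrite !subr_eq0 => /eqP -> /eqP ->; apply/andP.
by split; apply/dvdzP; [exists p|exists q]; ring.
Qed.

Lemma quarterN tau m n : - quarter tau m n = quarter tau (- m) (- n).
Proof. by rewrite /quarter !intrN; field. Qed.

Lemma quarterB tau m n p q : quarter tau m n - quarter tau p q = quarter tau (m - p) (n - q).
Proof. by rewrite /quarter !intrB; field. Qed.

Lemma quarterD4 tau m n p q :
  quarter tau (m + (p + p + p + p)) (n + (q + q + q + q)) = quarter tau m n + lattice_pt tau
    (p, q).
Proof. by rewrite /quarter /lattice_pt !intrD /=; field. Qed.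

Lemma wp4_periodic tau m n p q : 0 < complex.Im tau ->
  ~~ ((4 %| m)%Z && (4 %| n)%Z) ->
  wp4 tau (m + (p + p + p + p)) (n + (q + q + q + q)) = wp4 tau m n.
Proof.
by move=> t0 mn; rewrite !wp4E quarterD4 wp_periodic//; exact: off_quarter.
Qed.

Lemma wp4_opp tau m n : 0 < complex.Im tau -> ~~ ((4 %| m)%Z && (4 %| n)%Z) ->
  wp4 tau (- m) (- n) = wp4 tau m n.
Proof.
by move=> t0 mn; rewrite !wp4E -quarterN wp_even//; exact: off_quarter.
Qed.

Lemma wp4_eq tau m n m' n' : 0 < complex.Im tau -> ~~ ((4 %| m)%Z && (4 %| n)%Z) ->
  (4 %| m' - m)%Z && (4 %| n' - n)%Z || (4 %| m' + m)%Z && (4 %| n' + n)%Z ->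
  wp4 tau m' n' = wp4 tau m n.
Proof.
move=> t0 mn /orP[]/andP[/dvdzP[p hp] /dvdzP[q hq]].
  have -> : m' = m + (p + p + p + p) by lia.
  have -> : n' = n + (q + q + q + q) by lia.
  exact: wp4_periodic.
have -> : m' = - m + (p + p + p + p) by lia.
have -> : n' = - n + (q + q + q + q) by lia.
rewrite wp4_periodic ?wp4_opp//.
by rewrite !dvdzE !abszN.
Qed.

Lemma wp4_translation2 tau (p r : int) : 0 < complex.Im tau ->
  ~~ ((4 %| p)%Z && (4 %| r)%Z) -> (2 %| p)%Z && (2 %| r)%Z ->
  exists2 k : C, k != 0 & forall m n m' n', ~~ ((4 %| m)%Z && (4 %| n)%Z) ->
    ~~ ((4 %| m')%Z && (4 %| n')%Z) -> ~~ ((4 %| m - p)%Z && (4 %| n - r)%Z) ->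
    (4 %| m - p - m')%Z && (4 %| n - r - n')%Z ||
      (4 %| m - p + m')%Z && (4 %| n - r + n')%Z ->
    (wp4 tau m n - wp4 tau p r) * (wp4 tau m' n' - wp4 tau p r) = k.
Proof.
move=> t0 pr /andP[/dvdzP[i pE] /dvdzP[j rE]]; have o := off_quarter t0 pr.
have [|k k0 hk] := @wp_translation2 _ tau t0 _ (i, j) o.
  by rewrite /quarter /lattice_pt pE rE !intrM /=; field.
exists k => // m n m' n' mn mn' mn'' e; rewrite -(wp4_eq t0 mn' e) !wp4E -quarterB.
by apply: hk; [exact: off_quarter|rewrite quarterB; exact: off_quarter].
Qed.

Section Values.
Variable tau : C.
Hypothesis tau_gt0 : 0 < complex.Im tau.
Local Notation q := (wp4 tau).

(** On indices modulo 4 and sign, translation by a half period fixes two of the six primitive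
    classes, exchanges the other four in pairs, and exchanges the other two half periods. *)
Lemma wp4_relations : exists k1 k2 k3 : C, [/\ [/\ k1 != 0, k2 != 0 & k3 != 0],
  [/\ (q 1 0 - q 2 0) ^+ 2 = k1, (q 1 2 - q 2 0) ^+ 2 = k1,
      (q 0 1 - q 2 0) * (q 2 1 - q 2 0) = k1, (q 1 1 - q 2 0) * (q 1 (-1) - q 2 0) = k1 &
      (q 0 2 - q 2 0) * (q 2 2 - q 2 0) = k1],
  [/\ (q 0 1 - q 0 2) ^+ 2 = k2, (q 2 1 - q 0 2) ^+ 2 = k2,
      (q 1 0 - q 0 2) * (q 1 2 - q 0 2) = k2, (q 1 1 - q 0 2) * (q 1 (-1) - q 0 2) = k2 &
      (q 2 0 - q 0 2) * (q 2 2 - q 0 2) = k2] &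
  [/\ (q 1 1 - q 2 2) ^+ 2 = k3, (q 1 (-1) - q 2 2) ^+ 2 = k3,
      (q 1 0 - q 2 2) * (q 1 2 - q 2 2) = k3, (q 0 1 - q 2 2) * (q 2 1 - q 2 2) = k3 &
      (q 2 0 - q 2 2) * (q 0 2 - q 2 2) = k3]].
Proof.
have [k1 k10 h1] := wp4_translation2 (p := 2) (r := 0) tau_gt0 isT isT.
have [k2 k20 h2] := wp4_translation2 (p := 0) (r := 2) tau_gt0 isT isT.
have [k3 k30 h3] := wp4_translation2 (p := 2) (r := 2) tau_gt0 isT isT.
exists k1, k2, k3; rewrite !expr2; split; [by split|split|split|split].
- exact: (h1 1 0 1 0).
- exact: (h1 1 2 1 2).
- exact: (h1 0 1 2 1).
- exact: (h1 1 1 1 (-1)).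
- exact: (h1 0 2 2 2).
- exact: (h2 0 1 0 1).
- exact: (h2 2 1 2 1).
- exact: (h2 1 0 1 2).
- exact: (h2 1 1 1 (-1)).
- exact: (h2 2 0 2 2).
- exact: (h3 1 1 1 1).
- exact: (h3 1 (-1) 1 (-1)).
- exact: (h3 1 0 1 2).
- exact: (h3 0 1 2 1).
- exact: (h3 2 0 0 2).
Qed.

(** The equations concern the coordinate [(w - q 1 0) / (w - q 1 2)]. The involution with constant
    [k1] fixes its zero and its pole and so negates it; the one with constant [k2] exchanges them
    and fixes [q 0 1]. Together they make the ratio of the coordinates at [q 1 1] and [q 0 1] a
    square root of -1. *)
Lemma wp4_facts :
  [/\ [/\ q 1 0 != q 1 2, q 0 1 != q 1 0, q 0 1 != q 1 2, q 2 1 != q 1 0 & q 2 1 != q 1 2],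
      q 1 1 != q 1 2,
      (q 0 1 - q 1 0) * (q 2 1 - q 1 2) = - ((q 2 1 - q 1 0) * (q 0 1 - q 1 2)),
      (q 1 1 - q 1 0) * (q 1 (-1) - q 1 2) = - ((q 1 (-1) - q 1 0) * (q 1 1 - q 1 2)) &
      ((q 0 1 - q 1 2) * (q 1 1 - q 1 0)) ^+ 2 = - ((q 0 1 - q 1 0) * (q 1 1 - q 1 2)) ^+ 2].
Proof.
have [k1 [k2 [k3 [[k10 k20 k30] [r1 r2 r3 r4 r5] [s1 s2 s3 s4 s5] [t1 t2 t3 t4 t5]]]]] :=
  wp4_relations.
(* The constants are also products of differences of half period values, so their being nonzero
   separates these values. *)
have a12 : q 2 0 != q 0 2.
  by apply: contraNneq k10 => a12; rewrite -r5 a12 subrr mul0r.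
have a13 : q 2 0 != q 2 2.
  by apply: contraNneq k10 => a13; rewrite -r5 a13 subrr mulr0.
have a23 : q 0 2 != q 2 2.
  by apply: contraNneq k20 => a23; rewrite -s5 a23 subrr mulr0.
have e12 : q 1 0 != q 1 2.
  apply/eqP => e12; rewrite -e12 in s3.
  move/eqP: a13; apply; apply: (@fixed_points_distinct _ _ (q 0 2) _ (q 1 0)) => //.
    by rewrite r1 -r5.
  by rewrite expr2 s3 -s5.
have e03 : q 0 1 != q 2 1.
  apply/eqP => e03; rewrite -e03 in r3.
  move/eqP: a23; apply; apply: (@fixed_points_distinct _ _ (q 2 0) _ (q 0 1)) => //.
  - by rewrite eq_sym.
  - by rewrite s1 -s5.
  - by rewrite expr2 r3 -r5.
have e45 : q 1 1 != q 1 (-1).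
  apply/eqP => e45; rewrite -e45 in r4.
  move/eqP: a23; apply; symmetry.
  apply: (@fixed_points_distinct _ _ (q 2 0) _ (q 1 1)) => //.
  - by rewrite eq_sym.
  - by rewrite t1 -t5.
  - by rewrite expr2 r4 -r5 mulrC.
have r3' : (q 2 1 - q 2 0) * (q 0 1 - q 2 0) = k1 by rewrite mulrC.
have e30 : q 2 1 != q 0 1 by rewrite eq_sym.
have e41 := involution_neq r2 k10 r4 e45.
split; [split| | | |] => //.
- exact: involution_neq r1 k10 r3 e03.
- exact: involution_neq r2 k10 r3 e03.
- exact: involution_neq r1 k10 r3' e30.
- exact: involution_neq r2 k10 r3' e30.
- exact: involution_opp r1 r2 e12 r3.
- exact: involution_opp r1 r2 e12 r4.
have h1 := involution_opp r1 r2 e12 r4.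
have h2 := involution_inv s1 s3 s4.
have d : q 1 1 - q 1 2 != 0 by rewrite subr_eq0.
have d' : q 1 (-1) - q 1 2 != 0.
  rewrite subr_eq0; apply: (involution_neq r2 k10 (x := q 1 1)); last by rewrite eq_sym.
  by rewrite mulrC.
apply: (mulIf d'); move: h1 h2.
set u := q 1 1 - q 1 0; set v := q 1 (-1) - q 1 2; set u' := q 1 (-1) - q 1 0.
set v' := q 1 1 - q 1 2; set t := q 0 1 - q 1 2; set t' := q 0 1 - q 1 0.
move=> h1 h2.
have -> : (t * u) ^+ 2 * v = (u * v) * (t ^+ 2 * u) by ring.
rewrite h1; have -> : - (u' * v') * (t ^+ 2 * u) = - (u * u' * t ^+ 2) * v' by ring.
by rewrite h2; ring.
Qed.

End Values.
End QuarterPeriods.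

(** * The square lattice *)

Section SquareLattice.
Variable R : realType.
Local Notation C := R[i].
Local Notation i := ('i : C).
Implicit Types (m n : int) (z : C).

Lemma Im_i_gt0 : 0 < complex.Im i. Proof. exact: ltr01. Qed.

(** The matrix of the rotation fixes the parameter [i], and its automorphy factor [i] has square
    -1. *)
Lemma wp4_rot m n : ~~ ((4 %| m)%Z && (4 %| n)%Z) -> wp4 i n (- m) = - wp4 i m n.
Proof.
move=> mn; have := @wp_SL2Z _ i _ 0 (-1) 1 0 Im_i_gt0 (off_quarter Im_i_gt0 mn).
move=> /(_ erefl) /=; rewrite mulr0z mulr1z mulrN1z mul0r mul1r add0r addr0.
have i2 : i ^+ 2 = -1 := sqr_i _.
have i0 : i != 0 by rewrite -sqrf_eq0 i2 oppr_eq0 oner_eq0.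
have -> : -1 / i = i by rewrite -i2 expr2 mulfK.
rewrite i2 mulN1r !wp4E => <-; congr (wp _ _).
rewrite /quarter intrN; apply: (mulfI i0); rewrite mulVKf//.
have -> : i * ((n%:~R + - m%:~R * i) / 4) = (n%:~R * i - m%:~R * i ^+ 2) / 4 by ring.
by rewrite i2; ring.
Qed.

Lemma sum_inv_square (n : nat) : \sum_(k < n) ((k.+1)%:R ^- 2 : R) <= 2.
Proof.
suff : \sum_(k < n.+1) ((k.+1)%:R ^- 2 : R) <= 2 - n.+1%:R^-1.
  rewrite big_ord_recr /=; have h : 0 <= (n.+1)%:R ^- 2 :> R by rewrite invr_ge0 exprn_ge0.
  have h' : 0 <= n.+1%:R^-1 :> R by rewrite invr_ge0.
  move: h h'; move: (n.+1%:R ^- 2) (n.+1%:R^-1) (\sum_(k < n) _) => x y s; lra.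
elim: n => [|n IH]; first by rewrite big_ord_recr big_ord0 /= expr1n invr1; lra.
rewrite big_ord_recr /=; apply: le_trans (lerD IH (lexx _)) _.
have a0 : 0 < n.+1%:R :> R by rewrite ltr0n.
rewrite -[n.+2]addn1 natrD; set a := n.+1%:R in a0 *.
have b0 : 0 < a + 1 by rewrite addr_gt0.
rewrite -subr_ge0; have -> : 2 - (a + 1)^-1 - (2 - a^-1 + (a + 1) ^- 2) = (a * (a + 1) ^+ 2)^-1.
  by field; rewrite !gt_eqF.
by rewrite invr_ge0 mulr_ge0 ?exprn_ge0// ltW.
Qed.

Let qd (k : nat) : R := (k%:R ^+ 2)^-1.
Let d0 (k : nat) : R := (k == 0%N)%:R.

(** The two axes contribute at most 4 each and the rest at most 16 / 4, because
    [(m^2 + n^2)^2 >= 4 m^2 n^2]. In the majorant [d0] selects an axis, and [qd 0 = 0] by the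
    convention for the inverse of 0. *)
Lemma sum_inv_norm4 (A : {fset int * int}) :
  \sum_(p <- A | nz p) (nrm (lattice_pt i p) ^+ 4)^-1 <= 12.
Proof.
pose maj (p : int * int) := d0 `|p.1|%N * qd `|p.2|%N + qd `|p.1|%N * d0 `|p.2|%N +
  qd `|p.1|%N * qd `|p.2|%N / 4.
have qd_ge0 k : 0 <= qd k by rewrite invr_ge0 exprn_ge0.
have d0_ge0 k : 0 <= d0 k by [].
have maj_ge0 p : 0 <= maj p.
  by rewrite /maj !addr_ge0 ?mulr_ge0// divr_ge0// mulr_ge0.
have le_maj p : nz p -> (nrm (lattice_pt i p) ^+ 4)^-1 <= maj p.
  case: p => m n; rewrite /nz xpair_eqE negb_and /maj /= => mn.
  have -> : nrm (lattice_pt i (m, n)) ^+ 4 = ((`|m|%N)%:R ^+ 2 + (`|n|%N)%:R ^+ 2) ^+ 2.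
    rewrite (_ : 4%N = (2 * 2)%N)// exprM nrm_sqr lattice_ptE /= !mul0r !mulr0 !mulr1.
    rewrite subr0 !addr0 add0r !natr_absz !intr_norm.
    by rewrite !real_normK ?num_real.
  have [m0|m0] := eqVneq m 0.
    rewrite m0 /= in mn *; rewrite /d0 eqxx mul1r.
    have n1 : 1 <= (`|n|%N)%:R :> R by rewrite ler1n absz_gt0.
    rewrite expr0n add0r /qd expr0n invr0 !mul0r !addr0.
    move: (`|n|%N%:R) n1 => x x1; have x0 : 0 < x by rewrite (lt_le_trans _ x1).
    rewrite lef_pV2 ?posrE ?exprn_gt0// -exprM.
    by rewrite (_ : (2 * 2)%N = (2 + 2)%N)// exprD ler_peMr ?exprn_ge0 ?exprn_ege1// ltW.
  have m1 : 1 <= (`|m|%N)%:R :> R by rewrite ler1n absz_gt0.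
  have [n0|n0] := eqVneq n 0.
    rewrite n0 /= in mn *; rewrite /d0 eqxx mulr1.
    rewrite expr0n addr0 /qd expr0n invr0 !mulr0 mul0r addr0 add0r.
    move: (`|m|%N%:R) m1 => x x1; have x0 : 0 < x by rewrite (lt_le_trans _ x1).
    rewrite lef_pV2 ?posrE ?exprn_gt0// -exprM.
    by rewrite (_ : (2 * 2)%N = (2 + 2)%N)// exprD ler_peMr ?exprn_ge0 ?exprn_ege1// ltW.
  have n1 : 1 <= (`|n|%N)%:R :> R by rewrite ler1n absz_gt0.
  rewrite /d0 !absz_eq0 (negbTE m0) (negbTE n0) mul0r mulr0 !add0r /qd.
  move: (`|m|%N%:R) (`|n|%N%:R) m1 n1 => x y x1 y1.
  have x0 : 0 < x by rewrite (lt_le_trans _ x1).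
  have y0 : 0 < y by rewrite (lt_le_trans _ y1).
  rewrite -!invfM lef_pV2 ?posrE ?mulr_gt0 ?exprn_gt0 ?addr_gt0 ?exprn_gt0//.
  rewrite -subr_ge0; have -> : (x ^+ 2 + y ^+ 2) ^+ 2 - x ^+ 2 * y ^+ 2 * 4 = (x ^+ 2 - y ^+
    2) ^+ 2 by ring.
  exact: sqr_ge0.
have D (n : nat) : \sum_(k < n) d0 k.+1 <= 0 by rewrite big1.
have Q (n : nat) : \sum_(k < n) qd k.+1 <= 2 by exact: sum_inv_square.
have := ler_sum_int2 d0_ge0 D qd_ge0 Q (fset_uniq A).
have := ler_sum_int2 qd_ge0 Q d0_ge0 D (fset_uniq A).
have := ler_sum_int2 qd_ge0 Q qd_ge0 Q (fset_uniq A).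
have -> : qd 0 = 0 by rewrite /qd expr0n invr0.
have -> : d0 0 = 1 by [].
move=> h1 h2 h3.
apply: (@le_trans _ _ (\sum_(p <- A) maj p)).
  rewrite big_mkcond; apply: ler_sum => p _; case: ifP => [/le_maj//|_]; exact: maj_ge0.
rewrite !big_split /= -mulr_suml.
move: h1 h2 h3; move: (\sum_(p <- A) _) (\sum_(p <- A) _) (\sum_(p <- A) _) => s1 s2 s3.
by lra.
Qed.

Lemma norm_lattice_ge1 p : nz p -> 1 <= nrm (lattice_pt i p) ^+ 2.
Proof.
case: p => m n; rewrite /nz xpair_eqE negb_and => mn.
have -> : nrm (lattice_pt i (m, n)) ^+ 2 = (`|m|%N ^ 2 + `|n|%N ^ 2)%N%:R.
  rewrite nrm_sqr lattice_ptE /= !mul0r !mulr0 !mulr1.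
  rewrite subr0 !addr0 add0r natrD !natrX !natr_absz !intr_norm.
  by rewrite !real_normK ?num_real.
by rewrite ler1n addn_gt0 !expn_gt0 !absz_gt0 !orbF.
Qed.

(** Averaging the terms at [w] and [- w] gives [z^2 (3 w^2 - z^2) / ((z^2 - w^2)^2 w^2)]. For
    [|z|^2 <= 1/8] and [|w| >= 1] this is at most [(25/8) / (7/8)^2 = 200/49] times [|z|^2 / |w|^4],
    and 12 times 200/49 is below 49. *)
Lemma wp_i_estimate z : off_lattice i z -> nrm z ^+ 2 <= 8^-1 ->
  nrm (wp i z - z ^- 2) <= 49 * nrm z ^+ 2.
Proof.
move=> oz z8; have hs := wp_has_sum Im_i_gt0 oz.
pose opp p : int * int := (- p.1, - p.2).
have oppK : cancel opp opp by move=> [m n]; rewrite /opp /= !opprK.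
have nzo p : nz (opp p) = nz p.
  by case: p => m n; rewrite /nz /opp !xpair_eqE /= !oppr_eq0.
have := has_sumZ 2^-1 (has_sumD hs (has_sum_reindex oppK oppK hs)).
set S := wp i z - z ^- 2.
have -> : 2^-1 * (S + S) = S by field.
move=> h; apply: (has_sum_le h) => A.
have term p : nrm (2^-1 * ((if nz p then eis i z p else 0) +
    ((fun p => if nz p then eis i z p else 0) \o opp) p)) <=
    if nz p then (200 / 49 * nrm z ^+ 2) * (nrm (lattice_pt i p) ^+ 4)^-1 else 0.
  rewrite /= nzo; case: ifPn => pn; last by rewrite addr0 mulr0 nrm0.
  have w1 := norm_lattice_ge1 pn; rewrite /eis -lattice_ptN.
  have w0 := lattice_pt_neq0 Im_i_gt0 pn; have zw := oz p; have zw' := oz (opp p).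
  rewrite -lattice_ptN in zw'.
  move: (lattice_pt i p) w0 w1 zw zw' => w w0 w1 /eqP zw /eqP zw'.
  have d1 : z - w != 0 by rewrite subr_eq0.
  have d2 : z + w != 0 by rewrite addr_eq0.
  have -> : 2^-1 * ((z - w) ^- 2 - w ^- 2 + ((z - - w) ^- 2 - (- w) ^- 2)) =
      z ^+ 2 * (3 * w ^+ 2 - z ^+ 2) / ((z ^+ 2 - w ^+ 2) ^+ 2 * w ^+ 2).
    rewrite opprK; field.
    by rewrite w0 d1 d2 subr_sqr mulf_neq0.
  rewrite nrmM nrmM nrmV nrmX nrmM !nrmX.
  have u1 : nrm (3 * w ^+ 2 - z ^+ 2) <= 3 * nrm w ^+ 2 + nrm z ^+ 2.
    by rewrite (le_trans (nrmB _ _))// nrmM !nrmX (nrm_nat R 3).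
  have u2 : nrm w ^+ 2 - nrm z ^+ 2 <= nrm (z ^+ 2 - w ^+ 2).
    by have := nrm_lip (w ^+ 2) (z ^+ 2); rewrite !nrmX [X in _ <= X -> _]nrm_distC ler_norml
      => /andP[_].
  have -> : nrm w ^+ 4 = (nrm w ^+ 2) ^+ 2 by rewrite -exprM.
  have z20 : 0 <= nrm z ^+ 2 by rewrite exprn_ge0// nrm_ge0.
  move: (nrm w ^+ 2) (nrm z ^+ 2) (nrm (3 * w ^+ 2 - z ^+ 2)) (nrm (z ^+ 2 - w ^+ 2))
    (nrm_ge0 (3 * w ^+ 2 - z ^+ 2))
    w1 z8 z20 u1 u2 => W Z U V U0 W1 Z8 Z0 u1 u2.
  have W0 : 0 < W by rewrite (lt_le_trans _ W1).
  have V7 : 7 / 8 * W <= V by lra.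
  have V0 : 0 < V by lra.
  rewrite -mulrA [200 / 49 * Z]mulrC -[leRHS]mulrA ler_wpM2l//.
  rewrite ler_pdivrMr ?mulr_gt0 ?exprn_gt0//.
  have -> : 200 / 49 / W ^+ 2 * (V ^+ 2 * W) = 200 / 49 * V ^+ 2 / W.
    by field; rewrite gt_eqF.
  rewrite ler_pdivlMr//.
  apply: (@le_trans _ _ (25 / 8 * W * W)); first by rewrite ler_pM2r//; lra.
  have : (7 / 8 * W) ^+ 2 <= V ^+ 2 by rewrite lerXn2r// nnegrE; lra.
  by rewrite exprMn expr2 [W ^+ 2]expr2; lra.
apply: le_trans (ler_sum _ (fun p _ => term p)) _.
rewrite -big_mkcond -mulr_sumr /=.
have z20 : 0 <= 200 / 49 * nrm z ^+ 2.
  by rewrite mulr_ge0 ?exprn_ge0 ?nrm_ge0//; lra.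
apply: le_trans (ler_wpM2l z20 (sum_inv_norm4 A)) _.
have : 0 <= nrm z ^+ 2 by rewrite exprn_ge0// nrm_ge0.
lra.
Qed.

End SquareLattice.

(** * Choice of the square root of -1 *)

Section CrossRatioSign.
Variable R : realType.
Local Notation C := R[i].
Local Notation i := ('i : C).
Implicit Types (m n : int) (tau z : C).

(** The value of f at z = (1 + tau)/2. *)
Definition cross_ratio tau : C :=
  ((wp4 tau 0 1 - wp4 tau 1 2) * (wp4 tau 1 1 - wp4 tau 1 0)) /
  ((wp4 tau 0 1 - wp4 tau 1 0) * (wp4 tau 1 1 - wp4 tau 1 2)).

Lemma i_sqr : i ^+ 2 = -1. Proof. exact: sqr_i. Qed.

Lemma cross_ratio_sqr tau : 0 < complex.Im tau -> cross_ratio tau ^+ 2 = -1.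
Proof.
move=> t0; have [[_ h1 _ _ _] h2 _ _ h] := wp4_facts t0.
rewrite /cross_ratio expr_div_n h mulNr divff// expf_neq0//.
by rewrite mulf_neq0// subr_eq0.
Qed.

Lemma Re_realM (a : R) z : complex.Re (a%:C * z) = a * complex.Re z.
Proof. by case: z => u v /=; rewrite mul0r subr0. Qed.

(** Put [a = wp4 i 2 0]. By the rotation the other two half period values are [- a] and 0, so the
    relations leave [e4 = i a] or [- i a] for the index (1, 1) and [e1 = (1 + sqrt 2) a] or
    [(1 - sqrt 2) a] for (1, 0). The estimates place [e1] within 49/16 of 16 and [e4] within 49/8 of
    [- 8 i]. If [e4 = i a], the real part of [a] lies between -113/8 and -15/8, and neither choice
    of [e1] reaches the real part 207/16. *)
Lemma cross_ratio_i : cross_ratio i = - i.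
Proof.
have [k1 [k2 [k3 [[k10 _ _] [r1 r2 _ _ r5] _ [t1 _ _ _ t5]]]]] := wp4_relations (Im_i_gt0 R).
have [[e12 e01 _ _ _] e42 _ _ _] := wp4_facts (Im_i_gt0 R).
have [sum12 _] := opposite_fixed_points r1 r2 e12.
have a2 : wp4 i 0 2 = - wp4 i 2 0.
  by rewrite -wp4_rot//; apply: wp4_eq => //; exact: Im_i_gt0.
have e0 : wp4 i 0 1 = - wp4 i 1 0.
  by rewrite -wp4_rot//; apply: wp4_eq => //; exact: Im_i_gt0.
have a3 : wp4 i 2 2 = 0.
  have : wp4 i 2 2 = - wp4 i 2 2.
    by rewrite -wp4_rot//; apply: wp4_eq => //; exact: Im_i_gt0.
  move=> /eqP; rewrite -addr_eq0 -mulr2n mulrn_eq0 /= => /eqP; exact.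
have n1 := @wp_i_estimate R _ (off_quarter (Im_i_gt0 R) (isT : ~~ ((4 %| 1)%Z && (4 %| 0)%Z))).
have n4 := @wp_i_estimate R _ (off_quarter (Im_i_gt0 R) (isT : ~~ ((4 %| 1)%Z && (4 %| 1)%Z))).
rewrite -!wp4E in n1 n4.
have q1 : quarter i 1 0 = 4^-1 by rewrite /quarter mul0r addr0 mul1r.
have q1n : nrm (quarter i 1 0) ^+ 2 = 16^-1.
  by rewrite q1 nrmV (nrm_nat R 4); field.
have q4 : quarter i 1 1 ^+ 2 = i / 8.
  rewrite /quarter !mul1r; have -> : ((1 + i) / 4) ^+ 2 = (1 + i ^+ 2 + 2 * i) / 16 by field.
  by rewrite i_sqr; field.
have ni : nrm i = 1 by rewrite /= expr0n expr1n add0r sqrtr1.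
have q4n : nrm (quarter i 1 1) ^+ 2 = 8^-1.
  by rewrite -nrmX q4 nrmM nrmV (nrm_nat R 8) ni mul1r.
have q4V : quarter i 1 1 ^- 2 = - (8 * i).
  rewrite q4 invfM invrK; have i0 : i != 0 by rewrite -nrm_gt0 ni.
  by apply: (mulfI i0); rewrite mulrA divff// mulrN mulrCA -expr2 i_sqr; ring.
have q1V : quarter i 1 0 ^- 2 = 16 by rewrite q1; field.
rewrite q1n q1V in n1; rewrite q4n q4V in n4.
have {n1} n1 := n1 _; have {n4} n4 := n4 (lexx _).
have {n1} n1 : nrm (wp4 i 1 0 - 16) <= 49 * 16^-1 by apply: n1; lra.
rewrite a2 a3 !subr0 in r5 t1 t5; rewrite /cross_ratio e0.
move: (wp4 i 1 0) (wp4 i 2 0) (wp4 i 1 1) (wp4 i 1 2) e12 e42 sum12 r1 r5 t1 t5 n1 n4 e01 e0.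
move=> e1 a e4 e2 e12 e42 sum12 r1 r5 t1 t5 n1 n4 e01 e0.
have h1 : (e1 - a) ^+ 2 = 2 * a ^+ 2 by rewrite r1 -r5; ring.
have h4 : (e4 - i * a) * (e4 + i * a) = 0.
  have -> : (e4 - i * a) * (e4 + i * a) = e4 ^+ 2 - i ^+ 2 * a ^+ 2 by ring.
  by rewrite t1 -t5 i_sqr; ring.
have {h4} e4E : e4 = - (i * a).
  move/eqP: h4; rewrite mulf_eq0 subr_eq0 addr_eq0 => /orP[/eqP e4E|/eqP//]; exfalso.
  have Im4 : complex.Im e4 = complex.Re a by rewrite e4E mulrC ImiRe.
  have /andP[l4 u4] : - (49 / 8) <= complex.Re a + 8 <= 49 / 8.
    rewrite -ler_norml -Im4; apply: le_trans n4; apply: le_trans (Im_nrm _).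
    rewrite opprK Im_add; have -> : complex.Im (8 * i) = 8.
      by rewrite ImiRe -(rmorph_nat (real_complex R) 8).
    exact: lexx.
  have /andP[l1 u1] : - (49 / 16) <= complex.Re e1 - 16 <= 49 / 16.
    rewrite -ler_norml; apply: le_trans n1; apply: le_trans (Re_nrm _).
    by rewrite raddfB -[X in _ <= `|_ - complex.Re X|](rmorph_nat (real_complex R) 16).
  pose s : R := Num.sqrt 2.
  have s0 : 0 <= s by exact: sqrtr_ge0.
  have s2 : s ^+ 2 = 2 by rewrite sqr_sqrtr.
  have s1 : s <= 3 / 2.
    rewrite -(@ler_pXn2r _ 2)// ?nnegrE// ?s2; lra.
  have : (e1 - (1 + s)%:C * a) * (e1 - (1 - s)%:C * a) = 0.
    have sC : (s%:C) ^+ 2 = 2 :> C by rewrite -rmorphXn s2 rmorph_nat.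
    rewrite rmorphD rmorphB rmorph1.
    have -> : (e1 - (1 + s%:C) * a) * (e1 - (1 - s%:C) * a) =
      (e1 - a) ^+ 2 - s%:C ^+ 2 * a ^+ 2 by ring.
    by rewrite h1 sC subrr.
  move=> /eqP; rewrite mulf_eq0 !subr_eq0 => /orP[]/eqP e1E;
    move: l1; rewrite e1E Re_realM; nra.
have i0 : i != 0 by rewrite -nrm_gt0 ni.
have e2E : e2 = 2 * a - e1 by rewrite -sum12; ring.
have d1 : e4 - e2 != 0 by rewrite subr_eq0.
have d0 : - e1 - e1 != 0 by rewrite e0 in e01; rewrite subr_eq0.
rewrite -[RHS](mulfK (mulf_neq0 d0 d1)); congr (_ / _).
rewrite e4E e2E.
have -> : - i * ((- e1 - e1) * (- (i * a) - (2 * a - e1))) =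
   2 * i * (e1 - a) ^+ 2 - 2 * i * a ^+ 2 - 2 * i ^+ 2 * e1 * a by ring.
by rewrite h1 i_sqr; ring.
Qed.

Lemma taylor_wp4 tau m n K : 0 < complex.Im tau -> ~~ ((4 %| m)%Z && (4 %| n)%Z) ->
  taylor K (fun t => wp4 t m n) tau.
Proof.
move=> t0 mn; have h := taylor_wp_tau t0 (n%:~R / 4) K (off_quarter t0 mn).
apply: (taylor_eq ltr01 _ h) => x _; rewrite wp4E; congr (wp _ _).
by rewrite /quarter; field.
Qed.

Lemma taylor_cross_ratio tau : 0 < complex.Im tau -> taylor 1 cross_ratio tau.
Proof.
move=> t0; have [[_ h1 _ _ _] h2 _ _ _] := wp4_facts t0.
apply: taylorM.
  by apply: taylorM; apply: taylorB; apply: taylor_wp4.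
apply: taylorV; first by rewrite mulf_neq0// subr_eq0.
by apply: taylorM; apply: taylorB; apply: taylor_wp4.
Qed.

(* The square is -1 everywhere, so the sign is constant along the segment from
   [i] to [tau]. *)
Lemma cross_ratioE tau : 0 < complex.Im tau -> cross_ratio tau = - i.
Proof.
move=> t0.
have pm t : 0 < complex.Im t -> cross_ratio t = i \/ cross_ratio t = - i.
  move=> /cross_ratio_sqr; rewrite -i_sqr => /eqP.
  by rewrite eqf_sqr => /orP[]/eqP ->; [left|right].
case: (pm tau t0) => // tauE; exfalso.
pose g (s : R) : C := i + s%:C * (tau - i).
have Imi : complex.Im i = 1 by [].
have g0 s : 0 <= s -> s <= 1 -> 0 < complex.Im (g s).
  move=> s0 s1; rewrite /g Im_add Im_realM raddfB /= ; have := t0; nra.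
pose f s := complex.Im (cross_ratio (g s)).
have f0 : f 0 = -1 by rewrite /f /g mul0r addr0 cross_ratio_i.
have f1 : f 1 = 1.
  by rewrite /f /g mul1r addrC subrK tauE.
(* The imaginary part would vanish somewhere on the segment, where the value is [i] or [- i]. *)
have [||c c01 fc] := @IVT R f 0 1 0 ler01.
- apply: continuous_in_subspaceT => s; rewrite inE /= in_itv /= => /andP[s0 s1].
  have [B [d [d0 B0 hB]]] := taylor_lipschitz (taylor_cross_ratio (g0 s s0 s1)).
  apply/cvgrPdist_le => /= e e0.
  have D0 : 0 < nrm (tau - i) + 1 by rewrite ltr_wpDl ?nrm_ge0.
  have m0 : 0 < Num.min d (e / B) / (nrm (tau - i) + 1).
    by rewrite divr_gt0// lt_min d0 divr_gt0.
  exists (Num.min d (e / B) / (nrm (tau - i) + 1)) => //= s' /= ss'.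
  rewrite distrC -raddfB; apply: le_trans (Im_nrm _) _.
  have -> : g s' = g s + (s' - s)%:C * (tau - i) by rewrite /g rmorphB; ring.
  have nx : nrm ((s' - s)%:C * (tau - i)) <= Num.min d (e / B).
    rewrite nrmM nrm_real distrC; move: ss'; rewrite ltr_pdivlMr// => /ltW; apply: le_trans.
    by rewrite ler_wpM2l// lerDl.
  move: nx; rewrite le_min => /andP[nd nB].
  by rewrite (le_trans (hB _ nd))// mulrC -ler_pdivlMr.
- rewrite f0 f1 ge_min le_max; apply/andP; split; apply/orP; [left|right]; lra.
have /andP[c0 c1] : 0 <= c <= 1 by move: c01; rewrite in_itv.
move: fc; rewrite /f; case: (pm _ (g0 c c0 c1)) => -> /= /eqP.
  by rewrite oner_eq0.
by rewrite oppr_eq0 oner_eq0.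
Qed.

End CrossRatioSign.

(** * Moebius action of PSU(2) and the normalizer of the Klein group *)

Section MoebiusAction.
Local Open Scope quotient_scope.
Variable C : numClosedFieldType.
Local Notation P1 := (P1 C).
Implicit Types (A B : 'M[C]_2) (U V : SU2 C) (x y h : PSU2 C) (p : P1) (w : C).

Lemma ord2P (P : 'I_2 -> Prop) : P 0 -> P 1 -> forall i, P i.
Proof.
move=> P0 P1 i; have [->//|i0] : i = 0 \/ i = 1; last by rewrite i0.
by case: i => -[|[|//]] ?; [left|right]; exact: val_inj.
Qed.

Lemma mx2_eqP (K : nzRingType) (A B : 'M[K]_2) : A 0 0 = B 0 0 -> A 0 1 = B 0 1 -> A 1 0 = B
  1 0 ->
  A 1 1 = B 1 1 -> A = B.
Proof.
by move=> *; apply/matrixP; apply: ord2P; apply: ord2P.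
Qed.

Lemma mulmx2 (K : pzSemiRingType) (A B : 'M[K]_2) i j :
  (A *m B) i j = A i 0 * B 0 j + A i 1 * B 1 j.
Proof.
rewrite mxE !big_ord_recl big_ord0 addr0; congr (_ + A i _ * B _ j); exact: val_inj.
Qed.

Lemma det2 (K : comPzRingType) (A : 'M[K]_2) : \det A = A 0 0 * A 1 1 - A 0 1 * A 1 0.
Proof.
rewrite -[in RHS]det_mx2; congr (\det _); apply/matrixP; apply: ord2P; apply: ord2P;
by rewrite !mxE.
Qed.

(** Homogeneous coordinates, in which [moebius] is linear. The pair (0, 0) has to be excluded, since
    it would be read as infinity. *)
Definition ratio (u v : C) : P1 := if v == 0 then None else Some (u / v).

Lemma moebius_ratio A (u v : C) : (u != 0) || (v != 0) ->
  moebius A (ratio u v) = ratio (A 0 0 * u + A 0 1 * v) (A 1 0 * u + A 1 1 * v).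
Proof.
rewrite /ratio; case: (eqVneq v 0) => [->|v0]; rewrite /= ?orbF => u0.
  by rewrite !mulr0 !addr0 mulf_eq0 (negbTE u0) orbF; case: eqVneq => // A10;
    rewrite -mulf_div divff// mulr1.
have -> : A 1 0 * (u / v) + A 1 1 = (A 1 0 * u + A 1 1 * v) / v by field.
have -> : A 0 0 * (u / v) + A 0 1 = (A 0 0 * u + A 0 1 * v) / v by field.
rewrite mulf_eq0 invr_eq0 (negbTE v0) orbF; case: eqVneq => // D.
by rewrite -mulf_div invrK mulVf ?mulr1// mulfV.
Qed.

Lemma ratioE p : exists u v : C, (u != 0) || (v != 0) /\ p = ratio u v.
Proof.
case: p => [w|]; [exists w, 1|exists 1, 0]; rewrite /ratio ?eqxx oner_eq0 ?orbT//.
by rewrite divr1.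
Qed.

Lemma moebius_mul A B p : \det B != 0 -> moebius (A *m B) p = moebius A (moebius B p).
Proof.
move=> dB; have [u [v [uv ->]]] := ratioE p.
rewrite !moebius_ratio//; last first.
  apply: contraR dB; rewrite negb_or !negbK => /andP[/eqP h1 /eqP h2].
  have /orP[n0|n0] := uv; rewrite -(mulIr_eq0 _ (mulIf n0)) det2.
    have -> : (B 0 0 * B 1 1 - B 0 1 * B 1 0) * u =
      B 1 1 * (B 0 0 * u + B 0 1 * v) - B 0 1 * (B 1 0 * u + B 1 1 * v) by ring.
    by rewrite h1 h2 !mulr0 subr0.
  have -> : (B 0 0 * B 1 1 - B 0 1 * B 1 0) * v =
    B 0 0 * (B 1 0 * u + B 1 1 * v) - B 1 0 * (B 0 0 * u + B 0 1 * v) by ring.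
  by rewrite h1 h2 !mulr0 subr0.
by rewrite !mulmx2; congr ratio; ring.
Qed.

Lemma PSU2_actM x y p : PSU2_act (x * y)%g p = PSU2_act x (PSU2_act y p).
Proof.
rewrite -[x]reprK -[y]reprK -[(_ * _)%g]/(PSU2_mul _ _) -pi_PSU2_mul !PSU2_act_pi.
by rewrite /= moebius_mul// SU2_det oner_eq0.
Qed.

Lemma PSU2_act1 p : PSU2_act 1%g p = p.
Proof.
have -> : (1%g : PSU2 C) = \pi_(PSU2 C) (SU2_one C) by rewrite -[1%g]/(PSU2_one C) !piE.
rewrite PSU2_act_pi /=; case: p => [w|] /=; rewrite !mxE /= ?mul0r ?add0r ?oner_eq0 ?eqxx//.
by rewrite mul1r addr0 divr1.
Qed.

Lemma PSU2_actK x : cancel (PSU2_act x) (PSU2_act x^-1%g).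
Proof. by move=> p; rewrite -PSU2_actM mulVg PSU2_act1. Qed.

Lemma PSU2_act_fix3 x : PSU2_act x (Some 0) = Some 0 -> PSU2_act x None = None ->
  PSU2_act x (Some 1) = Some 1 -> x = 1%g.
Proof.
rewrite -[x]reprK; set U := repr x; rewrite !PSU2_act_pi /= !mulr0 !add0r !mulr1.
have := SU2_det U; rewrite det2.
case: (eqVneq (U 1 1) 0) => // u1 + [] /eqP; rewrite mulf_eq0 invr_eq0 (negbTE u1) orbF => +
  /eqP u01.
rewrite u01 mul0r subr0 addr0 => det1.
case: (eqVneq (U 1 0) 0) => // u10 _; rewrite u10 add0r (negbTE u1) => -[] /eqP.
rewrite (can2_eq (divfK u1) (mulfK u1)) mul1r => /eqP u00.
rewrite -[1%g]/(PSU2_one C) piE; apply/eqP/PSU2_eqP.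
rewrite u00 -expr2 in det1; move/eqP: det1; rewrite sqrf_eq1 => /orP[]/eqP E; [left|right].
  by apply: mx2_eqP; rewrite ?u00 ?u01 ?u10 ?E !mxE.
by apply: mx2_eqP; rewrite ?u00 ?u01 ?u10 ?E !mxE ?oppr0.
Qed.

Lemma PSU2_act_inj x y : (forall p, p \in [:: Some 0; None; Some 1] ->
  PSU2_act x p = PSU2_act y p) -> x = y.
Proof.
move=> h; suff E : (y^-1 * x)%g = 1%g by rewrite -[x]mul1g -(mulgV y) -mulgA E mulg1.
by apply: PSU2_act_fix3; rewrite PSU2_actM h ?PSU2_actK// !inE eqxx ?orbT.
Qed.

End MoebiusAction.

(** * The Klein group and its normalizer *)

Section KleinNormalizer.
Local Open Scope ring_scope.
Local Open Scope quotient_scope.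
Variable C : numClosedFieldType.
Local Notation P1 := (P1 C).
Local Notation N := (normalizer (@K4 C)).
Implicit Types (A B : 'M[C]_2) (x y h k : PSU2 C) (p : P1) (w : C).

Lemma is_image_act x A p : is_image_of x A -> PSU2_act x p = moebius A p.
Proof. by move=> [U <- ->]; rewrite PSU2_act_pi. Qed.

Lemma is_image_inj x y A : is_image_of x A -> is_image_of y A -> x = y.
Proof.
move=> [U UA ->] [V VA ->]; congr (\pi_(PSU2 C) _); apply: val_inj.
by rewrite /= UA VA.
Qed.

Lemma is_image_su2 (a b : C) : a * a^* + b * b^* = 1 ->
  exists x, is_image_of x (mx2 a b (- b^*) (a^*)).
Proof.
move=> ab; have h : (mx2 a b (- b^*) (a^*) \is unitarymx) && (\det (mx2 a b (- b^*) (a^*)) == 1).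
  rewrite det_mx2 mulrN opprK ab eqxx andbT; apply/unitarymxP; apply: mx2_eqP;
  rewrite mulmx2 !mxE /= ?rmorphN /= ?conjCK ?mulr0n ?mulr1n.
  - by rewrite ab.
  - by ring.
  - by ring.
  - by rewrite mulrNN -ab; ring.
by exists (\pi_(PSU2 C) (MkSU2 h)), (MkSU2 h).
Qed.

Definition act_neg p : P1 := omap -%R p.
Definition act_inv p : P1 :=
  if p is Some w then if w == 0 then None else Some w^-1 else Some 0.
Definition act_Ninv p : P1 := act_neg (act_inv p).

Lemma i_neq0 : 'i != 0 :> C. Proof. exact: neq0Ci. Qed.

(** [K4] described by its action, so that identities in PSU(2) can be checked at three points of the
    sphere. *)
Lemma K4_generators : exists t s r : PSU2 C,
  [/\ PSU2_act t =1 act_neg, PSU2_act s =1 act_inv, PSU2_act r =1 act_Ninv &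
      forall x, K4 x <-> [\/ x = 1%g, x = t, x = s | x = r]].
Proof.
have i2 : 'i * - 'i = 1 :> C by rewrite mulrN -expr2 sqrCi opprK.
have [|t ht] := @is_image_su2 'i 0; first by rewrite conjCi mul0r addr0.
have [|s hs] := @is_image_su2 0 'i; first by rewrite conjCi mul0r add0r.
have [|r hr] := @is_image_su2 0 1; first by rewrite rmorph1 mul0r add0r mulr1.
rewrite conjCi rmorph0 oppr0 in ht; rewrite conjCi rmorph0 opprK in hs.
rewrite rmorph1 rmorph0 in hr.
have h1 : is_image_of (1%g : PSU2 C) 1%:M.
  exists (SU2_one C) => //; rewrite -[1%g]/(PSU2_one C) piE //.
exists t, s, r; split.
- move=> p; rewrite (is_image_act _ ht); case: p => [w|] /=; rewrite !mxE /= ?eqxx// mul0r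
  add0r addr0.
  by rewrite oppr_eq0 (negbTE i_neq0) invrN mulrN mulrAC divff ?i_neq0// mul1r.
- move=> p; rewrite (is_image_act _ hs); case: p => [w|] /=; rewrite !mxE /= ?(negbTE i_neq0)
  ?mul0r// addr0 add0r.
  rewrite mulf_eq0 (negbTE i_neq0) /=; case: eqP => // _.
  by rewrite invfM mulrA divff ?i_neq0// mul1r.
- move=> p; rewrite (is_image_act _ hr); case: p => [w|] /=; rewrite !mxE /= ?oppr_eq0
  ?oner_eq0 ?mul0r /act_Ninv /= ?oppr0//.
  by rewrite addr0 add0r mulN1r oppr_eq0; case: eqP => // _; rewrite /= invrN mul1r.
- move=> x; split.
    move=> [A xA]; rewrite !inE => /or4P[]/eqP AE; rewrite AE in xA;
      [constructor 1|constructor 2|constructor 3|constructor 4]; exact: is_image_inj xA _.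
  case=> ->; [exists 1%:M|exists (mx2 'i 0 0 (- 'i))|exists (mx2 0 'i 'i 0)|exists (mx2 0 1
    (-1) 0)] => //;
    by rewrite !inE eqxx ?orbT.
Qed.

Lemma conjgE_comm x h k : (h * x = x * k)%g -> (h ^ x)%g = k.
Proof. by move=> hx; rewrite conjgE hx mulKg. Qed.

Lemma normalizerP x : N x <-> (forall h, K4 h -> K4 (h ^ x)%g) /\
  (forall k, K4 k -> exists2 h, K4 h & (h ^ x)%g = k).
Proof.
split=> [E|[h1 h2]].
  have E' : [set (h ^ x)%g | h in @K4 C] = @K4 C := E.
  split=> [h hK|k]; first by rewrite -E'; exists h.
  by rewrite -[X in X k]E' => -[h hK <-]; exists h.
by rewrite /normalizer /=; apply/seteqP; split=> [_ [h /h1 ? <-]|k /h2[h hK <-]]//; exists h.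
Qed.

Lemma normalizer_mul x y : N x -> N y -> N (x * y)%g.
Proof.
move=> /normalizerP[x1 x2] /normalizerP[y1 y2]; apply/normalizerP; split=> [h /x1/y1|k].
  by rewrite -conjgM.
by move=> /y2[h /x2[g gK <-] <-]; exists g; rewrite // conjgM.
Qed.

Lemma normalizer_inv x : N x -> N x^-1%g.
Proof.
move=> /normalizerP[x1 x2]; apply/normalizerP; split=> [h /x2[k kK <-]|k /x1 kK].
  by rewrite conjgK.
by exists (k ^ x)%g; rewrite // conjgK.
Qed.

Lemma normalizer_one : N 1%g.
Proof. by apply/normalizerP; split=> [h|k kK]; [rewrite conjg1|exists k; rewrite ?conjg1]. Qed.

Variables T S : PSU2 C.
Hypothesis T_act : forall p, PSU2_act T p = omap ( *%R 'i) p.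
Hypothesis S_act : forall p, PSU2_act S p =
  if p is Some w then if w == -1 then None else Some ((1 - w) / (1 + w)) else Some (-1).

Lemma one_neqN1 : (1 == -1 :> C) = false.
Proof. by rewrite -addr_eq0 -mulr2n pnatr_eq0. Qed.

Lemma N1_neq1 : (-1 == 1 :> C) = false.
Proof. by rewrite eq_sym one_neqN1. Qed.

Lemma zero_neqN1 : (0 == -1 :> C) = false.
Proof. by rewrite eq_sym oppr_eq0 oner_eq0. Qed.

(** Conjugation by the rotation fixes [t] and exchanges [s] and [r]. *)
Lemma normalizer_T : N T.
Proof.
have [t [s [r [ht hs hr hK]]]] := K4_generators.
have iV : 'i^-1 = - 'i :> C := invCi C.
have simp := (T_act, ht, hs, hr, (@oppr0 C, @mulr0 C, @mulr1 C, @invr1 C, @oner_eq0 C, @eqxx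
  C, negbTE i_neq0, iV)).
have tT : (t * T = T * t)%g.
  by apply: PSU2_act_inj => p; rewrite !inE => /or3P[]/eqP ->;
    rewrite !PSU2_actM !simp /= ?simp ?mulrN1.
have sT : (s * T = T * r)%g.
  by apply: PSU2_act_inj => p; rewrite !inE => /or3P[]/eqP ->;
    rewrite !PSU2_actM !simp /= ?simp ?mulrN1 /act_Ninv /= ?simp /= ?simp ?mulrN1.
have rT : (r * T = T * s)%g.
  by apply: PSU2_act_inj => p; rewrite !inE => /or3P[]/eqP ->;
    rewrite !PSU2_actM !simp /= ?simp ?mulrN1 /act_Ninv /= ?simp /= ?simp ?opprK.
have [[c1 c2] c3] := (conjgE_comm tT, conjgE_comm sT, conjgE_comm rT).
apply/normalizerP; split=> [h /hK|k /hK].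
  case=> ->; rewrite ?conj1g ?c1 ?c2 ?c3; apply/hK; by [constructor 1|constructor
    2|constructor 3|constructor 4].
case=> ->; [exists 1%g|exists t|exists r|exists s]; rewrite ?conj1g ?c1 ?c2 ?c3//; apply/hK;
  by [constructor 1|constructor 2|constructor 3|constructor 4].
Qed.

(** Here [t] and [s] are exchanged and [r] is fixed. *)
Lemma normalizer_S : N S.
Proof.
have [t [s [r [ht hs hr hK]]]] := K4_generators.
have simp := (S_act, ht, hs, hr, (@oppr0 C, @mulr0 C, @mulr1 C, @mul0r C, @divr1 C, @invr1 C,
  @oner_eq0 C, @eqxx C, @opprK C,
  @subrr C, @subr0 C, @addr0 C), (one_neqN1, N1_neq1, zero_neqN1, @oppr_eq0 C)).
have tS : (t * S = S * s)%g.
  by apply: PSU2_act_inj => p; rewrite !inE => /or3P[]/eqP ->; rewrite !PSU2_actM;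
    do 4!rewrite ?simp /=.
have sS : (s * S = S * t)%g.
  by apply: PSU2_act_inj => p; rewrite !inE => /or3P[]/eqP ->; rewrite !PSU2_actM;
    do 4!rewrite ?simp /= ?invrN1.
have rS : (r * S = S * r)%g.
  by apply: PSU2_act_inj => p; rewrite !inE => /or3P[]/eqP ->; rewrite !PSU2_actM /act_Ninv;
    do 4!rewrite ?simp /= /act_Ninv /= ?invrN1.
have [[c1 c2] c3] := (conjgE_comm tS, conjgE_comm sS, conjgE_comm rS).
apply/normalizerP; split=> [h /hK|k /hK].
  case=> ->; rewrite ?conj1g ?c1 ?c2 ?c3; apply/hK; by [constructor 1|constructor
    2|constructor 3|constructor 4].
case=> ->; [exists 1%g|exists s|exists t|exists r]; rewrite ?conj1g ?c1 ?c2 ?c3//; apply/hK;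
  by [constructor 1|constructor 2|constructor 3|constructor 4].
Qed.

(** The vertices of an inscribed regular octahedron, an opposite pair for each nontrivial element of
    [K4]. *)
Definition vertices : seq P1 :=
  [:: Some 0; None; Some 1; Some (-1); Some 'i; Some (- 'i)].

Lemma K4_fixed h p : K4 h -> h <> 1%g -> PSU2_act h p = p -> p \in vertices.
Proof.
have [t [s [r [ht hs hr hK]]]] := K4_generators.
move=> /hK[]-> //; rewrite ?ht ?hs ?hr; case: p => [w|]//= _.
- move=> [] /eqP; rewrite eq_sym -addr_eq0 -mulr2n mulrn_eq0 /= => /eqP ->.
  by rewrite !inE eqxx.
- case: eqP => // /eqP w0 [] /(congr1 ( *%R w)); rewrite divff// => /esym/eqP.
  by rewrite -expr2 sqrf_eq1 => /orP[]/eqP ->; rewrite !inE eqxx ?orbT.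
- rewrite /act_Ninv /=; case: eqP => // /eqP w0 [] /(congr1 ( *%R w)).
  rewrite mulrN divff// => /esym/eqP; rewrite -expr2 -sqrCi eqf_sqr.
  by case/orP=> /eqP ->; rewrite !inE eqxx ?orbT.
Qed.

Lemma normalizer_generated (G : PSU2 C -> Prop) :
  G 1%g -> (forall x y, G x -> G y -> G (x * y)%g) -> (forall x, G x -> G x^-1%g) ->
  G T -> G S -> forall x, N x -> G x.
Proof.
move=> G1 GM GV GT GS.
have [t [s [r [ht hs hr hK]]]] := K4_generators.
have i2 : 'i * 'i = -1 :> C by rewrite -expr2 sqrCi.
have rot v : v \in [:: Some 1; Some (-1); Some 'i; Some (- 'i)] ->
    exists g, [/\ G g, N g, PSU2_act g v = Some 1, PSU2_act g None = None &
      PSU2_act g (Some 0) = Some 0].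
  have NT := normalizer_T.
  rewrite !inE => /or4P[]/eqP ->.
  - by exists 1%g; split; rewrite ?PSU2_act1//; exact: normalizer_one.
  - exists (T * T)%g; split; [exact: GM|exact: normalizer_mul| | |];
      by rewrite PSU2_actM !T_act /= ?mulr0// mulrN1 mulrN i2 opprK.
  - exists (T * (T * T))%g; split; [exact/GM/GM|exact/normalizer_mul/normalizer_mul| | |];
      by rewrite !PSU2_actM !T_act /= ?mulr0// i2 mulrN1 mulrN i2 opprK.
  - by exists T; split; rewrite ?T_act //= ?mulr0// mulrN i2 opprK.
have trans v : v \in vertices -> exists g, [/\ G g, N g & PSU2_act g v = Some 0].
  have NS := normalizer_S.
  have S1 : PSU2_act S (Some 1) = Some 0.
    by rewrite S_act one_neqN1 subrr mul0r.
  have viaS u : u \in [:: Some 1; Some (-1); Some 'i; Some (- 'i)] ->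
      exists g, [/\ G g, N g & PSU2_act g u = Some 0].
    move=> /rot[g [Gg Ng g1 _ _]]; exists (S * g)%g.
    by split; [exact: GM|exact: normalizer_mul|rewrite PSU2_actM g1 S1].
  rewrite inE => /predU1P[->|].
    by exists 1%g; split; rewrite ?PSU2_act1//; exact: normalizer_one.
  rewrite inE => /predU1P[->|/viaS//].
  have [|g [Gg Ng g1]] := viaS (Some (-1)); first by rewrite !inE eqxx orbT.
  exists (g * S)%g; split; [exact: GM|exact: normalizer_mul|].
  by rewrite PSU2_actM S_act.
have comm x k : N x -> K4 k -> k <> 1%g -> exists h, [/\ K4 h, h <> 1%g & (h * x = x * k)%g].
  move=> /normalizerP[_ h2] kK k1; have [h hK' hx] := h2 k kK; exists h; split=> //.
    by move=> h1; apply: k1; rewrite -hx h1 conj1g.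
  by rewrite -hx conjgE mulVKg.
have one_w : Some 1 <> Some (-1) :> P1 by case=> /eqP; rewrite one_neqN1.
have t1 : t <> 1%g.
  by move=> h; have := PSU2_act1 (Some (1 : C)); rewrite -h ht /= => -[]/eqP; rewrite N1_neq1.
have s1 : s <> 1%g.
  by move=> h; have := PSU2_act1 (None : P1); rewrite -h hs.
have t0 : PSU2_act t (Some 0) = Some 0 by rewrite ht /= oppr0.
have too : PSU2_act t None = None by rewrite ht.
have s1E : PSU2_act s (Some 1) = Some 1 by rewrite hs /= oner_eq0 invr1.
have Kt : K4 t by apply/hK; constructor 2.
have Ks : K4 s by apply/hK; constructor 3.
move=> x Nx.
have [h [hKx hn1 hx]] := comm x t Nx Kt t1.
have x0 : PSU2_act x (Some 0) \in vertices.
  apply: K4_fixed hKx hn1 _; by rewrite -PSU2_actM hx PSU2_actM t0.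
have [g [Gg Ng gx]] := trans _ x0.
pose y := (g * x)%g; have Ny : N y by exact: normalizer_mul.
have y0 : PSU2_act y (Some 0) = Some 0 by rewrite PSU2_actM.
have [k [kK kn1 ky]] := comm y t Ny Kt t1.
(* Only [t] fixes 0 among the nontrivial elements of [K4]. So [y] commutes with [t] and preserves
   its other fixed point, infinity. *)
have kt : k = t.
  have : PSU2_act k (Some 0) = Some 0.
    by rewrite -[X in PSU2_act k X]y0 -PSU2_actM ky PSU2_actM t0 y0.
  move/hK: kK => [k1|//|->|->]; first by case: kn1.
    by rewrite hs /= eqxx.
  by rewrite hr /act_Ninv /= eqxx.
have yoo : PSU2_act y None = None.
  have : PSU2_act t (PSU2_act y None) = PSU2_act y None by rewrite -[X in PSU2_act X]kt
    -PSU2_actM ky PSU2_actM too.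
  case E : (PSU2_act y None) => [w|]//; rewrite ht /= => -[] /eqP.
  rewrite eq_sym -addr_eq0 -mulr2n mulrn_eq0 /= => /eqP w0.
  by have := PSU2_actK y None; rewrite E w0 -y0 PSU2_actK.
have [l [lK ln1 ly]] := comm y s Ny Ks s1.
have y1 : PSU2_act y (Some 1) \in vertices.
  apply: K4_fixed lK ln1 _; by rewrite -PSU2_actM ly PSU2_actM s1E.
have [g' [Gg' Ng' g'1 g'oo g'0]] : exists g, [/\ G g, N g,
    PSU2_act g (PSU2_act y (Some 1)) = Some 1, PSU2_act g None = None &
      PSU2_act g (Some 0) = Some 0].
  apply: rot; move: y1; rewrite inE => /predU1P[E|].
    have := PSU2_actK y (Some 1); rewrite E -y0 PSU2_actK => -[]/eqP.
    by rewrite eq_sym oner_eq0.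
  rewrite inE => /predU1P[E|//].
  by have := PSU2_actK y (Some 1); rewrite E -yoo PSU2_actK.
have : (g' * y)%g = 1%g by apply: PSU2_act_fix3; rewrite PSU2_actM ?y0 ?yoo.
rewrite /y => E; have -> : x = (g^-1 * g'^-1)%g.
  by rewrite -[LHS](mulKg g) -[(g * x)%g](mulKg g') E mulg1.
by apply: GM; exact: GV.
Qed.

End KleinNormalizer.

(** * The modular group *)

Section ModularGroup.
Implicit Types g h : SL2Z.

Lemma SL2Z_det2 g : g 0 0 * g 1 1 - g 0 1 * g 1 0 = 1.
Proof. by rewrite -det2 SL2Z_det. Qed.

Lemma SL2Z_mulE g h i j : (g * h)%g i j = g i 0 * h 0 j + g i 1 * h 1 j.
Proof. exact: mulmx2. Qed.

Lemma SL2Z_eqP g h : g 0 0 = h 0 0 -> g 0 1 = h 0 1 -> g 1 0 = h 1 0 -> g 1 1 = h 1 1 -> g = h.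
Proof. by move=> *; apply: val_inj; exact: mx2_eqP. Qed.

Lemma SL2Z_oneE : ((1%g : SL2Z) 0 0 = 1) * ((1%g : SL2Z) 0 1 = 0) *
  ((1%g : SL2Z) 1 0 = 0) * ((1%g : SL2Z) 1 1 = 1).
Proof. by rewrite !mxE. Qed.

Lemma SL2Z_TE : (SL2Z_T 0 0 = 1) * (SL2Z_T 0 1 = 1) * (SL2Z_T 1 0 = 0) * (SL2Z_T 1 1 = 1).
Proof. by rewrite !mxE. Qed.

Lemma SL2Z_SE : (SL2Z_S 0 0 = 0) * (SL2Z_S 0 1 = 1) * (SL2Z_S 1 0 = -1) * (SL2Z_S 1 1 = 0).
Proof. by rewrite !mxE. Qed.

Fact SL2Z_Tpow_subproof (k : int) : \det (mx2 1 k 0 1) == 1.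
Proof. by rewrite det_mx2 mulr1 mulr0 subr0. Qed.

Definition SL2Z_Tpow k : SL2Z := MkSL2Z (SL2Z_Tpow_subproof k).

Lemma SL2Z_TpowE k : (SL2Z_Tpow k 0 0 = 1) * (SL2Z_Tpow k 0 1 = k) *
  (SL2Z_Tpow k 1 0 = 0) * (SL2Z_Tpow k 1 1 = 1).
Proof. by rewrite !mxE. Qed.

Section Generation.
Variable P : SL2Z -> Prop.
Hypotheses (P1 : P 1%g) (PM : forall g h, P g -> P h -> P (g * h)%g)
  (PV : forall g, P g -> P g^-1%g) (PT : P SL2Z_T) (PS : P SL2Z_S).

Lemma SL2Z_Tpow_in k : P (SL2Z_Tpow k).
Proof.
have nat_case (n : nat) : P (SL2Z_Tpow n).
  elim: n => [|n IH].
    by rewrite (_ : SL2Z_Tpow _ = 1%g)//; apply: SL2Z_eqP; rewrite SL2Z_TpowE SL2Z_oneE.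
  rewrite (_ : SL2Z_Tpow _ = (SL2Z_T * SL2Z_Tpow n)%g); first exact: PM.
  by apply: SL2Z_eqP; rewrite SL2Z_mulE !SL2Z_TE !SL2Z_TpowE; lia.
case: k => n; first exact: nat_case.
rewrite (_ : SL2Z_Tpow _ = (SL2Z_Tpow n.+1)^-1%g); first exact/PV/nat_case.
rewrite -[RHS]mulg1 -(mulKg (SL2Z_Tpow n.+1) (SL2Z_Tpow (Negz n))); congr (_ * _)%g.
by apply: SL2Z_eqP; rewrite SL2Z_mulE !SL2Z_TpowE SL2Z_oneE; lia.
Qed.

(** Euclid's algorithm on the first column: division followed by [S] replaces the lower left entry
    by minus the remainder. *)
Lemma SL2Z_generated g : P g.
Proof.
have [n] := ubnP (absz (g 1 0)); elim: n g => // n IH g hn.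
have det := SL2Z_det2 g.
have [c0|c0] := eqVneq (g 1 0) 0.
  have ad : g 0 0 * g 1 1 = 1 by move: det; rewrite c0 mulr0 subr0.
  have [[a1 d1]|[a1 d1]] : (g 0 0 = 1 /\ g 1 1 = 1) \/ (g 0 0 = -1 /\ g 1 1 = -1).
    have := congr1 absz ad; rewrite abszM => /eqP; rewrite muln_eq1 => /andP[/eqP a1 /eqP d1].
    have [aE|aE] : g 0 0 = 1 \/ g 0 0 = -1 by lia.
      by left; split=> //; move: ad; rewrite aE; lia.
    by right; split=> //; move: ad; rewrite aE; lia.
    rewrite (_ : g = SL2Z_Tpow (g 0 1)); first exact: SL2Z_Tpow_in.
    by apply: SL2Z_eqP; rewrite SL2Z_TpowE.
  (* The matrix is minus a power of [T], and the square of [S] is minus the identity. *)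
  pose b := g 0 1; rewrite (_ : g = (SL2Z_S * (SL2Z_S * SL2Z_Tpow (- b)))%g).
    by apply: (PM PS); apply: (PM PS); exact: SL2Z_Tpow_in.
  by apply: SL2Z_eqP; rewrite !SL2Z_mulE !SL2Z_TpowE !SL2Z_SE /b; lia.
pose q := divz (g 0 0) (g 1 0).
pose h := (SL2Z_S * (SL2Z_Tpow (- q) * g))%g.
have hP : P h.
  apply: IH; rewrite /h !SL2Z_mulE !SL2Z_TpowE !SL2Z_SE.
  have -> : -1 * (1 * g 0 0 + - q * g 1 0) + 0 * (0 * g 0 0 + 1 * g 1 0) = - modz (g 0 0) (g 1 0).
    by rewrite /modz -/q; ring.
  have := ltz_mod (g 0 0) c0; have := modz_ge0 (g 0 0) c0.
  by rewrite abszN; lia.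
rewrite (_ : g = ((SL2Z_S * SL2Z_Tpow (- q))^-1 * h)%g); last by rewrite /h [(SL2Z_S * (_ *
  g))%g]mulgA mulKg.
apply: PM => //; apply: PV; apply: PM => //; exact: SL2Z_Tpow_in.
Qed.

End Generation.
End ModularGroup.

(** * Transformation laws of the developing map *)

Section ModularAction.
Variable R : realType.
Local Notation C := R[i].
Implicit Types (g h : SL2Z) (tau z w : C).

Lemma autj_neq0 g tau : 0 < complex.Im tau -> autj g tau != 0.
Proof.
move=> t0; rewrite /autj addrC -[_ + _]/(lattice_pt tau (g 1 1, g 1 0)).
apply: lattice_pt_neq0 => //; apply/eqP => -[d0 c0].
by have := SL2Z_det2 g; rewrite d0 c0 !mulr0 subr0.
Qed.

Lemma Im_div (u v : C) : complex.Im (u / v) =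
  (complex.Im u * complex.Re v - complex.Re u * complex.Im v) / nrm v ^+ 2.
Proof.
rewrite nrm_sqr; case: u v => a b [c d] /=; ring.
Qed.

Lemma Im_SL2Z_act g tau : 0 < complex.Im tau -> 0 < complex.Im (SL2Z_act g tau).
Proof.
move=> t0; have j0 := autj_neq0 g t0.
rewrite /SL2Z_act Im_div divr_gt0 ?exprn_gt0 ?nrm_gt0//.
have I (k : int) w : complex.Im (k%:~R * w) = k%:~R * complex.Im w.
  by rewrite -(rmorph_int (real_complex R)) Im_realM.
have Re' (k : int) w : complex.Re (k%:~R * w) = k%:~R * complex.Re w.
  by rewrite -(rmorph_int (real_complex R)) Re_realM.
have I0 (k : int) : complex.Im (k%:~R : C) = 0 by rewrite -(rmorph_int (real_complex R)).
have R0 (k : int) : complex.Re (k%:~R : C) = k%:~R by rewrite -(rmorph_int (real_complex R)).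
rewrite /autj !Im_add !Re_add !I !Re' !I0 !R0.
set x := complex.Re tau; set y := complex.Im tau.
have -> : (((g 0 0)%:~R * y + 0) * ((g 1 0)%:~R * x + (g 1 1)%:~R) -
   ((g 0 0)%:~R * x + (g 0 1)%:~R) * ((g 1 0)%:~R * y + 0)) =
   (g 0 0 * g 1 1 - g 0 1 * g 1 0)%:~R * y.
  by rewrite intrB !intrM; ring.
by rewrite SL2Z_det2 mul1r.
Qed.

Lemma autjM g h tau : 0 < complex.Im tau ->
  autj (g * h)%g tau = autj g (SL2Z_act h tau) * autj h tau.
Proof.
move=> t0; have j0 := autj_neq0 h t0.
rewrite [autj g _]/autj mulrDl /SL2Z_act -mulrA divfK// /autj !SL2Z_mulE !intrD !intrM.
by ring.
Qed.

Lemma SL2Z_actM g h tau : 0 < complex.Im tau ->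
  SL2Z_act (g * h)%g tau = SL2Z_act g (SL2Z_act h tau).
Proof.
move=> t0; have jh0 := autj_neq0 h t0; have jg0 := autj_neq0 g (Im_SL2Z_act h t0).
rewrite /SL2Z_act autjM// -/(SL2Z_act h tau).
apply: (mulIf (mulf_neq0 jg0 jh0)); rewrite divfK ?mulf_neq0// [RHS]mulrA divfK//.
by rewrite mulrDl {1}/SL2Z_act -mulrA divfK// /autj !SL2Z_mulE !intrD !intrM; ring.
Qed.

Lemma autj1 tau : autj 1%g tau = 1.
Proof. by rewrite /autj !SL2Z_oneE mulr0z mulr1z mul0r add0r. Qed.

Lemma SL2Z_act1 tau : SL2Z_act 1%g tau = tau.
Proof. by rewrite /SL2Z_act autj1 !SL2Z_oneE mulr0z mulr1z mul1r addr0 divr1. Qed.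

Lemma lattice_SL2Z g tau w : 0 < complex.Im tau ->
  off_lattice (SL2Z_act g tau) ((autj g tau)^-1 * w) <-> off_lattice tau w.
Proof.
move=> t0; have j0 := autj_neq0 g t0; have det := SL2Z_det2 g.
have ptE p : lattice_pt (SL2Z_act g tau) p =
    (autj g tau)^-1 * lattice_pt tau (p.1 * g 1 1 + p.2 * g 0 1, p.1 * g 1 0 + p.2 * g 0 0).
  apply: (mulfI j0); rewrite mulVKf// /lattice_pt mulrDr mulrCA /SL2Z_act.
  rewrite [autj g tau * (_ / _)]mulrCA divff// mulr1 /autj !intrD !intrM /=; ring.
split=> h p E.
  apply: (h (g 0 0 * p.1 - g 0 1 * p.2, g 1 1 * p.2 - g 1 0 * p.1)).
  rewrite ptE E; congr (_ * lattice_pt _ _); case: p {E h} => m n /=.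
  by rewrite -[m in LHS]mulr1 -[n in LHS]mulr1 -det; congr pair; ring.
apply: (h (p.1 * g 1 1 + p.2 * g 0 1, p.1 * g 1 0 + p.2 * g 0 0)).
by apply: (mulfI (invr_neq0 j0)); rewrite E ptE.
Qed.

Lemma wp_act g tau w : 0 < complex.Im tau -> off_lattice tau w ->
  wp (SL2Z_act g tau) ((autj g tau)^-1 * w) = autj g tau ^+ 2 * wp tau w.
Proof. by move=> t0 ow; apply: wp_SL2Z => //; exact: SL2Z_det2. Qed.

Lemma quarter_act g tau m n : 0 < complex.Im tau -> quarter (SL2Z_act g tau) m n =
  (autj g tau)^-1 * quarter tau (m * g 1 1 + n * g 0 1) (m * g 1 0 + n * g 0 0).
Proof.
move=> t0; have j0 := autj_neq0 g t0.
apply: (mulfI j0); rewrite mulVKf// /quarter mulrA; congr (_ / 4).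
rewrite mulrDr mulrCA [autj g tau * SL2Z_act _ _]mulrC /SL2Z_act divfK//.
by rewrite !intrD !intrM /autj; ring.
Qed.

Lemma wp4_act g tau m n : 0 < complex.Im tau -> ~~ ((4 %| m)%Z && (4 %| n)%Z) ->
  wp4 (SL2Z_act g tau) m n =
  autj g tau ^+ 2 * wp4 tau (m * g 1 1 + n * g 0 1) (m * g 1 0 + n * g 0 0).
Proof.
move=> t0 mn; have o := off_quarter (Im_SL2Z_act g t0) mn.
rewrite !wp4E quarter_act// wp_act//.
by apply/(lattice_SL2Z g _ t0); rewrite -quarter_act.
Qed.

(* The coordinate on the sphere with [e0, e1, e2] at [1, 0, oo]. *)
Definition normalized (e0 e1 e2 : C) (p : P1 C) : P1 C :=
  let c := (e0 - e2) / (e0 - e1) in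
  if p is Some w then if w == e2 then None else Some (c * ((w - e1) / (w - e2)))
  else Some c.

(** Infinity replaces the meaningless value of [wp] at lattice points. *)
Definition wp_P1 tau z : P1 C := if z / 2 \in lattice tau then None else Some (wp tau (z / 2)).

Lemma dev_mapE z tau : dev_map z tau =
  normalized (wp4 tau 0 1) (wp4 tau 1 0) (wp4 tau 1 2) (wp_P1 tau z).
Proof.
have e0 : wp4 tau 0 1 = wp tau (tau / 4) by rewrite wp4E /quarter mulr0z mulr1z mul1r add0r.
have e1 : wp4 tau 1 0 = wp tau (1 / 4) by rewrite wp4E /quarter mulr0z mulr1z mul0r addr0.
have e2 : wp4 tau 1 2 = wp tau (1 / 4 + tau / 2).
  by rewrite wp4E; congr (wp _ _); rewrite /quarter mulr1z; field.
rewrite /dev_map /wp_P1 /normalized e0 e1 e2.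
by case: ifP.
Qed.

Lemma normalized_scale (k e0 e1 e2 : C) p : k != 0 ->
  normalized (k * e0) (k * e1) (k * e2) (omap ( *%R k) p) = normalized e0 e1 e2 p.
Proof.
move=> k0; have sc (x y u v : C) : (k * x - k * y) / (k * u - k * v) = (x - y) / (u - v).
  by rewrite -!mulrBr -mulf_div divff// mul1r.
rewrite /normalized; case: p => [w|] /=; rewrite !sc//.
by rewrite (inj_eq (mulfI k0)).
Qed.

Lemma wp_P1_act g tau z : 0 < complex.Im tau ->
  wp_P1 (SL2Z_act g tau) ((autj g tau)^-1 * z) = omap ( *%R (autj g tau ^+ 2)) (wp_P1 tau z).
Proof.
move=> t0; have L := lattice_SL2Z g (z / 2) t0.
rewrite /wp_P1 -mulrA; have [zL|zL] := boolP (z / 2 \in lattice tau).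
  rewrite ifT//; apply: contraLR zL => /off_latticeP/L/off_latticeP; exact.
rewrite ifN /=; last by apply/off_latticeP/L/off_latticeP.
by rewrite wp_act//; exact/off_latticeP.
Qed.

(** The common factor [autj g tau ^+ 2] cancels; only the indices of the three reference points
    change, through the entries of [g]. *)
Lemma dev_map_act g tau z : 0 < complex.Im tau ->
  dev_map ((autj g tau)^-1 * z) (SL2Z_act g tau) =
  normalized (wp4 tau (g 0 1) (g 0 0)) (wp4 tau (g 1 1) (g 1 0))
    (wp4 tau (g 1 1 + 2 * g 0 1) (g 1 0 + 2 * g 0 0)) (wp_P1 tau z).
Proof.
move=> t0; rewrite dev_mapE !wp4_act// wp_P1_act// normalized_scale; last first.
  by rewrite expf_neq0// autj_neq0.
by rewrite !mul0r !mul1r !add0r !addr0.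
Qed.

(** Only the point of value 1 moves, from index (0, 1) to (1, 1), so f is multiplied by the inverse
    of [cross_ratio tau]. *)
Lemma dev_map_T tau z : 0 < complex.Im tau ->
  dev_map ((autj SL2Z_T tau)^-1 * z) (SL2Z_act SL2Z_T tau) = omap ( *%R 'i) (dev_map z tau).
Proof.
move=> t0; rewrite dev_map_act// dev_mapE !SL2Z_TE.
have -> : wp4 tau (1 + 2 * 1) (0 + 2 * 1) = wp4 tau 1 2 by apply: wp4_eq.
have [[e12 e01 e02 _ _] e42 _ _ _] := wp4_facts t0.
have := cross_ratioE t0; rewrite /cross_ratio.
move: (wp4 tau 0 1) (wp4 tau 1 0) (wp4 tau 1 1) (wp4 tau 1 2) e12 e01 e02 e42 => e e1 e4 e2
  e12 e01 e02 e42 X.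
rewrite -subr_eq0 in e01; rewrite -subr_eq0 in e02; rewrite -subr_eq0 in e42.
have i0 : ('i : C) != 0 := neq0Ci _.
have e41 : e4 - e1 != 0.
  apply: contraNneq i0 => h; move: X; rewrite h mulr0 mul0r => /esym/eqP.
  by rewrite oppr_eq0 => /eqP ->.
have c : (e4 - e2) / (e4 - e1) = 'i * ((e - e2) / (e - e1)).
  have -> : (e - e2) / (e - e1) = - 'i * ((e4 - e2) / (e4 - e1)).
    by rewrite -X; field; rewrite e41 e42 e01.
  by rewrite mulrA mulrN -expr2 (sqr_i R) opprK mul1r.
rewrite /normalized c; case: (wp_P1 tau z) => [w|]//=.
by case: eqP => //= _; rewrite !mulrA.
Qed.

(** The points of values 0 and 1 are exchanged and the pole moves to index (2, 1), where f is -1;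
    these three conditions single out the fraction. *)
Lemma dev_map_S tau z : 0 < complex.Im tau ->
  dev_map ((autj SL2Z_S tau)^-1 * z) (SL2Z_act SL2Z_S tau) =
  if dev_map z tau is Some w then if w == -1 then None else Some ((1 - w) / (1 + w))
  else Some (-1).
Proof.
move=> t0; rewrite dev_map_act// dev_mapE !SL2Z_SE.
have -> : wp4 tau (0 + 2 * 1) (-1 + 2 * 0) = wp4 tau 2 1 by apply: wp4_eq.
have -> : wp4 tau 0 (-1) = wp4 tau 0 1 by apply: wp4_eq.
have [[e12 e01 e02 e31 e32] _ X _ _] := wp4_facts t0.
move: (wp4 tau 0 1) (wp4 tau 1 0) (wp4 tau 2 1) (wp4 tau 1 2) e12 e01 e02 e31 e32 X.
move=> e e1 e3 e2 e12 e01 e02 e31 e32 X.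
rewrite -subr_eq0 in e12; rewrite -subr_eq0 in e01; rewrite -subr_eq0 in e02.
rewrite -subr_eq0 in e31; rewrite -subr_eq0 in e32.
(* The relation [X] is linear in [e3], and [D] is the denominator of its solution. Its vanishing
   would give [e1 = e2]. *)
pose D := 2 * e - e1 - e2.
have e3D : e3 * D = e * (e1 + e2) - 2 * e1 * e2.
  apply/eqP; rewrite -subr_eq0; apply/eqP.
  have -> : e3 * D - (e * (e1 + e2) - 2 * e1 * e2) =
    (e - e1) * (e3 - e2) + (e3 - e1) * (e - e2) by rewrite /D; ring.
  by rewrite X addNr.
have D0 : D != 0.
  apply/eqP => D0; move: e3D; rewrite D0 mulr0 => /esym h.
  have eE : e = (e1 + e2) / 2.
    apply: (mulfI (_ : 2 != 0)); first by rewrite pnatr_eq0.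
    have -> : 2 * e = D + (e1 + e2) by rewrite /D; ring.
    by rewrite D0; field.
  have : (e1 - e2) ^+ 2 = 0.
    have -> : (e1 - e2) ^+ 2 = 2 * (e * (e1 + e2) - 2 * e1 * e2) by rewrite eE; field.
    by rewrite h mulr0.
  by move/eqP; rewrite sqrf_eq0 (negbTE e12).
have e3E : e3 = (e * (e1 + e2) - 2 * e1 * e2) / D by rewrite -e3D mulfK.
have e10 : e1 - e != 0 by rewrite -opprB oppr_eq0.
have c1 : 1 + (e - e2) / (e - e1) = D / (e - e1) by rewrite /D; field.
have c'E : (e1 - e3) / (e1 - e) = (e2 - e1) / D.
  by rewrite e3E /D; field; rewrite D0.
rewrite /normalized; case: (wp_P1 tau z) => [w|]; last first.
  rewrite -addr_eq0 [_ + 1]addrC c1 mulf_eq0 invr_eq0 (negbTE D0) (negbTE e01) /=.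
  by rewrite c'E; congr Some; rewrite /D; field; rewrite e01 D0.
have [->|we2] := eqVneq w e2.
  have e23 : e2 != e3 by rewrite eq_sym -subr_eq0.
  rewrite (negbTE e23); congr Some; rewrite c'E.
  have -> : e2 - e3 = (e - e2) * (e2 - e1) / D by rewrite e3E /D; field.
  have e21 : e2 - e1 != 0 by rewrite -opprB oppr_eq0.
  by field; rewrite e21 e02 D0.
rewrite -subr_eq0 in we2.
have fE : 1 + (e - e2) / (e - e1) * ((w - e1) / (w - e2)) = D * (w - e3) / ((e - e1) * (w - e2)).
  by rewrite e3E /D; field; rewrite we2 e01 D0.
rewrite -addr_eq0 [_ + 1]addrC fE !mulf_eq0 invr_eq0 mulf_eq0 (negbTE D0) (negbTE e01)
  (negbTE we2) /= !orbF.
rewrite subr_eq0; case: eqVneq => // we3; rewrite -subr_eq0 in we3.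
congr Some; rewrite c'E.
have -> : (1 - (e - e2) / (e - e1) * ((w - e1) / (w - e2))) = (e2 - e1) * (w - e) / ((e - e1)
  * (w - e2)).
  by field; rewrite we2 e01.
by field; rewrite we3 we2 e01 D0.
Qed.

End ModularAction.

(** * Values of f at half lattice points *)

Section TorsionValues.
Variables (R : realType) (tau : R[i]).
Hypothesis tau_gt0 : 0 < complex.Im tau.
Local Notation C := R[i].
Implicit Types m n : int.

Definition dev4 m n : P1 C := dev_map ((m%:~R + n%:~R * tau) / 2) tau.

Lemma dev4E m n : ~~ ((4 %| m)%Z && (4 %| n)%Z) ->
  dev4 m n = normalized (wp4 tau 0 1) (wp4 tau 1 0) (wp4 tau 1 2) (Some (wp4 tau m n)).
Proof.
move=> mn; rewrite /dev4 dev_mapE /wp_P1.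
have -> : (m%:~R + n%:~R * tau) / 2 / 2 = quarter tau m n by rewrite /quarter; field.
by rewrite ifN ?wp4E//; apply/off_latticeP/off_quarter.
Qed.

Lemma dev4_eq m n m' n' : ~~ ((4 %| m)%Z && (4 %| n)%Z) ->
  ~~ ((4 %| m')%Z && (4 %| n')%Z) ->
  (4 %| m' - m)%Z && (4 %| n' - n)%Z || (4 %| m' + m)%Z && (4 %| n' + n)%Z ->
  dev4 m' n' = dev4 m n.
Proof. by move=> mn mn' e; rewrite !dev4E// (wp4_eq tau_gt0 mn e). Qed.

Lemma dev4_values : [/\ [/\ dev4 1 0 = Some 0, dev4 1 2 = None & dev4 0 1 = Some 1],
  dev4 2 1 = Some (-1), dev4 1 1 = Some (- 'i) & dev4 1 (-1) = Some 'i].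
Proof.
have [[e12 e01 e02 e31 e32] e42 h3 h5 _] := wp4_facts tau_gt0.
have := cross_ratioE tau_gt0; rewrite /cross_ratio !dev4E//=.
have i0 : ('i : C) != 0 := neq0Ci _.
move: (wp4 tau 0 1) (wp4 tau 1 0) (wp4 tau 1 2) (wp4 tau 2 1) (wp4 tau 1 1) (wp4 tau 1 (-1))
  e12 e01 e02 e31 e32 e42 h3 h5.
move=> e e1 e2 e3 e4 e5 e12 e01 e02 e31 e32 e42 h3 h5 X.
have n01 : e - e1 != 0 by rewrite subr_eq0.
have n02 : e - e2 != 0 by rewrite subr_eq0.
have n32 : e3 - e2 != 0 by rewrite subr_eq0.
have n42 : e4 - e2 != 0 by rewrite subr_eq0.
have n12 : e1 - e2 != 0 by rewrite subr_eq0.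
have e52 : e5 != e2.
  apply/eqP => E; move/eqP: h5; rewrite E subrr mulr0 eq_sym oppr_eq0 mulf_eq0.
  by rewrite (negbTE n42) orbF -oppr_eq0 opprB (negbTE n12).
have n52 : e5 - e2 != 0 by rewrite subr_eq0.
have X4 : (e - e2) / (e - e1) * ((e4 - e1) / (e4 - e2)) = - 'i by rewrite -X mulf_div.
split; [split| | |].
- by rewrite (negbTE e12) subrr mul0r mulr0.
- by rewrite eqxx.
- by rewrite (negbTE e02); congr Some; field; rewrite n01 n02.
- rewrite (negbTE e32); congr Some; rewrite mulf_div.
  apply: (mulIf (mulf_neq0 n01 n32)); rewrite divfK ?mulf_neq0// mulN1r h3 opprK.
  by rewrite mulrC.
- by rewrite (negbTE e42) X4.
- rewrite (negbTE e52); congr Some; rewrite -[RHS]opprK -X4.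
  have -> : (e5 - e1) / (e5 - e2) = - ((e4 - e1) / (e4 - e2)); last by rewrite mulrN.
  by apply/eqP; rewrite -mulNr eqr_div// mulNr h5 opprK.
Qed.

(** The value depends on the index modulo 4 and sign. Each alternative keeps just the divisibility
    that is later deduced from the value. *)
Lemma dev4_class m n : ~~ ((2 %| m)%Z && (2 %| n)%Z) ->
  [\/ (4 %| n)%Z /\ dev4 m n = Some 0, (2 %| n)%Z /\ dev4 m n = None,
      (4 %| m)%Z /\ dev4 m n = Some 1 |
      (2 %| m)%Z /\ dev4 m n = Some (-1) \/
      [/\ ~~ (2 %| m)%Z, ~~ (2 %| n)%Z &
        dev4 m n = Some (- 'i) \/ dev4 m n = Some 'i]].
Proof.
have [[v0 voo v1] vN vi vj] := dev4_values.
move=> mn.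
have mn4 : ~~ ((4 %| m)%Z && (4 %| n)%Z).
  by apply: contra mn => /andP[/dvdzP[p ->] /dvdzP[q ->]]; apply/andP; split;
    apply/dvdzP; [exists (p * 2)|exists (q * 2)]; ring.
have : [\/ (4 %| n)%Z /\ ((4 %| m - 1)%Z \/ (4 %| m + 1)%Z),
           (4 %| n - 2)%Z /\ ((4 %| m - 1)%Z \/ (4 %| m + 1)%Z),
           (4 %| m)%Z /\ ((4 %| n - 1)%Z \/ (4 %| n + 1)%Z) |
           (4 %| m - 2)%Z /\ ((4 %| n - 1)%Z \/ (4 %| n + 1)%Z) \/
           [/\ ~~ (2 %| m)%Z, ~~ (2 %| n)%Z & ((4 %| m - 1)%Z \/ (4 %| m + 1)%Z) /\ ((4 %| n
             - 1)%Z \/ (4 %| n + 1)%Z)]].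
  have res (k : int) : exists q, [\/ k = q * 4, k = q * 4 + 1, k = q * 4 + 2 | k = q * 4 + 3].
    exists (divz k 4); have := divz_eq k 4; have := @ltz_mod k 4 isT; have := @modz_ge0 k 4 isT.
    move: (divz k 4) (modz k 4) => q r *.
    have [r0|r1|r2|r3] : [\/ r = 0, r = 1, r = 2 | r = 3].
      have : [|| r == 0, r == 1, r == 2 | r == 3] by lia.
      by case/or4P=> /eqP ->; [constructor 1|constructor 2|constructor 3|constructor 4].
    - by constructor 1; lia.
    - by constructor 2; lia.
    - by constructor 3; lia.
    - by constructor 4; lia.
  have d4 (k q : int) : k = q * 4 -> (4 %| k)%Z by move=> ->; apply/dvdzP; exists q.
  have od (k : int) : ~~ (2 %| k)%Z -> (4 %| k - 1)%Z \/ (4 %| k + 1)%Z.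
    have [q [kE|kE|kE|kE]] := res k => k2.
    - by case/negP: k2; apply/dvdzP; exists (q * 2); lia.
    - by left; apply: (d4 _ q); lia.
    - by case/negP: k2; apply/dvdzP; exists (q * 2 + 1); lia.
    - by right; apply: (d4 _ (q + 1)); lia.
  have ev (k : int) : (2 %| k)%Z -> (4 %| k)%Z \/ (4 %| k - 2)%Z.
    move=> /dvdzP[p kp]; have [q [kE|kE|kE|kE]] := res k.
    - by left; apply: (d4 _ q).
    - by exfalso; lia.
    - by right; apply: (d4 _ q); lia.
    - by exfalso; lia.
  have [m2|m2] := boolP (2 %| m)%Z; have [n2|n2] := boolP (2 %| n)%Z.
  - by move: mn; rewrite m2 n2.
  - have [m4|m4] := ev m m2; [constructor 3|constructor 4; left]; split=> //; exact: od.
  - have [n4|n4] := ev n n2; [constructor 1|constructor 2]; split=> //; exact: od.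
  - by constructor 4; right; split=> //; split; exact: od.
have two (k : int) : (4 %| k - 2)%Z -> (2 %| k)%Z.
  by move=> /dvdzP[q kq]; apply/dvdzP; exists (q * 2 + 1); lia.
have two' (k : int) : (4 %| k - 2)%Z -> (4 %| k + 2)%Z.
  by move=> /dvdzP[q kq]; apply/dvdzP; exists (q + 1); lia.
have sgn (k : int) : (4 %| k - 1)%Z -> (4 %| k - (-1) - 2)%Z by rewrite opprK -addrA.
case=> [[n4 mo]|[n4 mo]|[m4 no]|[[m4 no]|[m2 n2 [mo no]]]].
- constructor 1; split=> //; rewrite -v0; apply: dev4_eq => //.
  by rewrite !(addr0, subr0) n4 !andbT; apply/orP.
- constructor 2; split; first exact: two.
  by rewrite -voo; apply: dev4_eq => //; rewrite n4 (two' _ n4) !andbT; apply/orP.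
- constructor 3; split=> //; rewrite -v1; apply: dev4_eq => //.
  by rewrite !(addr0, subr0) m4 /=; apply/orP.
- constructor 4; left; split; first exact: two.
  by rewrite -vN; apply: dev4_eq => //; rewrite m4 (two' _ m4) /=; apply/orP.
- constructor 4; right; split=> //.
  case: mo no => mo [no|no]; [left; rewrite -vi|right; rewrite -vj|right; rewrite -vj|left;
    rewrite -vi];
    by apply: dev4_eq => //; rewrite ?opprK mo no ?orbT.
Qed.

End TorsionValues.

(** * The homomorphism psi *)

Section Intertwiner.
Variable R : realType.
Local Notation C := R[i].
Local Notation N := (normalizer (@K4 C)).
Implicit Types (g h : SL2Z) (x y : PSU2 C) (tau z : C).

Local Notation zeta := (cexp ((pi : R)%:C * 'i / 4)).
Local Notation zetaV := (cexp (- ((pi : R)%:C * 'i / 4))).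

Lemma pi_i4 : (pi : R)%:C * 'i / 4 = 0 +i* (pi / 4).
Proof.
have -> : (4 : C)^-1 = (4^-1 : R)%:C by rewrite rmorphV ?unitfE// rmorph_nat.
by apply/eqP; rewrite eq_complex /= !mulr0 !mul0r !mulr1 !subr0 mul0r !addr0 add0r !eqxx.
Qed.

Lemma zetaE : zeta = cos (pi / 4) +i* sin (pi / 4).
Proof. by rewrite pi_i4 /cexp /= expR0 rmorph1 mul1r. Qed.

Lemma zetaVE : zetaV = cos (pi / 4) -i* sin (pi / 4).
Proof.
by rewrite pi_i4 /cexp /= oppr0 expR0 cosN sinN rmorph1 mul1r.
Qed.

Lemma zeta_conj : (zeta^*)%R = zetaV.
Proof. by rewrite zetaE zetaVE. Qed.

Lemma zeta_norm : zeta * (zeta^*)%R = 1.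
Proof.
rewrite zeta_conj zetaE zetaVE; apply/eqP; rewrite eq_complex /=.
have := cos2Dsin2 (pi / 4 : R); rewrite !expr2 => h.
by rewrite mulrN opprK h mulrN [X in _ + X]mulrC addNr !eqxx.
Qed.

Lemma zeta_sqr : zeta ^+ 2 = 'i.
Proof.
rewrite zetaE expr2; have p2 : pi / 4 + pi / 4 = pi / 2 :> R by field.
have := cosD (pi / 4 : R) (pi / 4); have := sinD (pi / 4 : R) (pi / 4).
rewrite p2 cos_pihalf sin_pihalf => h1 h2.
by apply/eqP; rewrite eq_complex /= -h2 addrC -h1 !eqxx.
Qed.

Lemma generator_T : exists x, is_image_of x (mx2 zeta 0 0 zetaV) /\
  forall p, PSU2_act x p = omap ( *%R ('i : C)) p.
Proof.
have [|x hx] := @is_image_su2 C zeta 0; first by rewrite mul0r addr0 zeta_norm.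
rewrite rmorph0 oppr0 zeta_conj in hx; exists x; split=> // p.
have zV : zetaV != 0.
  apply/eqP => z0; have := zeta_norm; rewrite zeta_conj z0 mulr0 => /eqP.
  by rewrite eq_sym oner_eq0.
rewrite (is_image_act _ hx); case: p => [w|] /=; rewrite !mxE /= ?eqxx//.
rewrite mul0r add0r addr0 (negbTE zV); congr Some.
apply: (mulIf zV); rewrite divfK//.
suff E : zeta * w = zeta ^+ 2 * w * zetaV by rewrite E zeta_sqr.
rewrite -[zetaV]zeta_conj; have -> : zeta ^+ 2 * w * (zeta^*)%R = zeta * (zeta^*)%R * (zeta *
  w) by ring.
by rewrite zeta_norm mul1r.
Qed.

Lemma generator_S : exists x, is_image_of x (('i / sqrtC 2) *: mx2 (-1) 1 1 (1 : C)) /\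
  forall p, PSU2_act x p = if p is Some w then
    if w == -1 then None else Some ((1 - w) / (1 + w)) else Some (-1).
Proof.
pose k : C := 'i / sqrtC 2.
have s0 : sqrtC 2 != 0 :> C by rewrite sqrtC_eq0 pnatr_eq0.
have k0 : k != 0 by rewrite mulf_neq0 ?invr_eq0// neq0Ci.
have sJ : ((sqrtC (2 : C))^*)%R = sqrtC 2.
  by apply/CrealP/ger0_real; rewrite sqrtC_ge0 ler0n.
(* [k] is purely imaginary with square -1/2, so the scaled matrix has the shape of [is_image_su2]
   with [a = - k] and [b = k]. *)
have kJ : (k^*)%R = - k.
  by rewrite /k rmorphM fmorphV; rewrite /= sJ conjCi mulNr.
have kk : k * k = - 2^-1.
  by rewrite /k mulf_div -expr2 sqrCi -expr2 sqrtCK mulN1r.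
have [|x hx] := @is_image_su2 C (- k) k.
  by rewrite rmorphN /= kJ opprK mulrN mulNr kk opprK; field.
rewrite rmorphN /= kJ !opprK in hx.
have E : k *: mx2 (-1) 1 1 1 = mx2 (- k) k k k.
  by apply: mx2_eqP; rewrite !mxE /= ?mulr1 ?mulrN1.
rewrite -/k E; exists x; split=> // p.
rewrite (is_image_act _ hx); case: p => [w|] /=; rewrite !mxE /=; last first.
  by rewrite (negbTE k0) mulNr divff.
have -> : k * w + k = k * (1 + w) by ring.
have -> : - k * w + k = k * (1 - w) by ring.
rewrite mulf_eq0 (negbTE k0) /= addrC addr_eq0; case: eqP => // _.
by rewrite -mulf_div divff// mul1r.
Qed.

(** The graph of [psi], written as a relation so that it can be propagated from the generators
    through products and inverses. *)
Definition intertwines g x := N x /\ forall z tau, 0 < complex.Im tau ->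
  dev_map ((autj g tau)^-1 * z) (SL2Z_act g tau) = PSU2_act x (dev_map z tau).

(** Division by [autj g tau] carries the half lattice point of index [(m', n')] for [tau] to the one
    of index [(m, n)] for the image parameter. *)
Lemma intertwines_act g x tau m n m' n' : 0 < complex.Im tau -> intertwines g x ->
  m' = m * g 1 1 + n * g 0 1 -> n' = m * g 1 0 + n * g 0 0 ->
  PSU2_act x (dev4 tau m' n') = dev4 (SL2Z_act g tau) m n.
Proof.
move=> t0 [_ h] -> ->; rewrite /dev4 -(h _ _ t0); congr (dev_map _ _).
have /(congr1 ( *%R 2)) := quarter_act g m n t0; rewrite /quarter => E.
have -> : (m%:~R + n%:~R * SL2Z_act g tau) / 2 = 2 * ((m%:~R + n%:~R * SL2Z_act g tau) / 4)
  by field.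
by rewrite E; field; exact: autj_neq0.
Qed.

Lemma intertwines_unique g x y : intertwines g x -> intertwines g y -> x = y.
Proof.
move=> [_ hx] [_ hy]; have t0 := Im_i_gt0 R.
have [[v0 voo v1] _ _ _] := dev4_values t0.
apply: PSU2_act_inj => p; rewrite !inE => /or3P[]/eqP ->.
- by rewrite -v0 /dev4 -(hx _ _ t0) (hy _ _ t0).
- by rewrite -voo /dev4 -(hx _ _ t0) (hy _ _ t0).
- by rewrite -v1 /dev4 -(hx _ _ t0) (hy _ _ t0).
Qed.

Lemma intertwines1 : intertwines 1%g 1%g.
Proof.
split=> [|z tau t0]; first exact: normalizer_one.
by rewrite PSU2_act1 autj1 SL2Z_act1 invr1 mul1r.
Qed.

Lemma intertwinesM g h x y : intertwines g x -> intertwines h y ->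
  intertwines (g * h)%g (x * y)%g.
Proof.
move=> [Nx hx] [Ny hy]; split=> [|z tau t0]; first exact: normalizer_mul.
rewrite PSU2_actM -(hy _ _ t0) -(hx _ _ (Im_SL2Z_act h t0)).
by rewrite (autjM _ _ t0) (SL2Z_actM _ _ t0) invfM mulrA.
Qed.

Lemma intertwinesV g x : intertwines g x -> intertwines g^-1%g x^-1%g.
Proof.
move=> [Nx hx]; split=> [|z tau t0]; first exact: normalizer_inv.
have t0' := Im_SL2Z_act g^-1%g t0.
have tE : SL2Z_act g (SL2Z_act g^-1%g tau) = tau by rewrite -SL2Z_actM// mulgV SL2Z_act1.
have jE : autj g (SL2Z_act g^-1%g tau) * autj g^-1%g tau = 1 by rewrite -autjM// mulgV autj1.
rewrite -[LHS](PSU2_actK x) -(hx _ _ t0') tE; congr (PSU2_act _ (dev_map _ _)).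
by rewrite mulrA -invfM jE invr1 mul1r.
Qed.

Lemma intertwines_T x : (forall p, PSU2_act x p = omap ( *%R ('i : C)) p) ->
  intertwines SL2Z_T x.
Proof.
move=> hx; split=> [|z tau t0]; first exact: normalizer_T.
by rewrite hx dev_map_T.
Qed.

Lemma intertwines_S x : (forall p, PSU2_act x p = if p is Some w then
    if w == -1 then None else Some ((1 - w) / (1 + w)) else Some (-1)) ->
  intertwines SL2Z_S x.
Proof.
move=> hx; split=> [|z tau t0]; first exact: normalizer_S.
by rewrite hx dev_map_S.
Qed.

Lemma intertwiner_exists g : exists x, intertwines g x.
Proof.
apply: (@SL2Z_generated (fun g => exists x, intertwines g x)).
- by exists 1%g; exact: intertwines1.
- by move=> {}g h [x hx] [y hy]; exists (x * y)%g; exact: intertwinesM.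
- by move=> {}g [x hx]; exists x^-1%g; exact: intertwinesV.
- by have [x [_ hx]] := generator_T; exists x; exact: intertwines_T.
- by have [x [_ hx]] := generator_S; exists x; exact: intertwines_S.
Qed.

Definition plus_minus_Gamma4 g := [/\ (4 %| (g 0 1)%R)%Z, (4 %| (g 1 0)%R)%Z &
  (4 %| (g 0 0)%R - 1)%Z && (4 %| (g 1 1)%R - 1)%Z || (4 %| (g 0 0)%R + 1)%Z && (4 %| (g 1
    1)%R + 1)%Z].

Lemma SL2Z_row_not_even g : ~~ ((2 %| (g 1 1)%R)%Z && (2 %| (g 1 0)%R)%Z) /\
  ~~ ((2 %| (g 0 1)%R)%Z && (2 %| (g 0 0)%R)%Z).
Proof.
have det := SL2Z_det2 g; split; apply/negP => /andP[/dvdzP[p pE] /dvdzP[q qE]];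
  move: det; rewrite pE qE.
  have -> : g 0 0 * (p * 2) - g 0 1 * (q * 2) = 2 * (g 0 0 * p - g 0 1 * q) by ring.
  by lia.
have -> : q * 2 * g 1 1 - p * 2 * g 1 0 = 2 * (q * g 1 1 - p * g 1 0) by ring.
by lia.
Qed.

Lemma SL2Z_row_not_mul4 g : ~~ ((4 %| (g 1 1)%R)%Z && (4 %| (g 1 0)%R)%Z) /\
  ~~ ((4 %| (g 0 1)%R)%Z && (4 %| (g 0 0)%R)%Z).
Proof.
have h (k : int) : (4 %| k)%Z -> (2 %| k)%Z by apply: dvdz_trans.
by have [h1 h2] := SL2Z_row_not_even g; split; [apply: contra h1|apply: contra h2] =>
  /andP[/h -> /h ->].
Qed.

(** Modulo 4 the determinant leaves [a d = 1], and the only units are 1 and -1. *)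
Lemma odd_unit_sign (a d b c : int) : (4 %| b)%Z -> (4 %| c)%Z -> a * d - b * c = 1 ->
  (4 %| a - 1)%Z && (4 %| d - 1)%Z || (4 %| a + 1)%Z && (4 %| d + 1)%Z.
Proof.
move=> /dvdzP[p ->] /dvdzP[q ->] det.
have := divz_eq a 4; have := @ltz_mod a 4 isT; have := @modz_ge0 a 4 isT.
have := divz_eq d 4; have := @ltz_mod d 4 isT; have := @modz_ge0 d 4 isT.
move: (divz a 4) (modz a 4) (divz d 4) (modz d 4) => s r t u u0 u4 dE r0 r4 aE.
have E : r * u = 1 + 4 * (4 * p * q - 4 * s * t - s * u - r * t).
  by move: det; rewrite aE dE; lia.
move: (4 * p * q - _ - _ - _) E => k E.
have [[r1 u1]|[r3 u3]] : (r = 1 /\ u = 1) \/ (r = 3 /\ u = 3).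
  have : [|| r == 0, r == 1, r == 2 | r == 3] by lia.
  case/or4P=> /eqP rE; rewrite rE in E; lia.
  apply/orP; left; apply/andP; split; apply/dvdzP; [exists s|exists t]; lia.
apply/orP; right; apply/andP; split; apply/dvdzP; [exists (s + 1)|exists (t + 1)]; lia.
Qed.

(** Fixing 0 forces 4 to divide [g 1 0], fixing 1 forces it to divide [g 0 1], and the determinant
    settles the diagonal. Conversely the congruences preserve the classes of the indices (1, 0), (0,
    1) and (1, 2), where f is 0, 1 and infinity. *)
Lemma intertwiner_trivial g x : intertwines g x -> (x = 1%g <-> plus_minus_Gamma4 g).
Proof.
move=> gx; have [t t0] : exists t : C, 0 < complex.Im t by exists 'i; exact: Im_i_gt0.
have t0' := Im_SL2Z_act g t0.
have [[v0 voo v1] _ _ _] := dev4_values t0.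
have [[w0 woo w1] _ _ _] := dev4_values t0'.
have [row1 row0] := SL2Z_row_not_even g; have [row1' row0'] := SL2Z_row_not_mul4 g.
have a0 := intertwines_act (m := 1) (n := 0) (m' := g 1 1) (n' := g 1 0) t0 gx.
have a1 := intertwines_act (m := 0) (n := 1) (m' := g 0 1) (n' := g 0 0) t0 gx.
have aoo := intertwines_act (m := 1) (n := 2) t0 gx erefl erefl.
rewrite !mul1r !mul0r !addr0 in a0; rewrite !mul1r !mul0r !add0r in a1.
have {a0} a0 := a0 erefl erefl; have {a1} a1 := a1 erefl erefl.
rewrite w0 in a0; rewrite w1 in a1; rewrite woo !mul1r in aoo.
have det := SL2Z_det2 g.
have i0 : (('i : C) == 0) = false := negbTE (neq0Ci _).
split=> [x1|[b4 c4 ad]].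
  rewrite x1 PSU2_act1 in a0; rewrite x1 PSU2_act1 in a1.
  have [c4 b4] : (4 %| (g 1 0)%R)%Z /\ (4 %| (g 0 1)%R)%Z.
    split.
      case: (dev4_class t0 row1) => [[]//|[_]|[_]|[[_]|[_ _ []]]]; rewrite a0 // => /Some_inj/eqP.
      - by rewrite eq_sym oner_eq0.
      - by rewrite eq_sym oppr_eq0 oner_eq0.
      - by rewrite eq_sym oppr_eq0 i0.
      - by rewrite eq_sym i0.
    case: (dev4_class t0 row0) => [[_]|[_]|[]//|[[_]|[_ _ []]]]; rewrite a1 // => /Some_inj/eqP.
    - by rewrite oner_eq0.
    - by rewrite one_neqN1.
    - by rewrite eq_complex /= oppr0 oner_eq0.
    - by rewrite eq_complex /= oner_eq0.
  by split=> //; exact: odd_unit_sign b4 c4 det.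
have f0 : dev4 t (g 1 1) (g 1 0) = Some 0.
  apply: etrans v0; apply: dev4_eq => //; rewrite !(subr0, addr0) c4 !andbT.
  by move: ad => /orP[]/andP[_ ->]; rewrite ?orbT.
have f1 : dev4 t (g 0 1) (g 0 0) = Some 1.
  apply: etrans v1; apply: dev4_eq => //; rewrite !(subr0, addr0) b4 /=.
  by move: ad => /orP[]/andP[-> _]; rewrite ?orbT.
have foo : dev4 t (g 1 1 + 2 * g 0 1) (g 1 0 + 2 * g 0 0) = None.
  have [p pE] := dvdzP b4; have [q qE] := dvdzP c4.
  have e : (4 %| (g 1 1)%R + 2 * (g 0 1)%R - 1)%Z && (4 %| (g 1 0)%R + 2 * (g 0 0)%R - 2)%Z
      || (4 %| (g 1 1)%R + 2 * (g 0 1)%R + 1)%Z && (4 %| (g 1 0)%R + 2 * (g 0 0)%R + 2)%Z.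
    move: ad => /orP[]/andP[/dvdzP[s sE] /dvdzP[u uE]]; apply/orP; [left|right];
      apply/andP; split; apply/dvdzP; rewrite ?pE ?qE.
    - by exists (u + 2 * p); lia.
    - by exists (q + 2 * s); lia.
    - by exists (u + 2 * p); lia.
    - by exists (q + 2 * s); lia.
  apply: etrans voo; apply: dev4_eq => //.
  apply/negP => /andP[/dvdzP[u uE] _].
  by move: e => /orP[]/andP[/dvdzP[w wE] _]; lia.
apply: PSU2_act_fix3.
- by rewrite f0 in a0.
- by rewrite foo in aoo.
- by rewrite f1 in a1.
Qed.

Lemma GammaP (d : nat) g : Gamma d g <->
  [/\ (d %| (g 0 0)%R - 1)%Z, (d %| (g 0 1)%R)%Z, (d %| (g 1 0)%R)%Z & (d %| (g 1 1)%R - 1)%Z].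
Proof.
have E (u v : int) : (u = v %[mod d])%Z <-> (d %| u - v)%Z.
  by rewrite -eqz_mod_dvd; split=> /eqP.
split=> [h|[h1 h2 h3 h4]].
  have := h 0 0; have := h 0 1; have := h 1 0; have := h 1 1.
  by rewrite !mxE /= => /E h11 /E + /E + /E h00; rewrite !subr0.
by apply: ord2P; apply: ord2P; rewrite !mxE /=; apply/E; rewrite ?subr0.
Qed.

Lemma K4_inv x : K4 x -> K4 x^-1%g.
Proof.
have [t [s [r [ht hs hr hK]]]] := K4_generators C.
have invo : (x * x)%g = 1%g -> x^-1%g = x.
  by move=> xx; rewrite -[LHS]mulg1 -xx mulKg.
move=> xK; rewrite invo//; move/hK: xK => [] ->; first by rewrite mulg1.
- by apply: PSU2_act_inj => p; rewrite !inE => /or3P[]/eqP ->;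
    rewrite PSU2_actM PSU2_act1 !ht /= ?opprK.
- by apply: PSU2_act_inj => p; rewrite !inE => /or3P[]/eqP ->;
    rewrite PSU2_actM PSU2_act1 !hs /= ?eqxx ?oner_eq0 /= ?eqxx ?invr1 ?oner_eq0 ?invr1.
- apply: PSU2_act_inj => p; rewrite !inE => /or3P[]/eqP ->;
    rewrite PSU2_actM PSU2_act1 !hr /act_Ninv /= ?eqxx ?oner_eq0 /= ?oppr0 ?eqxx ?oner_eq0//=.
  by rewrite invr1 oppr_eq0 oner_eq0 /= invrN1 opprK.
Qed.

(** [K4] consists of the elements preserving both the pair 0, infinity and the pair 1, -1. The first
    pair is taken at indices with [m] odd and [n] even, the second at those with [m] even and [n]
    odd, so the condition is a parity condition on [g]. *)
Lemma intertwiner_K4 g x : intertwines g x -> (K4 x <-> Gamma 2 g).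
Proof.
move=> gx; have [t t0] : exists t : C, 0 < complex.Im t by exists 'i; exact: Im_i_gt0.
have t0' := Im_SL2Z_act g t0.
have [[w0 woo w1] _ _ _] := dev4_values t0'.
have [row1 row0] := SL2Z_row_not_even g.
have a0 := intertwines_act (m := 1) (n := 0) (m' := g 1 1) (n' := g 1 0) t0 gx.
have a1 := intertwines_act (m := 0) (n := 1) (m' := g 0 1) (n' := g 0 0) t0 gx.
have aoo := intertwines_act (m := 1) (n := 2) t0 gx erefl erefl.
rewrite !mul1r !mul0r !addr0 in a0; rewrite !mul1r !mul0r !add0r in a1.
have {a0} a0 := a0 erefl erefl; have {a1} a1 := a1 erefl erefl.
rewrite w0 in a0; rewrite w1 in a1; rewrite woo !mul1r in aoo.
have det := SL2Z_det2 g.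
have [tt [s [r [ht hs hr hK]]]] := K4_generators C.
have i0 : (('i : C) == 0) = false := negbTE (neq0Ci _).
split=> [/hK xK|/GammaP[a2 b2 c2 d2]].
  have p0 : dev4 t (g 1 1) (g 1 0) = Some 0 \/ dev4 t (g 1 1) (g 1 0) = None.
    move: a0 xK; case: (dev4 _ _ _) => [w|]; last by right.
    move=> a0 xK; left; move: a0; case: xK => ->; rewrite ?PSU2_act1 ?ht ?hs ?hr //=.
    - by move=> /Some_inj/eqP; rewrite oppr_eq0 => /eqP ->.
    - by case: eqP => // /eqP wn0 /Some_inj/eqP; rewrite invr_eq0 (negbTE wn0).
    - by rewrite /act_Ninv /=; case: eqP => //= /eqP wn0 /Some_inj/eqP;
      rewrite oppr_eq0 invr_eq0 (negbTE wn0).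
  have p1 : dev4 t (g 0 1) (g 0 0) = Some 1 \/ dev4 t (g 0 1) (g 0 0) = Some (-1).
    move: a1 xK; case: (dev4 _ _ _) => [w|] a1 xK; move: a1; case: xK => ->;
      rewrite ?PSU2_act1 ?ht ?hs ?hr //= /act_Ninv /= ?oppr0.
    - by left.
    - by move=> /Some_inj/eqP; rewrite eqr_oppLR => /eqP ->; right.
    - by case: eqP => // _ /Some_inj/eqP; rewrite invr_eq1 => /eqP ->; left.
    - by case: eqP => //= _ /Some_inj/eqP; rewrite eqr_oppLR => /eqP wV; right;
      rewrite -[w]invrK wV invrN1.
    - by move=> /Some_inj/eqP; rewrite eq_sym oner_eq0.
    - by move=> /Some_inj/eqP; rewrite eq_sym oner_eq0.
  have c2 : (2 %| (g 1 0)%R)%Z.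
    case: (dev4_class t0 row1) => [[n4 _]|[]//|[_ E]|[[_ E]|[_ _ E]]].
    - exact: dvdz_trans n4.
    - case: p0; rewrite E // => /Some_inj/eqP; by rewrite oner_eq0.
    - case: p0; rewrite E // => /Some_inj/eqP; by rewrite oppr_eq0 oner_eq0.
    - case: p0; case: E => -> // /Some_inj/eqP; by rewrite ?oppr_eq0 i0.
  have b2 : (2 %| (g 0 1)%R)%Z.
    case: (dev4_class t0 row0) => [[_ E]|[_ E]|[n4 _]|[[n2 _]|[_ _ E]]] //.
    - case: p1; rewrite E // => /Some_inj/eqP; by rewrite eq_sym ?oppr_eq0 oner_eq0.
    - by case: p1; rewrite E.
    - exact: dvdz_trans n4.
    - by case: p1; case: E => -> // /Some_inj/eqP;
        rewrite eq_complex /= ?oppr0 ?oppr_eq0 ?oner_eq0 ?andbF // eq_sym ?oppr_eq0 oner_eq0.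
  have odd (k : int) : ~~ (2 %| k)%Z -> (2 %| k - 1)%Z by move=> k2; lia.
  apply/GammaP; split=> //; apply: odd; [by move: row0; rewrite b2|by move: row1;
    rewrite c2 andbT].
have od (k : int) : (2 %| k - 1)%Z -> (2 %| k)%Z -> False.
  by move=> /dvdzP[u uE] /dvdzP[v vE]; lia.
have dval m n : (2 %| m - 1)%Z -> (2 %| n)%Z -> dev4 t m n = Some 0 \/ dev4 t m n = None.
  move=> m1 n2; have mn : ~~ ((2 %| m)%Z && (2 %| n)%Z) by apply/negP => /andP[/(od _ m1)].
  case: (dev4_class t0 mn) => [[_ E]|[_ E]|[m4 _]|[[m2 _]|[_ n2' _]]]; [by left|by right| | |].
  - by exfalso; apply: (od _ m1); exact: dvdz_trans m4.
  - by case: (od _ m1 m2).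
  - by rewrite n2 in n2'.
have p1 : dev4 t (g 0 1) (g 0 0) = Some 1 \/ dev4 t (g 0 1) (g 0 0) = Some (-1).
  case: (dev4_class t0 row0) => [[n4 _]|[n2 _]|[_ E]|[[_ E]|[m2' _ _]]]; [| |by left|by right|].
  - by exfalso; apply: (od _ a2); exact: dvdz_trans n4.
  - by case: (od _ a2 n2).
  - by rewrite b2 in m2'.
have p0 := dval _ _ d2 c2.
have poo : dev4 t (g 1 1 + 2 * g 0 1) (g 1 0 + 2 * g 0 0) = Some 0 \/
    dev4 t (g 1 1 + 2 * g 0 1) (g 1 0 + 2 * g 0 0) = None.
  apply: dval; first by rewrite addrAC rpredD// dvdz_mulr.
  by rewrite rpredD// dvdz_mulr.
(* The functional equation gives the preimages of 0, 1 and infinity under [x], hence identifies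
   [x^-1]; [K4_inv] leads back to [x]. *)
have inv0 : PSU2_act x^-1%g (Some 0) = dev4 t (g 1 1) (g 1 0) by rewrite -[RHS](PSU2_actK x) a0.
have inv1 : PSU2_act x^-1%g (Some 1) = dev4 t (g 0 1) (g 0 0) by rewrite -[RHS](PSU2_actK x) a1.
have invoo : PSU2_act x^-1%g None = dev4 t (g 1 1 + 2 * g 0 1) (g 1 0 + 2 * g 0 0).
  by rewrite -[RHS](PSU2_actK x) aoo.
have ne : dev4 t (g 1 1) (g 1 0) <> dev4 t (g 1 1 + 2 * g 0 1) (g 1 0 + 2 * g 0 0).
  by move=> E; move: a0; rewrite E aoo.
rewrite -[x]invgK; apply: K4_inv; apply/hK.
have eq3 y : PSU2_act y (Some 0) = PSU2_act x^-1%g (Some 0) ->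
    PSU2_act y None = PSU2_act x^-1%g None ->
    PSU2_act y (Some 1) = PSU2_act x^-1%g (Some 1) -> x^-1%g = y.
  move=> h1 h2 h3; apply: PSU2_act_inj => p; rewrite !inE => /or3P[]/eqP ->.
  - exact: esym h1.
  - exact: esym h2.
  - exact: esym h3.
rewrite inv0 inv1 invoo in eq3.
case: p0 poo p1 => E0 [Eoo|Eoo] [E1|E1]; rewrite E0 Eoo ?E1 in ne eq3 => //.
- by constructor 1; apply: eq3; rewrite PSU2_act1.
- by constructor 2; apply: eq3; rewrite ht /= ?oppr0.
- by constructor 3; apply: eq3; rewrite hs /= ?eqxx ?oner_eq0 ?invr1.
- by constructor 4; apply: eq3; rewrite hr /act_Ninv /= ?eqxx ?oner_eq0 ?invr1 ?oppr0.
Qed.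

End Intertwiner.

Section Generated.

Fact SL2Z_N1_subproof : \det (- 1%:M : 'M[int]_2) == 1.
Proof. by rewrite det2 !mxE. Qed.

Definition SL2Z_N1 : SL2Z := MkSL2Z SL2Z_N1_subproof.

Lemma SL2Z_N1E : (SL2Z_N1 0 0 = -1) * (SL2Z_N1 0 1 = 0) * (SL2Z_N1 1 0 = 0) * (SL2Z_N1 1 1 = -1).
Proof. by rewrite !mxE /= oppr0. Qed.

(** An element satisfying the congruences lies in [Gamma 4] either itself or after multiplication by
    minus the identity. The other inclusion uses that [K], later a kernel, is a group. *)
Lemma generated_pm_Gamma4 (K : set SL2Z) :
  (forall h, K h <-> plus_minus_Gamma4 h) -> group_closed [in K] ->
  K = generated ([set h : SL2Z | SL2Z_mx h = 1%:M \/ SL2Z_mx h = - 1%:M] `|` Gamma 4).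
Proof.
move=> hK gK; apply/seteqP; split=> h; last first.
  apply; split=> // k [[k1|k1]|/GammaP[a b c d]]; apply/hK; split=> //.
  - by rewrite k1 mxE.
  - by rewrite k1 mxE.
  - by rewrite k1 !mxE.
  - by rewrite k1 !mxE.
  - by rewrite k1 !mxE.
  - by rewrite k1 !mxE.
  - by rewrite a d.
move=> /hK[b4 c4 /orP[]/andP[a4 d4]] M [gM sM].
  by apply: sM; right; apply/GammaP.
have hN : M (SL2Z_N1 * h)%g.
  apply: sM; right; apply/GammaP; rewrite !SL2Z_mulE !SL2Z_N1E.
  have E (u v : int) : -1 * u + 0 * v = - u by ring.
  have E' (u v : int) : 0 * u + -1 * v = - v by ring.
  have N4 (u : int) : (4 %| - u)%Z = (4 %| u)%Z by rewrite !dvdzE abszN.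
  by rewrite !E !E' -!opprD !N4.
have MN : M SL2Z_N1 by apply: sM; left; right.
have -> : h = (SL2Z_N1 * (SL2Z_N1 * h))%g.
  by apply: SL2Z_eqP; rewrite !SL2Z_mulE !SL2Z_N1E; ring.
apply/set_mem; exact: (group_closedM gM (mem_set MN) (mem_set hN)).
Qed.

End Generated.

Theorem proposition4p3 (R : realType) :
  exists psi : SL2Z -> PSU2 R[i],
    unique (@is_psi R) psi /\
    [/\ range psi = normalizer (@K4 R[i]),
        psi @^-1` [set 1%g] =
          generated ([set g : SL2Z | SL2Z_mx g = 1%:M \/ SL2Z_mx g = - 1%:M]
                     `|` Gamma 4) &
        psi @^-1` (@K4 R[i]) = Gamma 2] /\
    is_image_of (psi SL2Z_T)
      (mx2 (cexp ((pi : R)%:C * 'i / 4)) 0 0 (cexp (- ((pi : R)%:C * 'i / 4))))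
    /\
    is_image_of (psi SL2Z_S) (('i / sqrtC 2) *: mx2 (-1) 1 1 1).
Proof.
(* A pointwise choice suffices: uniqueness of the intertwiner makes it multiplicative. *)
have [psi hpsi] := choice (@intertwiner_exists R).
have psiM g h : psi (g * h)%g = (psi g * psi h)%g.
  exact: intertwines_unique (hpsi _) (intertwinesM (hpsi g) (hpsi h)).
have psi1 : psi 1%g = 1%g := intertwines_unique (hpsi _) (@intertwines1 R).
have psiV g : psi g^-1%g = (psi g)^-1%g.
  exact: intertwines_unique (hpsi _) (intertwinesV (hpsi g)).
have [xT [imT actT]] := generator_T R; have [xS [imS actS]] := generator_S R.
have psiT : psi SL2Z_T = xT by exact: intertwines_unique (hpsi _) (intertwines_T actT).
have psiS : psi SL2Z_S = xS by exact: intertwines_unique (hpsi _) (intertwines_S actS).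
exists psi; split; [split|split; [split|split]].
- split=> [g h|g|g z tau t0]; [exact: psiM|exact: (hpsi g).1|exact: (hpsi g).2].
- move=> psi' [_ h1 h2]; apply/funext => g; apply: (intertwines_unique (hpsi g)).
  by split=> [|z tau]; [exact: h1|exact: h2].
- apply/seteqP; split=> [_ [g _ <-]|x Nx]; first exact: (hpsi g).1.
  apply: (normalizer_generated actT actS (G := range psi)) Nx.
  + by exists 1%g.
  + by move=> _ _ [g _ <-] [h _ <-]; exists (g * h)%g; rewrite // psiM.
  + by move=> _ [g _ <-]; exists g^-1%g; rewrite // psiV.
  + by exists SL2Z_T.
  + by exists SL2Z_S.
- apply: generated_pm_Gamma4 => [h|]; first exact: (intertwiner_trivial (hpsi h)).
  split; first by apply/mem_set.
  move=> g h /set_mem g1 /set_mem h1; apply/mem_set.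
  by rewrite /= psiM psiV g1 h1 invg1 mulg1.
- by apply/seteqP; split=> g /(intertwiner_K4 (hpsi g)).
- by rewrite psiT.
- by rewrite psiS.
Qed.
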